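(* The spatio-temporal triangulation method $\mathcal{T}_{ST}$ is affine-invariant: let $\mathcal{O}=\{\mathcal{O}_1,\ldots,\mathcal{O}_n\}$ and $\mathcal{O}'=\{\mathcal{O}'_1,\ldots,\mathcal{O}'_m\}$ be geometric objects such that for each moment $\tau_0$ in their time domains there is an affinity $\alpha_{\tau_0}:\mathbb{R}^2\to\mathbb{R}^2$ with $\alpha_{\tau_0}(\mathcal{O}^{\tau_0})=\mathcal{O}'^{\tau_0}$. Then for each such $\tau_0$ also $\alpha_{\tau_0}\big(\mathcal{T}_{ST}(\mathcal{O})^{\tau_0}\big)=\mathcal{T}_{ST}(\mathcal{O}')^{\tau_0}$, where $\mathcal{T}_{ST}(\cdot)^{\tau_0}$ denotes the collection of triangles that are the snapshots at $\tau_0$ of the atomic objects of the output existing at $\tau_0$.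
   Context: Affinity: an invertible affine map of $\mathbb{R}^2$. Atomic geometric objects. An atomic geometric object is a triple $(S,I,f)$ where $S\subset\mathbb{R}^2$ is a closed filled triangle (possibly degenerate to a segment or a point) with rational or real algebraic corner points; $I\subset\mathbb{R}$ is a point or an interval, given by its two end points (rational or algebraic numbers); and $f:\mathbb{R}^2\times\mathbb{R}\to\mathbb{R}^2$ is a time-dependent affinity $f(x,y;t)=A(t)\binom{x}{y}+b(t)$, where all entries of the $2\times2$ matrix $A(t)$ and of the vector $b(t)$ are rational functions $p_1(t)/p_2(t)$ with $p_1,p_2$ polynomials with rational coefficients, well-defined on $I$, and $\det A(t)\ne0$ for all $t\in I$ (in objects produced by the algorithm, real algebraic coefficients are allowed). A geometric object $\mathcal{O}=\{(S_i,I_i,f_i)\}_{i}$ is a finite set of atomic geometric objects; its time domain is the convex closure of the union of the $I_i$. Its snapshot at time $\tau$ is the set $\mathcal{O}^\tau=\bigcup_{i:\tau\in I_i}f_i(S_i,\tau)\subseteq\mathbb{R}^2$, given by the triangles $f_i(S_i,\tau)$. Standing assumption: every nonempty snapshot of the inputs is fully two-dimensional, i.e. equals the union of the nondegenerate triangles $f_i(S_i,\tau)$, $\tau\in I_i$. Procedure Partition. On input $\mathcal{O}$: (1) Let $\chi$ be the sorted list of all begin and end points of the $I_i$. (2) Let $\mathcal{C}$ be the set of all triples $(S_{i,\ell},I_i,f_i)$, where $S_{i,1},S_{i,2},S_{i,3}$ are the (nondegenerate) boundary segments of $S_i$; the carrier at time $t\in I_i$ of such an element is the line through $f_i(S_{i,\ell},t)$.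 (3) For all pairs of distinct elements of $\mathcal{C}$ whose time domains have nonempty intersection $J$, add to $\chi$ those moments in $J$ that are end points of maximal intervals on which the type of intersection of the two carriers (empty, a single point, or a whole line) is constant. (4) For all triples of distinct elements of $\mathcal{C}$ whose time domains have nonempty intersection $J$, add to $\chi$ those moments in $J$ that are end points of maximal intervals during which the three carriers intersect in one point. (5) Return the sorted list $\chi=(\tau_1<\cdots<\tau_k)$, which represents the partition of the time domain into the points $\tau_j$ and the open intervals $]\tau_j,\tau_{j+1}[$. Spatial algorithm $\mathcal{T}_S$. On input a set $S\subseteq\mathbb{R}^2$ given as a union of finitely many triangles: consider all lines through those edges of input triangles that contain a nondegenerate segment of the topological boundary of $S$; these lines subdivide the convex hull of $S$ into convex polygonal faces; for each face with vertices $v_1,\ldots,v_c$ in cyclic order let $a=\frac1c\sum_i v_i$, and if $a\in S$ output the closed triangles with corner points $a,v_i,v_{i+1}$ ($v_{c+1}=v_1$). $\mathcal{T}_S(\emptyset)=\emptyset$. Procedure Triangulate. On input $\mathcal{O}$ and $\chi$: (i) for each $\tau_j$ in $\chi$ and each triangle $T\in\mathcal{T}_S(\mathcal{O}^{\tau_j})$, output $(T,\{\tau_j\},Id)$. (ii) For each pair of consecutive moments $\tau_j,\tau_{j+1}$ let $\tau_m=\frac12(\tau_j+\tau_{j+1})$ and compute $\mathcal{T}_S(\mathcal{O}^{\tau_m})$, carrying along with every point constructed (corner points of $f_i(S_i,\tau_m)$, intersection points of carriers, averages of face vertices) the corresponding moving point, whose coordinates are rational functions of $t$ on $]\tau_j,\tau_{j+1}[$.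 For each triangle $T$ of $\mathcal{T}_S(\mathcal{O}^{\tau_m})$ output $(T,]\tau_j,\tau_{j+1}[,f)$, where $f$ is the time-dependent affinity mapping each corner point of $T$ at time $t$ to its associated moving point at time $t$. Procedure Merge. Runs through the elements of the time partition in order, merging two consecutive ones when possible. A point $\tau$ and an adjacent interval $J$ are merged if there is a one-to-one correspondence between the atomic objects with time domain $J$ and those with time domain $\{\tau\}$ such that for corresponding $(S,J,f)$ and $(S',\{\tau\},Id)$, $\tau$ is in the domain of $f$ (coefficients well-defined, nonzero determinant) and $f(S,\tau)=S'$; then the objects at $\tau$ are deleted and the time domains $J$ extended to $J\cup\{\tau\}$. Two adjacent intervals with common end point $\tau$ are merged if the transformation functions of the objects of each interval are defined on the other, the objects correspond one-to-one with equal triangles at $\tau$, and the transformation functions of corresponding objects agree after changing to a common reference triangle; corresponding objects are then replaced by one object on the union interval. $\mathcal{T}_{ST}$: on input $\mathcal{O}$, compute $\chi$ by Partition, apply Triangulate to $\mathcal{O}$ and $\chi$, and, if $\chi$ has more than one element, apply Merge to the result. *)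

(* Defs.v *)
From HB Require Import structures.
From mathcomp Require Import all_boot all_order all_algebra.
From mathcomp Require Import finmap.
From mathcomp Require Import all_classical all_reals all_analysis.
Set Implicit Arguments.
Unset Strict Implicit.
Unset Printing Implicit Defensive.
Import Order.TTheory GRing.Theory Num.Theory.
Import numFieldTopology.Exports numFieldNormedType.Exports.
Local Open Scope classical_set_scope.
Local Open Scope ring_scope.

Notation pt R := 'cV[R]_2.
Notation ratfun R := {fraction {poly R}}.

Section Geometry.
Context {R : realType}.
Implicit Types (p q r v : pt R) (A S T F e l : set (pt R)).

Definition hull A : set (pt R) := smallest (@convex_set R (pt R)) A.

Definition segment p q : set (pt R) := hull [set p; q].

Definition triangle p q r : set (pt R) := hull [set p; q; r].

Definition collinear p q r : Prop := \det (row_mx (q - p) (r - p)) = 0.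

Definition nondegenerate T : Prop :=
  exists p q r, ~ collinear p q r /\ T = triangle p q r.

(* Extreme point of a convex set: the corners of a triangle (the two end
   points, or the single point, if it is degenerate) and the vertices of a
   convex polygon. *)
Definition extreme F v : Prop :=
  F v /\ forall p q (s : R), F p -> F q -> 0 < s < 1 ->
    v = (1 - s) *: p + s *: q -> p = q.

(* A triangle degenerate to a segment has that segment as its only edge; a
   point has no edge. *)
Definition edge T e : Prop :=
  exists p q, [/\ extreme T p, extreme T q, p <> q & e = segment p q].

Definition line_through e : set (pt R) :=
  [set v | exists p q (s : R), [/\ e p, e q, p <> q & v = p + s *: (q - p)]].

Definition boundary S : set (pt R) := closure S `\` interior S.

Definition has_boundary_segment S e : Prop :=
  exists p q, p <> q /\ segment p q `<=` e `&` boundary S.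

Definition affinity (a : pt R -> pt R) : Prop :=
  exists (M : 'M[R]_2) (b : pt R), M \in unitmx /\ forall v, a v = M *m v + b.

Definition centroid (vs : seq (pt R)) : pt R :=
  (size vs)%:R^-1 *: \sum_(v <- vs) v.

End Geometry.

(* The spatial triangulation of the union of a set of triangles. *)
Section SpatialTriangulation.
Context {R : realType}.
Implicit Types (Ts : set (set (pt R))) (F T l : set (pt R)) (vs : seq (pt R)).

Definition figure Ts : set (pt R) := \bigcup_(T in Ts) T.

Definition ts_line Ts l : Prop :=
  exists T e, [/\ Ts T, edge T e, has_boundary_segment (figure Ts) e
                & l = line_through e].

Definition ts_face Ts F : Prop :=
  let D := hull (figure Ts) `\` \bigcup_(l in ts_line Ts) l in
  exists2 x, D x & F = closure (connected_component D x).

(* vs lists the vertices of the convex polygon F in cyclic order, in one of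
   the two directions: consecutive vertices are joined by sides of F. *)
Definition cyclic_vertices F vs : Prop :=
  [/\ uniq vs, forall v, v \in vs <-> extreme F v
    & forall v, v \in vs -> segment v (next vs v) `<=` boundary F].

(* vs are the vertices of a face that is triangulated *)
Definition ts_kept_face Ts vs : Prop :=
  [/\ exists2 F, ts_face Ts F & cyclic_vertices F vs
    & figure Ts (centroid vs)].

Definition TS Ts : set (set (pt R)) :=
  [set T | exists vs v, [/\ ts_kept_face Ts vs, v \in vs
                          & T = triangle (centroid vs) v (next vs v)]].

End SpatialTriangulation.

(* Intervals of time, as sets of moments. *)
Section Time.
Context {R : realType}.
Implicit Types (I J K : set R) (x y t : R).

Definition has_endpoints I x y : Prop :=
  I !=set0 /\ exists bl br, I = [set` Interval (BSide bl x) (BSide br y)].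

Definition endpoint I x : Prop :=
  exists y, has_endpoints I x y \/ has_endpoints I y x.

Definition maximal_interval J (P : set R -> Prop) K : Prop :=
  let ok K' := [/\ K' !=set0, is_interval K', K' `<=` J & P K'] in
  ok K /\ forall K', ok K' -> K `<=` K' -> K' = K.

End Time.

Section GeometricObjects.
Context {R : realType}.

Definition rdefined (r : ratfun R) (t : R) : Prop :=
  exists p q : {poly R}, q.[t] != 0 /\
    r = FracField.tofrac p / FracField.tofrac q.

(* The value of r at t; the junk value 0 if r is not defined at t. *)
Definition reval (r : ratfun R) (t : R) : R :=
  xget 0 [set y | exists p q : {poly R},
    [/\ q.[t] != 0, r = FracField.tofrac p / FracField.tofrac q
      & y = p.[t] / q.[t]]].

Definition rational_coef (r : ratfun R) : Prop :=
  exists p q : {poly rat}, q != 0 /\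
    r = FracField.tofrac (map_poly ratr p) / FracField.tofrac (map_poly ratr q).

(* (A, b) stands for the map v |-> A(t) v + b(t). *)
Definition taff : Type := ('M[ratfun R]_2 * 'cV[ratfun R]_2)%type.

Definition taff_mx (f : taff) (t : R) : 'M[R]_2 := map_mx (reval^~ t) f.1.

Definition taff_at (f : taff) (t : R) (v : pt R) : pt R :=
  taff_mx f t *m v + map_mx (reval^~ t) f.2.

Definition taff_defined (f : taff) (t : R) : Prop :=
  [/\ forall i j, rdefined (f.1 i j) t, forall i j, rdefined (f.2 i j) t
    & \det (taff_mx f t) != 0].

Definition taff_id : taff := (1%:M, 0).

Record atomic : Type := Atomic {
  shape : set (pt R);
  dom : set R;
  trans : taff }.

Definition gobject : Type := set atomic.

Implicit Types (O G : gobject) (o c : atomic).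

Definition snap o (t : R) : set (pt R) := taff_at (trans o) t @` shape o.

Definition snap_triangles O (t : R) : set (set (pt R)) :=
  [set snap o t | o in [set o | O o /\ dom o t]].

Definition snapshot O (t : R) : set (pt R) := figure (snap_triangles O t).

Definition time_domain O : set R := [set` Rhull (\bigcup_(o in O) dom o)].

Definition algebraic (x : R) : Prop := algebraicOver (@ratr R) x.

Definition input_atomic o : Prop :=
  [/\ exists p q r : pt R, [/\ forall i, algebraic (p i 0), forall i, algebraic (q i 0),
                        forall i, algebraic (r i 0) & shape o = triangle p q r],
      exists x y, [/\ algebraic x, algebraic y & has_endpoints (dom o) x y],
      forall i j, rational_coef ((trans o).1 i j),
      forall i j, rational_coef ((trans o).2 i j)
    & forall t, dom o t -> taff_defined (trans o) t].

Definition input_object O : Prop :=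
  [/\ finite_set O, forall o, O o -> input_atomic o
    & forall t, snapshot O t =
        \bigcup_(T in [set T | snap_triangles O t T /\ nondegenerate T]) T].

End GeometricObjects.
Arguments taff : clear implicits.
Arguments atomic : clear implicits.
Arguments gobject : clear implicits.

Section Partition.
Context {R : realType}.
Implicit Types (O : gobject R) (c : atomic R).

Definition moving_edge O c : Prop :=
  exists o e, [/\ O o, edge (shape o) e & c = Atomic e (dom o) (trans o)].

Definition carrier c (t : R) : set (pt R) := line_through (snap c t).

Variant meet_type := MeetEmpty | MeetPoint | MeetLine.

Definition has_meet_type (l1 l2 : set (pt R)) (m : meet_type) : Prop :=
  match m with
  | MeetEmpty => l1 `&` l2 = set0
  | MeetPoint => exists v, l1 `&` l2 = [set v]
  | MeetLine => l1 = l2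
  end.

Definition pair_constant c1 c2 (K : set R) : Prop :=
  exists m, forall t, K t -> has_meet_type (carrier c1 t) (carrier c2 t) m.

Definition triple_concurrent c1 c2 c3 (K : set R) : Prop :=
  forall t, K t -> exists v,
    carrier c1 t `&` carrier c2 t `&` carrier c3 t = [set v].

Definition partition_moments O : set R :=
  [set x | [\/ exists2 o, O o & endpoint (dom o) x,
      exists c1 c2 K, let J := dom c1 `&` dom c2 in
        [/\ moving_edge O c1 /\ moving_edge O c2, c1 <> c2, J x,
            maximal_interval J (pair_constant c1 c2) K & endpoint K x]
    | exists c1 c2 c3 K, let J := dom c1 `&` dom c2 `&` dom c3 in
        [/\ [/\ moving_edge O c1, moving_edge O c2 & moving_edge O c3],
            [/\ c1 <> c2, c1 <> c3 & c2 <> c3], J x,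
            maximal_interval J (triple_concurrent c1 c2 c3) K
          & endpoint K x]]].

(* fset_set X is only meaningful for finite X; the set of moments is finite
   for input objects. *)
Definition Partition O : seq R :=
  sort (fun x y => x <= y) (fset_set (partition_moments O)).

(* {tau_1}, ]tau_1, tau_2[, {tau_2}, ..., {tau_k} *)
Fixpoint time_elements (chi : seq R) : seq (set R) :=
  if chi is x :: chi' then
    [set x] :: (if chi' is y :: _ then [set` `]x, y[] :: time_elements chi'
                else [::])
  else [::].

End Partition.

Section Triangulate.
Context {R : realType}.
Implicit Types (O : gobject R) (chi : seq R).

Definition active_edge O (tm : R) (c : atomic R) : Prop :=
  [/\ moving_edge O c, dom c tm & has_boundary_segment (snapshot O tm) (snap c tm)].

(* The vertices of the kept faces are intersection points of the lines drawn;
   v moves along with the two carriers that meet in it at the moment tm. *)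
Definition moving_point O (tm : R) (J : set R) (v : pt R) (m : R -> pt R) :=
  exists c1 c2, [/\ active_edge O tm c1, active_edge O tm c2,
    carrier c1 tm `&` carrier c2 tm = [set v]
    & forall t, J t -> carrier c1 t `&` carrier c2 t = [set m t]].

Definition triangulate_interval O (a b : R) : gobject R :=
  let tm := (a + b) / 2 in
  let J : set R := [set` `]a, b[] in
  [set o | exists (vs : seq (pt R)) (v : pt R) (m : pt R -> R -> pt R),
    [/\ ts_kept_face (snap_triangles O tm) vs,
        v \in vs,
        forall w, w \in vs -> moving_point O tm J w (m w),
        shape o = triangle (centroid vs) v (next vs v) /\ dom o = J
      & forall t, J t ->
        let move := taff_at (trans o) t in
        [/\ taff_defined (trans o) t,
            move (centroid vs) = centroid [seq m w t | w <- vs],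
            move v = m v t & move (next vs v) = m (next vs v) t]]].

Definition triangulate_point O (x : R) : gobject R :=
  [set Atomic T [set x] taff_id | T in TS (snap_triangles O x)].

Definition Triangulate O chi : gobject R :=
  [set o | (exists2 x, x \in chi & triangulate_point O x o) \/
           (exists2 j, (j.+1 < size chi)%N &
              triangulate_interval O chi`_j chi`_j.+1 o)].

End Triangulate.

Section Merge.
Context {R : realType}.
Implicit Types (G : gobject R) (E N J K : set R).

Definition objs_on G J : gobject R := [set o | G o /\ dom o = J].

(* The correspondence sends (S, J, f) to (f(S, x), {x}, Id). *)
Definition mergeable_point G (x : R) J : Prop :=
  exists phi : atomic R -> atomic R,
    set_bij (objs_on G J) (objs_on G [set x]) phi /\
    forall o, objs_on G J o ->
      taff_defined (trans o) x /\ phi o = Atomic (snap o x) [set x] taff_id.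

Definition mergeable_intervals G E N : Prop :=
  [/\ forall x, E <> [set x] /\ N <> [set x],
      forall o t, objs_on G E o -> N t -> taff_defined (trans o) t,
      forall o t, objs_on G N o -> E t -> taff_defined (trans o) t
    & exists x (phi : atomic R -> atomic R),
      [/\ endpoint E x, endpoint N x, set_bij (objs_on G E) (objs_on G N) phi
        & forall o, objs_on G E o ->
          snap o x = snap (phi o) x /\
          exists g, [/\ affinity g, g @` shape o = shape (phi o)
            & forall t v, (E `|` N) t ->
              taff_at (trans o) t v = taff_at (trans (phi o)) t (g v)]]].

(* The objects on J are extended to J `|` K and those on K are deleted. *)
Definition absorb G J K : gobject R :=
  [set o | (G o /\ dom o <> J /\ dom o <> K) \/
    exists2 o', objs_on G J o' & o = Atomic (shape o') (J `|` K) (trans o')].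

(* One step of the pass: G is the current object, E the last element of the
   time partition obtained so far and N the next one. *)
Definition merge_step (GE : gobject R * set R) N : gobject R * set R :=
  let: (G, E) := GE in
  if `[< exists2 x, E = [set x] & mergeable_point G x N >]
    then (absorb G N E, E `|` N)
  else if `[< exists2 x, N = [set x] & mergeable_point G x E >]
    then (absorb G E N, E `|` N)
  else if `[< mergeable_intervals G E N >]
    then (absorb G E N, E `|` N)
  else (G, N).

Definition Merge G (chi : seq R) : gobject R :=
  if time_elements chi is E :: Ns then (foldl merge_step (G, E) Ns).1 else G.

End Merge.

Definition TST {R : realType} (O : gobject R) : gobject R :=
  let chi := Partition O in
  let G := Triangulate O chi in
  if (1 < size chi)%N then Merge G chi else G.

(* Main.v *)
(* The spatial triangulation of a figure S depends on S alone, not on the given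
   triangles: the lines drawn are those that carry a segment of the boundary of
   S, and the kept faces are the convex polygons with sides on such lines, cut
   by none of them, whose centroid lies in S. Affinities preserve this
   description, so TS commutes with them.

   It then suffices that the snapshot at t of TST O is the spatial
   triangulation of the snapshot of O at t. Merge changes no snapshot. Between
   two consecutive moments of the partition no carriers start or cease to be
   parallel, to coincide or to be concurrent; hence the side of a third
   carrier on which two carriers meet is constant, being the sign of a
   continuous function that vanishes everywhere or nowhere. These signs decide
   which cells lie in the figure (a point of the figure is a combination of
   vertices of the arrangement in its closed cell), and therefore which carriers
   contain boundary segments and which cycles of moving vertices bound a kept
   face: the faces kept at the middle moment move to the faces kept at t. *)

(* The definitions speak of closures, components, hulls and extreme points, whereas between two
   moments only signs can be followed. So both notions on which the triangulation rests get a
   description by signs of line forms: a boundary line has a point on no other line whose two sides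
   are not both covered by triangles ([bpoint]), and a kept face is a cycle of points subject to
   sign conditions ([good_polygon]). The bridge is [separation]: a point of the figure and a point
   outside it are weakly separated by a boundary line. Hence a cell of the boundary lines that
   contains one figure point lies in the figure, and the convex hull cuts nothing off it. Two
   obstacles shape the part about time. [fset_set] is meaningful only for finite sets, so the
   moments must be proved finite; this rests on rational functions having finitely many zeros. And a
   moving point may be carried by edges of degenerate triangles, which the sign arguments leave out:
   at the middle moment such an edge lies on the line of an edge of a nondegenerate triangle, and
   then it does so throughout the interval. *)
Require Import Defs.
From mathcomp Require Import all_boot all_order all_algebra.
From mathcomp Require Import finmap.
From mathcomp Require Import all_classical all_reals all_analysis.
From mathcomp Require Import ring lra.
Set Implicit Arguments.
Unset Strict Implicit.
Unset Printing Implicit Defensive.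
Import Order.TTheory GRing.Theory Num.Theory.
Import numFieldTopology.Exports numFieldNormedType.Exports.
Local Open Scope classical_set_scope.
Local Open Scope ring_scope.

(** * Orientation and triangles in the plane *)

Section PlaneGeometry.
Context {R : realType}.
Implicit Types (p q r u v w x y : pt R) (s t : R).

(** Twice the signed area of the triangle [p q x]. For fixed [p <> q] it is an affine form in [x]
    that vanishes on the line through [p] and [q] and is positive to its left; all lines below are
    zero sets of such forms. *)
Definition orient p q x : R :=
  (q 0 0 - p 0 0) * (x 1 0 - p 1 0) - (q 1 0 - p 1 0) * (x 0 0 - p 0 0).

Lemma pt_eqP p q : p 0 0 = q 0 0 -> p 1 0 = q 1 0 -> p = q.
Proof.
move=> h0 h1; apply/matrixP => i j; rewrite (ord1 j).
have [->//|] := eqVneq i 0 => i0; suff -> : i = 1 by [].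
by apply/val_inj; case: i i0 => -[|[|]].
Qed.

Lemma pt_neqP p q : p <> q -> (p 0 0 != q 0 0) || (p 1 0 != q 1 0).
Proof.
move=> pq; apply/orP; have [e0|] := eqVneq (p 0 0) (q 0 0); last by left.
by have [e1|] := eqVneq (p 1 0) (q 1 0); [case: pq; exact: pt_eqP|right].
Qed.

Lemma orientC p q x : orient q p x = - orient p q x.
Proof. by rewrite /orient; ring. Qed.

Lemma orient_rot p q x : orient q x p = orient p q x.
Proof. by rewrite /orient; ring. Qed.

Lemma orientl p q : orient p q p = 0.
Proof. by rewrite /orient; ring. Qed.

Lemma orientr p q : orient p q q = 0.
Proof. by rewrite /orient; ring. Qed.

Lemma orient_sum p q r x :
  orient p q x + orient q r x + orient r p x = orient p q r.
Proof. by rewrite /orient; ring. Qed.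

Lemma orient_line p q x y s :
  orient p q (x + s *: (y - x)) = (1 - s) * orient p q x + s * orient p q y.
Proof. by rewrite /orient !mxE; ring. Qed.

Lemma orient_add p q x v s :
  orient p q (x + s *: v) =
  orient p q x + s * ((q 0 0 - p 0 0) * v 1 0 - (q 1 0 - p 1 0) * v 0 0).
Proof. by rewrite /orient !mxE; ring. Qed.

Lemma orient_comb p q u v w (a b c : R) : a + b + c = 1 ->
  orient p q (a *: u + b *: v + c *: w) =
  a * orient p q u + b * orient p q v + c * orient p q w.
Proof.
move=> h; have -> : a = 1 - b - c by rewrite -h; ring.
by rewrite /orient !mxE; ring.
Qed.

Lemma collinearE p q r : collinear p q r <-> orient p q r = 0.
Proof.
rewrite /collinear /orient.
suff -> : \det (row_mx (q - p) (r - p)) =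
  (q 0 0 - p 0 0) * (r 1 0 - p 1 0) - (q 1 0 - p 1 0) * (r 0 0 - p 0 0) by [].
rewrite (expand_det_row _ 0) !big_ord_recl big_ord0 addr0 /cofactor !det_mx11.
have el i : row_mx (q - p) (r - p) i (lshift 1 0) = (q - p) i 0 by rewrite row_mxEl.
have er i : row_mx (q - p) (r - p) i (rshift 1 0) = (r - p) i 0 by rewrite row_mxEr.
move: (row_mx _ _) el er => N el er; rewrite !mxE.
have -> : lift 0 0 = 1 :> 'I_2 by exact/val_inj.
have := el 0; rewrite (_ : lshift 1 0 = 0); last exact/val_inj.
have := el 1; rewrite (_ : lshift 1 0 = 0); last exact/val_inj.
have := er 0; rewrite (_ : rshift 1 0 = 1); last exact/val_inj.
have := er 1; rewrite (_ : rshift 1 0 = 1); last exact/val_inj.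
rewrite (_ : lift 1 0 = 0); last exact/val_inj.
rewrite (_ : ord0 = 0)// => -> -> -> ->; rewrite !mxE /= addn0 expr0 expr1.
by ring.
Qed.

Lemma sqr_dist_gt0 p q : p <> q ->
  0 < (q 0 0 - p 0 0) ^+ 2 + (q 1 0 - p 1 0) ^+ 2.
Proof.
move=> /pt_neqP /orP[h|h].
  by apply: ltr_wpDr; rewrite ?sqr_ge0// exprn_even_gt0//= subr_eq0 eq_sym.
by apply: ltr_wpDl; rewrite ?sqr_ge0// exprn_even_gt0//= subr_eq0 eq_sym.
Qed.

(* Coordinates of x along p -> q and along its normal. *)
Lemma pt_decomp p q x : p <> q ->
  let d := (q 0 0 - p 0 0) ^+ 2 + (q 1 0 - p 1 0) ^+ 2 in
  let n : pt R := \col_i (if i == 0 then - (q 1 0 - p 1 0) else q 0 0 - p 0 0) in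
  x = p + (((q 0 0 - p 0 0) * (x 0 0 - p 0 0) +
            (q 1 0 - p 1 0) * (x 1 0 - p 1 0)) / d) *: (q - p) +
      (orient p q x / d) *: n.
Proof.
move=> pq d n; have d0 : d != 0 by rewrite gt_eqF// sqr_dist_gt0.
by apply: pt_eqP; rewrite /orient !mxE /=; move: d0; rewrite /d => d0; field.
Qed.

Lemma orient0_line p q x : p <> q -> orient p q x = 0 ->
  exists s, x = p + s *: (q - p).
Proof.
move=> pq h; have /= := pt_decomp x pq; rewrite h mul0r scale0r addr0 => e.
by eexists; exact: e.
Qed.

(** An affine form is determined by its values at [p], at [q] and off their line. The factor [k] is
    the scalar product of [q - p] and [q' - p'] over the squared length of [q - p]; it is 0 if
    [p' = q'], so callers that need [k != 0] prove it separately. *)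
Lemma orient_coin p q p' q' : p <> q ->
  orient p' q' p = 0 -> orient p' q' q = 0 ->
  exists k, forall x, orient p' q' x = k * orient p q x.
Proof.
move=> pq hp hq.
set d := (q 0 0 - p 0 0) ^+ 2 + (q 1 0 - p 1 0) ^+ 2.
have d0 : d != 0 by rewrite gt_eqF// sqr_dist_gt0.
exists (((q 0 0 - p 0 0) * (q' 0 0 - p' 0 0) +
            (q 1 0 - p 1 0) * (q' 1 0 - p' 1 0)) / d) => x.
apply: (mulfI d0); rewrite mulrA [d * (_ / d)]mulrC divfK//.
pose a := (q 0 0 - p 0 0) * (x 0 0 - p 0 0) +
            (q 1 0 - p 1 0) * (x 1 0 - p 1 0).
transitivity ((d - a) * orient p' q' p + a * orient p' q' q +
  ((q 0 0 - p 0 0) * (q' 0 0 - p' 0 0) +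
            (q 1 0 - p 1 0) * (q' 1 0 - p' 1 0)) * orient p q x).
  by rewrite /d /a /orient; ring.
by rewrite hp hq !mulr0 !add0r.
Qed.

Lemma convP (A : set (pt R)) : convex_set A <->
  forall p q s, A p -> A q -> 0 <= s <= 1 -> A (p + s *: (q - p)).
Proof.
have E p q (l : {i01 R}) : conv l (q : convex_lmodType (pt R)) p = p + l%:num *: (q - p).
  rewrite /conv /= /unstable.onem.
  by apply: pt_eqP; rewrite !mxE; ring.
split=> [cA p q s Ap Aq /andP[s0 s1]|cA q p l /[!inE] Aq Ap].
  by have := cA q p (Itv01 s0 s1); rewrite !inE E /=; exact.
by rewrite E; apply: cA => //; rewrite ge0 le1.
Qed.

Lemma hullP (A : set (pt R)) (p q : pt R) s : hull A p -> hull A q ->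
  0 <= s <= 1 -> hull A (p + s *: (q - p)).
Proof.
move=> hp hq s01 B [cB AB]; apply: (iffLR (convP B) cB) => //.
  by apply: hp.
by apply: hq.
Qed.

Lemma sub_hull (A : set (pt R)) : A `<=` hull A.
Proof. exact: sub_gen_smallest. Qed.

Lemma hull_min (A B : set (pt R)) :
  (forall p q s, B p -> B q -> 0 <= s <= 1 -> B (p + s *: (q - p))) ->
  A `<=` B -> hull A `<=` B.
Proof. by move=> /convP cB AB; apply: smallest_sub. Qed.

Lemma segmentE p q :
  segment p q = [set x | exists s, 0 <= s <= 1 /\ x = p + s *: (q - p)].
Proof.
apply/seteqP; split.
  apply: hull_min => [x y s [a [/andP[a0 a1] ->]] [b [/andP[b0 b1] ->]] /andP[s0 s1]|x [->|->]].
  - exists (a + s * (b - a)); split; first by apply/andP; split; nra.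
    by apply: pt_eqP; rewrite !mxE; ring.
  - by exists 0; rewrite lexx ler01 scale0r addr0.
  - by exists 1; rewrite lexx ler01 scale1r addrC subrK.
move=> x [s [s01 ->]]; apply: hullP => //; apply: sub_hull; by [left|right].
Qed.

Lemma segmentC p q : segment p q = segment q p.
Proof. by rewrite /segment setUC. Qed.

Lemma triangleE p q r : triangle p q r = [set x | exists a b c : R,
  [/\ 0 <= a, 0 <= b, 0 <= c, a + b + c = 1 & x = a *: p + b *: q + c *: r]].
Proof.
apply/seteqP; split.
  apply: hull_min => [x y s [a [b [c [a0 b0 c0 e ->]]]]
      [a' [b' [c' [a0' b0' c0' e' ->]]]] /andP[s0 s1]|x [[->|->]|->]].
  - exists (a + s * (a' - a)), (b + s * (b' - b)), (c + s * (c' - c)).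
    split; [nra..|].
    by apply: pt_eqP; rewrite !mxE; ring.
  - by exists 1, 0, 0; rewrite !scale0r scale1r !addr0 ler01 lexx.
  - by exists 0, 1, 0; rewrite !scale0r scale1r !addr0 !add0r ler01 lexx.
  - by exists 0, 0, 1; rewrite !scale0r scale1r !addr0 !add0r ler01 lexx.
move=> x [a [b [c [a0 b0 c0 e ->]]]].
have tp : triangle p q r p by apply: sub_hull; left; left.
have tq : triangle p q r q by apply: sub_hull; left; right.
have tr : triangle p q r r by apply: sub_hull; right.
have [c1|c1] := eqVneq c 1.
  have -> : a = 0 by lra.
  have -> : b = 0 by lra.
  by rewrite !scale0r c1 scale1r !add0r.
have c1' : 1 - c != 0 by rewrite subr_eq0 eq_sym.
(* The point is reached along two segments: from [p] towards [q], then from there towards [r]. The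
   case [c = 1] was split off because of the division by [1 - c]. *)
have -> : a *: p + b *: q + c *: r =
   (p + (b / (1 - c)) *: (q - p)) + c *: (r - (p + (b / (1 - c)) *: (q - p))).
  have -> : a = 1 - b - c by rewrite -e; ring.
  by apply: pt_eqP; rewrite !mxE; field.
have c1'' : 0 < 1 - c by rewrite lt_def c1'; lra.
apply: hullP => //; last by apply/andP; split; lra.
apply: hullP => //; apply/andP; split; first by rewrite divr_ge0// ltW.
by rewrite ler_pdivrMr //; lra.
Qed.

Lemma triangle_swap p q r : triangle q p r = triangle p q r.
Proof. by rewrite /triangle (setUC [set q]). Qed.

(** The three orientations divided by [orient p q r] are the barycentric coordinates of [x]. *)
Lemma triangle_orient p q r x : 0 < orient p q r ->
  triangle p q r x <->
  [/\ 0 <= orient p q x, 0 <= orient q r x & 0 <= orient r p x].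
Proof.
move=> o; rewrite triangleE; split=> [[a [b [c [a0 b0 c0 e ->]]]]|[h1 h2 h3]].
  rewrite !(orient_comb _ _ _ _ _ e) !orientl !orientr orient_rot.
  by rewrite [orient r p q]orient_rot orient_rot !mulr0 !addr0 !add0r !mulr_ge0// ltW.
exists (orient q r x / orient p q r), (orient r p x / orient p q r),
  (orient p q x / orient p q r).
have o0 : orient p q r != 0 by rewrite gt_eqF.
split; rewrite ?divr_ge0 ?(ltW o)//.
  rewrite -!mulrDl (_ : _ + _ + _ = orient p q r) ?divff//.
  by rewrite -(orient_sum p q r x); ring.
by apply: pt_eqP; rewrite !mxE; move: o0; rewrite /orient => o0; field.
Qed.

Lemma segl (p q : pt R) : segment p q p.
Proof. by rewrite segmentE; exists 0; rewrite lexx ler01 scale0r addr0. Qed.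

Lemma segr (p q : pt R) : segment p q q.
Proof. by rewrite segmentC; exact: segl. Qed.

End PlaneGeometry.

(** * Affinities; corners and edges of triangles *)

Section Affinities.
Context {R : realType}.
Implicit Types (p q r u v w x y : pt R) (s t : R) (M : 'M[R]_2) (a : pt R -> pt R).

(** Two barycentric coordinates of [x] vanish, which leaves only the corner [p]. *)
Lemma orient_cross p q r x : orient p q r != 0 ->
  orient p q x = 0 -> orient r p x = 0 -> x = p.
Proof.
move=> o h1 h2.
have e : orient q r x = orient p q r by rewrite -(orient_sum p q r x) h1 h2; ring.
have -> : x = (orient q r x / orient p q r) *: p + (orient r p x / orient p q r) *: q +
  (orient p q x / orient p q r) *: r.
  by apply: pt_eqP; rewrite !mxE; move: o; rewrite /orient => o; field.
by rewrite h1 h2 !mul0r !scale0r !addr0 e divff// scale1r.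
Qed.

Lemma det_mx22 M : \det M = M 0 0 * M 1 1 - M 0 1 * M 1 0.
Proof.
rewrite (expand_det_row _ 0) !big_ord_recl big_ord0 addr0 /cofactor !det_mx11.
rewrite !mxE /= addn0 expr0 expr1.
rewrite (_ : lift 0 0 = 1); last exact/val_inj.
rewrite (_ : lift 1 0 = 0); last exact/val_inj.
rewrite (_ : ord0 = 0)//.
by ring.
Qed.

Lemma mulmx2E M v i : (M *m v) i 0 = M i 0 * v 0 0 + M i 1 * v 1 0.
Proof.
rewrite mxE !big_ord_recl big_ord0 addr0.
by rewrite (_ : lift ord0 ord0 = 1)//; exact/val_inj.
Qed.

Lemma addmx00 (A B : pt R) i : (A + B) i 0 = A i 0 + B i 0.
Proof. by rewrite mxE. Qed.

Lemma scalemx00 (k : R) (A : pt R) i : (k *: A) i 0 = k * A i 0.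
Proof. by rewrite mxE. Qed.

Lemma oppmx00 (A : pt R) i : (- A) i 0 = - A i 0.
Proof. by rewrite mxE. Qed.

Lemma orient_aff M b p q x :
  orient (M *m p + b) (M *m q + b) (M *m x + b) = \det M * orient p q x.
Proof.
by rewrite det_mx22 /orient !addmx00 !mulmx2E; ring.
Qed.

Lemma affinity_orient a : affinity a ->
  exists2 k, k != 0 & forall p q x, orient (a p) (a q) (a x) = k * orient p q x.
Proof.
move=> [M [b [Mu aE]]]; exists (\det M); first by move: Mu; rewrite unitmxE unitfE.
by move=> p q x; rewrite !aE orient_aff.
Qed.

Lemma affinity_line a p q s : affinity a ->
  a (p + s *: (q - p)) = a p + s *: (a q - a p).
Proof.
move=> [M [b [_ aE]]]; rewrite !aE; apply: pt_eqP.
  by rewrite !(addmx00, scalemx00, oppmx00, mulmx2E); ring.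
by rewrite !(addmx00, scalemx00, oppmx00, mulmx2E); ring.
Qed.

Lemma affinity_inv a : affinity a ->
  exists a', [/\ affinity a', cancel a a' & cancel a' a].
Proof.
move=> [M [b [Mu aE]]]; exists (fun v => invmx M *m v - invmx M *m b); split.
- by exists (invmx M), (- (invmx M *m b)); rewrite unitmx_inv.
- by move=> v; rewrite aE mulmxDr mulKmx// addrK.
- by move=> v; rewrite aE mulmxBr !mulKVmx// subrK.
Qed.

Lemma affinity_inj a : affinity a -> injective a.
Proof. by move=> /affinity_inv[a' [_ k _]]; exact: can_inj k. Qed.

Lemma affinity_hull a (A : set (pt R)) : affinity a ->
  a @` hull A = hull (a @` A).
Proof.
move=> ha; have [a' [ha' k k']] := affinity_inv ha.
apply/seteqP; split.
  suff : hull A `<=` [set x | hull (a @` A) (a x)] by move=> h _ [x /h ? <-].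
  apply: hull_min => [p q s /= hp hq s01|x Ax /=].
    by rewrite affinity_line//; exact: hullP.
  by apply: sub_hull; exists x.
apply: hull_min => [_ _ s [p hp <-] [q hq <-] s01|_ [x Ax <-]].
  by rewrite -affinity_line//; exists (p + s *: (q - p)) => //; exact: hullP.
by exists x => //; exact: sub_hull.
Qed.

Lemma affinity_triangle a p q r : affinity a ->
  a @` triangle p q r = triangle (a p) (a q) (a r).
Proof. by move=> ha; rewrite affinity_hull// !image_setU !image_set1. Qed.

Lemma affinity_segment a p q : affinity a ->
  a @` segment p q = segment (a p) (a q).
Proof. by move=> ha; rewrite affinity_hull// !image_setU !image_set1. Qed.

Lemma extreme_affinity a (F : set (pt R)) v : affinity a ->
  extreme F v -> extreme (a @` F) (a v).
Proof.
move=> ha [Fv ev]; split=> [|_ _ s [p Fp <-] [q Fq <-] s01 e]; first by exists v.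
congr a; apply: (ev _ _ s) => //; apply: (affinity_inj ha).
have -> : (1 - s) *: p + s *: q = p + s *: (q - p).
  by rewrite scalerBr scalerBl scale1r addrAC addrA.
rewrite affinity_line// e.
by rewrite scalerBr scalerBl scale1r addrAC addrA.
Qed.

Lemma edge_affinity a (T e : set (pt R)) : affinity a ->
  edge T e -> edge (a @` T) (a @` e).
Proof.
move=> ha [p [q [ep eq pq ->]]]; exists (a p), (a q).
split; [exact: extreme_affinity..| |exact: affinity_segment].
by move/(affinity_inj ha).
Qed.

Lemma line_through_segment p q : p <> q ->
  line_through (segment p q) = [set x | orient p q x = 0].
Proof.
move=> pq; apply/seteqP; split=> [_ [u [v [s [+ + uv ->]]]]|x /= /(orient0_line pq)[s ->]].
  rewrite segmentE => -[a [_ ->]] [b [_ ->]] /=.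
  by rewrite orient_line !orient_line !orientl !orientr; ring.
exists p, q, s; split=> //; rewrite segmentE.
  by exists 0; rewrite lexx ler01 scale0r addr0.
by exists 1; rewrite lexx ler01 scale1r addrC subrK.
Qed.

(** Corners are indexed by ['I_3] with addition modulo 3: edge [k] joins the corners [k] and [k + 1]
    and is opposite to corner [k + 2]. *)
Definition tri (c : 'I_3 -> pt R) : set (pt R) := triangle (c 0) (c 1) (c 2%:R).

Definition pos3 (c : 'I_3 -> pt R) : Prop := 0 < orient (c 0) (c 1) (c 2%:R).

Lemma ord3P (P : 'I_3 -> Prop) : P 0 -> P 1 -> P 2%:R -> forall k, P k.
Proof.
by move=> h0 h1 h2 [[|[|[|//]]] hi];
  [move: h0|move: h1|move: h2]; congr P; exact/val_inj.
Qed.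

Lemma ord3E : [/\ (0 + 1 = 1 :> 'I_3)%R, (1 + 1 = 2%:R :> 'I_3)%R, (2%:R + 1 = 0 :> 'I_3)%R,
  (0 + 2%:R = 2%:R :> 'I_3)%R & (1 + 2%:R = 0 :> 'I_3)%R /\ (2%:R + 2%:R = 1 :> 'I_3)%R].
Proof. by do !split; exact/val_inj. Qed.

Lemma orient3 (c : 'I_3 -> pt R) k :
  orient (c k) (c (k + 1)) (c (k + 2%:R)) = orient (c 0) (c 1) (c 2%:R).
Proof.
have [e1 e2 e3 e4 [e5 e6]] := ord3E.
move: k; apply: ord3P; rewrite ?(e1,e2,e3,e4,e5,e6)//; by rewrite /orient; ring.
Qed.

Lemma pos3k (c : 'I_3 -> pt R) k : pos3 c ->
  0 < orient (c k) (c (k + 1)) (c (k + 2%:R)).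
Proof. by rewrite orient3. Qed.

Lemma triP (c : 'I_3 -> pt R) x : pos3 c ->
  tri c x <-> forall k, 0 <= orient (c k) (c (k + 1)) x.
Proof.
have [e1 e2 e3 e4 [e5 e6]] := ord3E.
move=> p; rewrite /tri triangle_orient//; split=> [[h1 h2 h3]|h].
  by apply: ord3P; rewrite ?(e1,e2,e3).
by have := h 0; have := h 1; have := h 2%:R; rewrite ?(e1,e2,e3) => ? ? ?.
Qed.

Lemma pos3_neq (c : 'I_3 -> pt R) k : pos3 c -> c k <> c (k + 1).
Proof. by move=> /(pos3k k) + e; rewrite -e /orient !subrr !mul0r subrr ltxx. Qed.

(** Degenerate triangles are included, since input shapes may be degenerate. If the weight of [p] is
    strictly between 0 and 1, then [v] lies strictly between [p] and a point [w] of the opposite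
    side, so [p = w]; if it is 0, the same argument applies on that side. *)
Lemma extreme_triangle p q r v : extreme (triangle p q r) v ->
  [\/ v = p, v = q | v = r].
Proof.
move=> [].
have tp : triangle p q r p by apply: sub_hull; left; left.
have tq : triangle p q r q by apply: sub_hull; left; right.
have tr : triangle p q r r by apply: sub_hull; right.
rewrite {1}triangleE => -[l [m [n [l0 m0 n0 e ->]]]] ext.
have [l1|l1] := eqVneq l 1.
  constructor 1; have -> : m = 0 by lra.
  have -> : n = 0 by lra.
  by rewrite l1 scale1r !scale0r !addr0.
have l1' : 0 < m + n.
  have : l < 1 by rewrite lt_neqAle l1 /=; lra.
  lra.
pose w := q + (n / (m + n)) *: (r - q).
have wT : triangle p q r w.
  apply: hullP => //.
  apply/andP; split; first by rewrite divr_ge0// ltW.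
  by rewrite ler_pdivrMr// mul1r; lra.
have eqw : l *: p + m *: q + n *: r = l *: p + (1 - l) *: w.
  have -> : 1 - l = m + n by lra.
  by apply: pt_eqP; rewrite !mxE; field; rewrite gt_eqF.
have [l0'|l0'] := eqVneq l 0; last first.
  have cw : p = w.
    apply: (ext _ _ (1 - l)) => //; first by apply/andP; split; lra.
    by rewrite subKr.
  by constructor 1; rewrite eqw -cw -scalerDl addrC subrK scale1r.
move: e eqw ext; rewrite l0' !scale0r !add0r => e eqw ext.
have [m0'|m0'] := eqVneq m 0.
  by constructor 3; rewrite m0' scale0r add0r (_ : n = 1) ?scale1r//; lra.
have [n0'|n0'] := eqVneq n 0.
  by constructor 2; rewrite n0' scale0r addr0 (_ : m = 1) ?scale1r//; lra.
have qr : q = r.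
  apply: (ext _ _ n) => //.
    have n0'' : 0 < n by rewrite lt_neqAle eq_sym n0' n0.
    have m0'' : 0 < m by rewrite lt_neqAle eq_sym m0' m0.
    rewrite n0'' /=; lra.
  by rewrite (_ : 1 - n = m)//; lra.
by constructor 2; rewrite -qr -scalerDl e scale1r.
Qed.

(** Two side forms vanish at a corner and are nonnegative on the triangle. They therefore vanish at
    both ends of any segment through the corner, and [orient_cross] identifies these ends with
    it. *)
Lemma extreme_tri (c : 'I_3 -> pt R) v : pos3 c ->
  extreme (tri c) v <-> exists k, v = c k.
Proof.
move=> cp; split=> [/extreme_triangle[->|->|->]|[k ->]]; [by exists 0|by exists 1|by exists 2%:R|].
have ckT : tri c (c k).
  by apply: sub_hull; move: k; apply: ord3P; [left; left|left; right|right].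
split=> // p q s /(triP _ cp) hp /(triP _ cp) hq /andP[s0 s1] e.
have [e1 e2 e3 e4 [e5 e6]] := ord3E.
have e7 : k + 2%:R + 1 = k by rewrite -addrA e3 addr0.
have key (h : pt R -> R) : 0 <= h p -> 0 <= h q ->
    (forall x y, h (x + s *: (y - x)) = (1 - s) * h x + s * h y) -> h (c k) = 0 ->
  h p = 0 /\ h q = 0.
  move=> h1 h2 ha; have -> : c k = p + s *: (q - p).
    by rewrite e scalerBr scalerBl scale1r addrAC addrA.
  rewrite ha => h0; have s1' : 0 < 1 - s by rewrite subr_gt0.
  have : (1 - s) * h p = 0 /\ s * h q = 0.
    have : 0 <= (1 - s) * h p by rewrite mulr_ge0// ltW.
    have : 0 <= s * h q by rewrite mulr_ge0// ltW.
    by move=> ? ?; split; lra.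
  by move=> [/eqP + /eqP]; rewrite !mulf_eq0 (gt_eqF s0) (gt_eqF s1') /= => /eqP ? /eqP ?.
have [p1 q1] := key (orient (c k) (c (k + 1))) (hp k) (hq k)
  (fun x y => orient_line _ _ _ _ _) (orientl _ _).
have := key (orient (c (k + 2%:R)) (c (k + 2%:R + 1))) (hp _) (hq _)
  (fun x y => orient_line _ _ _ _ _).
rewrite e7 => /(_ (orientr _ _))[p2 q2].
have ok : orient (c k) (c (k + 1)) (c (k + 2%:R)) != 0 by rewrite gt_eqF// pos3k.
by rewrite (orient_cross ok p1 p2) (orient_cross ok q1 q2).
Qed.

Lemma edge_tri (c : 'I_3 -> pt R) e : pos3 c ->
  edge (tri c) e <-> exists k, e = segment (c k) (c (k + 1)).
Proof.
move=> cp; split.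
  move=> [p [q [/(extreme_tri _ cp)[i ->] /(extreme_tri _ cp)[j ->] ij ->]]].
  have : j = i + 1 \/ i = j + 1.
    have [e1 e2 e3 e4 [e5 e6]] := ord3E.
    have : i <> j by move=> h; apply: ij; rewrite h.
    by move: i j {ij}; do 2 apply: ord3P => //; rewrite ?(e1,e2,e3); auto.
  by move=> [->|->]; [exists i|exists j; rewrite segmentC].
move=> [k ->]; exists (c k), (c (k + 1)); split=> //.
- by apply/extreme_tri => //; exists k.
- by apply/extreme_tri => //; exists (k + 1).
- exact: pos3_neq.
Qed.

Lemma nondegenerate_tri (T : set (pt R)) :
  Defs.nondegenerate T <-> exists2 c, pos3 c & T = tri c.
Proof.
have E p q r : 0 < orient p q r ->
    exists2 c, pos3 c & triangle p q r = tri c.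
  move=> o; by exists (fun k => if k == 0 then p else if k == 1 then q else r).
split=> [[p [q [r [/collinearE/eqP]]]]|[c cp ->]].
  rewrite neq_lt => /orP[ltpqr eT|]; last by move=> /E[c cp e] eT; exists c; rewrite ?eT.
  have : 0 < orient q p r by rewrite orientC oppr_gt0.
  by rewrite eT -triangle_swap => /E.
by exists (c 0), (c 1), (c 2%:R); split=> //; move/collinearE => e; move: cp; rewrite /pos3 e ltxx.
Qed.

End Affinities.

(** * Continuity of orientation and points in general position *)

Section PlaneTopology.
Context {R : realType}.
Implicit Types (p q r u v w x y : pt R) (s t : R).

Lemma cvg_orient (T : Type) (F : set_system T) {FF : Filter F}
    (P Q X : T -> pt R) p q x :
  (forall i : 'I_2, (fun t : T => P t i 0) @ F --> p i 0) ->
  (forall i : 'I_2, (fun t : T => Q t i 0) @ F --> q i 0) ->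
  (forall i : 'I_2, (fun t : T => X t i 0) @ F --> x i 0) ->
  (fun t : T => orient (P t) (Q t) (X t)) @ F --> orient p q x.
Proof.
move=> hP hQ hX; rewrite /orient.
by apply: (@cvgB _ R^o); apply: (@cvgM R); apply: (@cvgB _ R^o).
Qed.

Lemma continuous_orient p q : continuous (orient p q : pt R -> R).
Proof.
move=> x; apply: (@cvg_orient _ (nbhs x) (nbhs_filter x)) => i; try exact: cvg_cst.
exact: coord_continuous.
Qed.

Lemma near_orient_gt0 p q x : 0 < orient p q x ->
  \forall y \near x, 0 < orient p q y.
Proof.
move=> h; have := @continuous_orient p q x.
by move=> /cvgr_gt; exact.
Qed.

Lemma near_orient_lt0 p q x : orient p q x < 0 ->
  \forall y \near x, orient p q y < 0.
Proof.
move=> h; have := @continuous_orient p q x.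
by move=> /cvgr_lt; exact.
Qed.

Lemma near_orient_neq0 p q x : orient p q x != 0 ->
  \forall y \near x, orient p q y != 0.
Proof.
rewrite neq_lt => /orP[/near_orient_lt0|/near_orient_gt0]; apply: filterS => y h;
  by rewrite ?(lt_eqF h) ?(gt_eqF h).
Qed.

Lemma continuous_ray x v : continuous (fun s : R => x + s *: v : pt R).
Proof.
move=> s; apply: cvgD; first exact: cvg_cst.
by apply: cvgZr_tmp; exact: cvg_id.
Qed.

Lemma near_ray x v (P : set (pt R)) : nbhs x P ->
  \forall s \near (0 : R), P (x + s *: v).
Proof.
move=> h; apply: (@continuous_ray x v 0).
by rewrite /= scale0r addr0.
Qed.

Lemma near_ray_gt0 x v (P : set (pt R)) : nbhs x P ->
  exists2 s : R, 0 < s & forall t, `|t| <= s -> P (x + t *: v).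
Proof.
move=> /(near_ray v) /nbhs_ballP[e /= e0 h]; exists (e / 2); first by rewrite divr_gt0.
move=> t te; apply: h; rewrite /ball /= sub0r normrN (le_lt_trans te)//.
by rewrite ltr_pdivrMr// mulr_natr mulr2n ltrDl.
Qed.

Lemma closed_orient_ge0 p q : closed [set x : pt R | 0 <= orient p q x].
Proof.
apply: (@preimage_closed _ _ (orient p q) [set z | 0 <= z]); last exact: closed_ge.
by move=> x _; exact: continuous_orient.
Qed.

(** A small shift along its normal leaves a given line, and the part of [U] off that line is again
    open and nonempty, so the lines can be avoided one after the other. *)
Lemma open_avoid_lines (U : set (pt R)) (l : seq (pt R * pt R)) :
  open U -> U !=set0 -> (forall a, a \in l -> a.1 <> a.2) ->
  exists2 y, U y & forall a, a \in l -> orient a.1 a.2 y != 0.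
Proof.
elim: l U => [|a l IH] U oU [y Uy] hl; first by exists y.
have [z [Uz az]] : exists z, U z /\ orient a.1 a.2 z != 0.
  have [ay|] := eqVneq (orient a.1 a.2 y) 0; last by exists y.
  pose n : pt R := \col_i (if i == 0 then - (a.2 1 0 - a.1 1 0) else a.2 0 0 - a.1 0 0).
  have := open_nbhs_nbhs (conj oU Uy) => /(near_ray_gt0 n)[s s0 hs].
  exists (y + s *: n); split; first by apply: hs; rewrite gtr0_norm.
  rewrite orient_add ay add0r !mxE /= mulrN opprK mulf_neq0 ?gt_eqF//.
  by rewrite -!expr2 sqr_dist_gt0//; apply: hl; rewrite mem_head.
case: (IH (U `&` [set x | orient a.1 a.2 x != 0])) => [|||y' [Uy' ay'] hy'].
- apply: openI => //; rewrite openE => x /= hx; exact: near_orient_neq0.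
- by exists z.
- by move=> b bl; apply: hl; rewrite inE bl orbT.
by exists y' => // b; rewrite inE => /orP[/eqP ->|/hy'].
Qed.

Lemma near_finType (T : topologicalType) (J : finType) (x : T) (P : J -> set T) :
  (forall j, nbhs x (P j)) -> nbhs x [set y | forall j, P j y].
Proof.
move=> h; suff : forall l : seq J, nbhs x [set y | forall j, j \in l -> P j y].
  by move=> /(_ (enum J)); apply: filterS => y hy j; apply: hy; rewrite mem_enum.
elim=> [|a l IH]; first by apply: filterS filterT.
apply: filterS2 (h a) IH => y h1 h2 j; rewrite inE => /orP[/eqP ->//|]; exact: h2.
Qed.

End PlaneTopology.

(** * Figures covered by positively oriented triangles *)

Section Scene.
Context {R : realType} {I : finType} (c : I -> 'I_3 -> pt R).
Hypothesis cpos : forall i, pos3 (c i).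
Implicit Types (x y z : pt R) (e : I * 'I_3) (s : R).

(* The pair e = (i, k) stands for the k-th edge of the triangle c i. *)
Definition form e x : R := orient (c e.1 e.2) (c e.1 (e.2 + 1)) x.

Definition apex e : pt R := c e.1 (e.2 + 2%:R).

Definition fig : set (pt R) := [set x | exists i, forall k, 0 <= form (i, k) x].

Definition coin e e' : Prop :=
  form e' (c e.1 e.2) = 0 /\ form e' (c e.1 (e.2 + 1)) = 0.

(** Near such a point the arrangement looks like a single line, so membership in the figure depends
    only on the side of [e]; this is [fig_near]. *)
Definition simple e x : Prop :=
  form e x = 0 /\ forall e', form e' x = 0 -> coin e e'.

(* Near a point x that lies on no line but that of e, the figure covers the
   side of e to which s * (apex of e) points. *)
Definition cov s e x : Prop := exists i, forall k,
  0 < form (i, k) x \/ (form (i, k) x = 0 /\ 0 < s * form (i, k) (apex e)).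

(* Given simple e x and fig x, the last clause says that x is a boundary point. *)
Definition bpoint e x : Prop :=
  [/\ simple e x, fig x & ~ (cov 1 e x /\ cov (-1) e x)].

Lemma formE e x : form e x = orient (c e.1 e.2) (c e.1 (e.2 + 1)) x.
Proof. by []. Qed.

Lemma figE : fig = \bigcup_i tri (c i).
Proof.
apply/seteqP; split=> x; first by move=> [i h]; exists i => //; apply/triP.
by move=> [i _ /(triP _ (cpos i)) h]; exists i.
Qed.

Lemma form_apex e : 0 < form e (apex e).
Proof. by rewrite /form pos3k. Qed.

Lemma end_neq e : c e.1 e.2 <> c e.1 (e.2 + 1).
Proof. exact: pos3_neq. Qed.

Lemma form_line e x y s :
  form e (x + s *: (y - x)) = (1 - s) * form e x + s * form e y.
Proof. exact: orient_line. Qed.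

Lemma form_coin e e' : coin e e' ->
  exists2 k, k != 0 & forall x, form e' x = k * form e x.
Proof.
move=> [h1 h2]; have [k hk] := orient_coin (@end_neq e) h1 h2.
exists k => //; apply/eqP => k0; have := form_apex e'.
by rewrite /form hk k0 mul0r ltxx.
Qed.

Lemma near_form_sign x : \forall y \near x,
  forall e, (0 < form e x -> 0 < form e y) /\ (form e x < 0 -> form e y < 0).
Proof.
apply: near_finType => e.
have [h|h|h] := ltgtP (form e x) 0.
- by apply: filterS (near_orient_lt0 h).
- by apply: filterS (near_orient_gt0 h).
- exact: filterS filterT.
Qed.

(** Forms that are nonzero at [x] keep their sign nearby; those that vanish at [x] are nonzero
    multiples of [form e], so their signs at [y] are fixed by the side on which [y] lies. The apex
    of [e] serves as reference point for the sides. *)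
Lemma fig_near e x : simple e x -> \forall y \near x,
  (form e y = 0 -> (fig y <-> fig x)) /\
  forall s, 0 < s * form e y -> (fig y <-> cov s e x).
Proof.
move=> [ex sx]; apply: filterS (near_form_sign x) => y hy; split=> [ey|s sy].
  have z e' : form e' x = 0 -> form e' y = 0.
    by move=> /sx/form_coin[k _ ->]; rewrite ey mulr0.
  split=> -[i h]; exists i => k; have [] := hy (i, k); have := h k.
    move=> hk _ h2; rewrite leNgt; apply/negP => /h2.
    by rewrite ltNge hk.
  by rewrite le_eqVlt eq_sym => /orP[/eqP/z -> //|hx /(_ hx)/ltW].
split=> -[i h]; exists i => k; have [h1 h2] := hy (i, k); have := h k.
  have [/h2 hx|hx|hx] := ltgtP (form (i, k) x) 0; first by rewrite leNgt hx.
    by left.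
  have [k' k0 hk] := form_coin (sx _ hx).
  move=> ky; right; split=> //; move: ky sy; rewrite !hk => ky sy.
  have ea := form_apex e.
  have : 0 < k' * form e y.
    rewrite lt_def ky mulf_neq0//.
    by apply: contraTneq sy => ->; rewrite mulr0 ltxx.
  by move=> ky'; rewrite mulrA pmulr_lgt0//; nra.
move=> [/h1/ltW//|[hx]].
have [k' k0 hk] := form_coin (sx _ hx); rewrite !hk mulrA => hs.
have := form_apex e => ea; move: hs; rewrite pmulr_lgt0// => hs.
by nra.
Qed.

Lemma closed_fig : closed fig.
Proof.
rewrite (_ : fig = \bigcup_(i in [set: I]) [set x | forall k, 0 <= form (i, k) x]).
  apply: closed_bigcup => [|i _]; first exact: finite_finset.
  rewrite (_ : mkset _ = \bigcap_(k in [set: 'I_3]) [set x | 0 <= form (i, k) x]).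
    by apply: closed_bigI => k _; exact: closed_orient_ge0.
  by apply/seteqP; split=> x; [move=> h k _; exact: h|move=> h k; exact: h].
by apply/seteqP; split=> x; [move=> [i h]; exists i|move=> [i _ h]; exists i].
Qed.

Lemma bpoint_boundary e x : bpoint e x -> \forall y \near x,
  form e y = 0 -> boundary fig y.
Proof.
move=> [sx fx ncov].
have [s s1 ns] : exists2 s, s = 1 \/ s = -1 & ~ cov s e x.
  by have [h|h] := pselect (cov 1 e x); [exists (-1); auto|exists 1; auto].
(* Below, [near_join] provides this description in a whole neighbourhood of [y], because it is
   applied to a point moved away from [y]. *)
have hn := fig_near sx.
apply: filterS2 hn (near_join hn) => y hy hy' ey; split.
  by apply: subset_closure; apply/(hy.1 ey).
rewrite /interior /= => hf; apply: ns.
(* Moving from [y] towards the apex if [s = 1], and away from it if [s = -1], enters the side that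
   is not covered. *)
have [t t0 ht] := near_ray_gt0 (s *: (apex e - y)) (filterI hf hy').
have := ht t; rewrite gtr0_norm// lexx => /(_ isT)[fz [_ h]].
apply/(h s) => //; rewrite scalerA form_line ey mulr0 add0r mulrCA.
rewrite !mulrA pmulr_lgt0 ?form_apex// mulrAC -mulrA pmulr_rgt0//.
by case: s1 => ->; rewrite ?mulrNN mulr1.
Qed.

End Scene.

(** * Intersection of two lines *)

Section Crossing.
Context {R : realType}.
Implicit Types (p q r u v w x y : pt R) (s t : R).

(** Cross product of the directions [q - p] and [q' - p']. *)
Definition crs p q p' q' : R :=
  (q 0 0 - p 0 0) * (q' 1 0 - p' 1 0) - (q 1 0 - p 1 0) * (q' 0 0 - p' 0 0).

(** Cramer's rule. If the directions are parallel, division by 0 gives the junk value [p], which is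
    still on the first line. *)
Definition meet p q p' q' : pt R :=
  p + (orient p' q' p / crs p q p' q') *: (q - p).

Lemma orient_dir p q p' q' : orient p' q' q = orient p' q' p - crs p q p' q'.
Proof. by rewrite /orient /crs; ring. Qed.

Lemma orient_ray p q p' q' s :
  orient p' q' (p + s *: (q - p)) = orient p' q' p - s * crs p q p' q'.
Proof. by rewrite orient_line (orient_dir p q); ring. Qed.

Lemma meet_l p q p' q' : orient p q (meet p q p' q') = 0.
Proof. by rewrite /meet orient_line orientl orientr; ring. Qed.

Lemma meet_r p q p' q' : crs p q p' q' != 0 -> orient p' q' (meet p q p' q') = 0.
Proof. by move=> h; rewrite /meet orient_ray divfK// subrr. Qed.

Lemma crs_neq p q p' q' : crs p q p' q' != 0 -> p <> q.
Proof. by move=> h e; move: h; rewrite e /crs !subrr !mul0r subrr eqxx. Qed.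

Lemma meet_uniq p q p' q' x : crs p q p' q' != 0 ->
  orient p q x = 0 -> orient p' q' x = 0 -> x = meet p q p' q'.
Proof.
move=> h /(orient0_line (crs_neq h))[s ->].
rewrite orient_ray => /eqP; rewrite subr_eq0 => /eqP e.
by rewrite /meet e mulfK.
Qed.

Lemma crs0_coin p q p' q' x : p <> q -> crs p q p' q' = 0 ->
  orient p q x = 0 -> orient p' q' x = 0 ->
  orient p' q' p = 0 /\ orient p' q' q = 0.
Proof.
move=> pq h /(orient0_line pq)[s ->]; rewrite orient_ray (orient_dir p q) h mulr0 subr0.
by move=> ->.
Qed.

Lemma coin_crs p q p' q' : orient p' q' p = 0 -> orient p' q' q = 0 ->
  crs p q p' q' = 0.
Proof. by rewrite (orient_dir p q) => ->; rewrite sub0r => /eqP; rewrite oppr_eq0 => /eqP. Qed.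

(** One more point than there are labels suffices. Applied to labels that stand for lines, it turns
    a cover of a segment by finitely many lines into a single line containing two of its points,
    hence all of it. *)
Lemma segment_pigeon (E : finType) (Q : E -> pt R -> Prop) p q : p <> q ->
  (forall x, segment p q x -> exists e, Q e x) ->
  exists e x y, [/\ x <> y, segment p q x, segment p q y, Q e x & Q e y].
Proof.
move=> pq h.
pose X (k : 'I_#|E|.+1) : pt R := p + (k%:R / (#|E|.+1)%:R) *: (q - p).
have N0 : 0 < (#|E|.+1)%:R :> R by rewrite ltr0n.
have sX k : segment p q (X k).
  rewrite segmentE; exists (k%:R / (#|E|.+1)%:R); split=> //.
  by rewrite divr_ge0//= ler_pdivrMr// mul1r ler_nat ltnW.
have injX : injective X.
  move=> i j /addrI /eqP; rewrite -subr_eq0 -scalerBl scaler_eq0 => /orP[|].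
    rewrite subr_eq0 => /eqP /mulIf; rewrite invr_neq0 ?gt_eqF// => /(_ isT)/eqP.
    by rewrite eqr_nat => /eqP/val_inj.
  by rewrite subr_eq0 => /eqP e; case: pq.
have [f hf] : exists f : 'I_#|E|.+1 -> E, forall k, Q (f k) (X k).
  by apply: (@fin_all_exists _ (fun=> E) (fun k e => Q e (X k))) => k; exact: h.
have : ~ injective f by move=> /leq_card; rewrite card_ord ltnn.
move=> /injectiveP/injectivePn[i [j ij fij]].
exists (f i), (X i), (X j); split=> //; last by rewrite fij.
by move=> /injX e; rewrite e eqxx in ij.
Qed.

End Crossing.

(** * Boundary lines of a figure *)

Section SceneLines.
Context {R : realType} {I : finType} (c : I -> 'I_3 -> pt R).
Hypothesis cpos : forall i, pos3 (c i).
Implicit Types (x y z : pt R) (e : I * 'I_3) (s : R).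
Local Notation form := (form c).
Local Notation fig := (fig c).
Local Notation coin := (coin c).
Local Notation apex := (apex c).
Local Notation bpoint := (bpoint c).

Definition ecrs e e' : R :=
  crs (c e.1 e.2) (c e.1 (e.2 + 1)) (c e'.1 e'.2) (c e'.1 (e'.2 + 1)).

Definition vtx e e' : pt R :=
  meet (c e.1 e.2) (c e.1 (e.2 + 1)) (c e'.1 e'.2) (c e'.1 (e'.2 + 1)).

Lemma vtx_l e e' : form e (vtx e e') = 0. Proof. exact: meet_l. Qed.

Lemma vtx_r e e' : ecrs e e' != 0 -> form e' (vtx e e') = 0.
Proof. exact: meet_r. Qed.

Lemma vtx_uniq e e' x : ecrs e e' != 0 -> form e x = 0 -> form e' x = 0 ->
  x = vtx e e'.
Proof. exact: meet_uniq. Qed.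

Lemma coin_or_vtx e e' x : form e x = 0 -> form e' x = 0 ->
  coin e e' \/ ecrs e e' != 0 /\ x = vtx e e'.
Proof.
move=> h h'; have [e0|e0] := eqVneq (ecrs e e') 0.
  by left; exact: crs0_coin (end_neq cpos (e := e)) e0 h h'.
by right; split=> //; exact: vtx_uniq.
Qed.

Lemma center_pos i : exists g, forall k, 0 < form (i, k) g.
Proof.
exists ((3%:R)^-1 *: c i 0 + (3%:R)^-1 *: c i 1 + (3%:R)^-1 *: c i 2%:R) => k.
have h3 : (3%:R)^-1 + (3%:R)^-1 + (3%:R)^-1 = 1 :> R by field.
have o := cpos i.
have i3 : 0 < (3%:R)^-1 :> R by rewrite invr_gt0.
rewrite /form (orient_comb _ _ _ _ _ h3) /=.
have [e1 e2 e3 e4 [e5 e6]] := ord3E.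
move: k; apply: ord3P; rewrite ?(e1,e2,e3); move: o; rewrite /pos3 => o.
- by rewrite orientl orientr !mulr0 !add0r mulr_gt0.
- by rewrite orientl orientr orient_rot !mulr0 !addr0 mulr_gt0.
- by rewrite orientl orientr -orient_rot !mulr0 !addr0 add0r mulr_gt0.
Qed.

(* A generic segment from y to z leaves the figure for the last time at a
   point of a single line, which is therefore a boundary line. *)
Lemma separation y z : fig y -> ~ fig z ->
  exists e w, bpoint e w /\ form e y * form e z <= 0.
Proof.
move=> [i fy] nfz; apply: contrapT => nex.
have H e w : bpoint e w -> 0 < form e y * form e z.
  by move=> b; rewrite ltNge; apply/negP => h; apply: nex; exists e, w.
(* First [y] is moved towards an interior point of its triangle, so little that no nonzero form
   changes sign; the result [y1] is interior to the triangle. *)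
have [g hg] := center_pos i.
have [t t0 ht] := near_ray_gt0 (g - y) (near_form_sign c y).
pose t1 := Num.min t 1.
have t10 : 0 < t1 by rewrite lt_min t0 ltr01.
have t11 : t1 <= 1 by rewrite ge_min lexx orbT.
pose y1 := y + t1 *: (g - y).
have hy1 : forall e, (0 < form e y -> 0 < form e y1) /\ (form e y < 0 -> form e y1 < 0).
  by apply: ht; rewrite gtr0_norm// ge_min lexx.
have iy1 k : 0 < form (i, k) y1.
  rewrite form_line; have := fy k; have := hg k => h1 h2.
  by rewrite ltr_wpDl ?mulr_gt0// mulr_ge0// subr_ge0.
pose U := [set y' | forall e, (0 < form e y1 -> 0 < form e y') /\
  (form e y1 < 0 -> form e y' < 0)]°.
(* Lines to be avoided by the generic start [y']: all lines of edges, and all lines joining [z] to a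
   vertex of the arrangement. Then no vertex other than possibly [z] is on the segment from [y'] to
   [z]. *)
pose l := [seq (c e.1 e.2, c e.1 (e.2 + 1)) | e <- enum {: I * 'I_3}] ++
  [seq a <- [seq (z, vtx e e') | e <- enum {: I * 'I_3}, e' <- enum {: I * 'I_3}]
    | a.1 != a.2].
have [||a|y' Uy' hy'] := @open_avoid_lines _ U l.
- exact: open_interior.
- by exists y1; exact: near_form_sign.
- rewrite mem_cat => /orP[/mapP[e _ ->]|]; first exact: end_neq.
  by rewrite mem_filter => /andP[/eqP].
have {Uy'} Uy' := interior_subset Uy'.
have y'e e : form e y' != 0.
  apply: (hy' (c e.1 e.2, c e.1 (e.2 + 1))).
  by rewrite mem_cat; apply/orP; left; apply/mapP; exists e; rewrite ?mem_enum.
have y'v e e' : z <> vtx e e' -> orient z (vtx e e') y' != 0.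
  move=> /eqP zv; apply: (hy' (z, vtx e e')).
  rewrite mem_cat; apply/orP; right; rewrite mem_filter zv /=.
  by apply/allpairsP; exists (e, e'); rewrite !mem_enum.
pose ga (s : R) : pt R := y' + s *: (z - y').
have cga : continuous ga by exact: continuous_ray.
pose A := [set s : R | s \in `[0, 1] /\ fig (ga s)].
have cA : compact A.
  apply: (subclosed_compact _ (@segment_compact R 0 1)); last by move=> s [].
  apply: closedI; first exact: itv_closed.
  by apply: (@preimage_closed _ _ ga fig) => [s _|]; [exact: cga|exact: closed_fig].
have A0 : A 0.
  split; first by rewrite bound_itvE.
  exists i => k; rewrite /ga scale0r addr0.
  by have := (Uy' (i, k)).1 (iy1 k) => /ltW.
(* The last time at which the segment is in the figure exists by compactness. *)
have [s0] : exists2 s, s \in A & forall t, t \in A -> t <= s.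
  apply: (@compact_EVT_max _ _ idfun) => //; first by exists 0.
  by apply: continuous_subspaceT => s; exact: cvg_id.
rewrite inE => -[]; rewrite in_itv /= => /andP[s00 s01] fw smax.
have s01' : s0 < 1.
  rewrite lt_neqAle s01 andbT; apply/eqP => s1; apply: nfz.
  by move: fw; rewrite s1 /ga scale1r addrC subrK.
set w := ga s0 in fw *.
have after P : nbhs w P -> exists s, [/\ s0 < s, s <= 1, ~ fig (ga s) & P (ga s)].
  move=> /(near_ray_gt0 (z - y'))[t2 t20 ht2].
  pose t3 := Num.min t2 (1 - s0).
  have t30 : 0 < t3 by rewrite lt_min t20 subr_gt0.
  have t32 : t3 <= t2 by rewrite ge_min lexx.
  have t31 : t3 <= 1 - s0 by rewrite ge_min lexx orbT.
  have le1 : s0 + t3 <= 1 by rewrite addrC -lerBrDr.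
  exists (s0 + t3); split=> //; first by rewrite ltrDl.
    move=> h; have : s0 + t3 \in A.
      by rewrite inE; split=> //; rewrite in_itv /= le1 andbT addr_ge0// ltW.
    by move=> /smax; rewrite gerDl leNgt t30.
  by rewrite /ga scalerDl addrA; apply: ht2; rewrite gtr0_norm.
have [j hj] := fw.
have [k jk] : exists k, form (j, k) w = 0.
  apply: contrapT => nk.
  have [s [_ _ nf]] := after _ (near_form_sign c w).
  move=> hs; apply: nf; exists j => k; apply/ltW/(hs _).1.
  by rewrite lt_def hj andbT; apply/eqP => h; apply: nk; exists k.
set e := (j, k) in jk.
(* A further line through [w] would make [w] a vertex, and [y'] would lie on the line from [z] to
   that vertex. *)
have sw : simple c e w.
  split=> // e' e'w; have [//|[ne wv]] := coin_or_vtx jk e'w.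
  have zw : z <> vtx e e' by rewrite -wv => zw; apply: nfz; rewrite zw.
  have := y'v _ _ zw; rewrite -wv /w /ga.
  by rewrite /orient !mxE; apply: contra_neqP => _; ring.
have ew : (1 - s0) * form e y' + s0 * form e z = 0 by rewrite -form_line.
have s0' : 0 < 1 - s0 by rewrite subr_gt0.
have ez : form e z != 0.
  apply/eqP => h; move: ew; rewrite h mulr0 addr0 => /eqP.
  by rewrite mulf_eq0 (negbTE (y'e e)) gt_eqF.
have bw : bpoint e w.
  split=> //; have [s [ss0 s1 nf [_ hs]]] := after _ (fig_near cpos sw).
  have ega : (1 - s0) * form e (ga s) = (s - s0) * form e z.
    rewrite /ga form_line; move: ew.
    move: (form e z) (form e y') => a b h.
    transitivity ((1 - s) * ((1 - s0) * b + s0 * a) + (s - s0) * a); first by ring.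
    by rewrite h; ring.
  have ss0' : 0 < s - s0 by rewrite subr_gt0.
  have [zp|zn] : 0 < form e z \/ form e z < 0.
    by move: ez; rewrite neq_lt => /orP[]; auto.
    case=> h _; apply: nf; apply/(hs 1) => //; rewrite mul1r.
    by rewrite -(pmulr_rgt0 _ s0') ega mulr_gt0.
  case=> _ h; apply: nf; apply/(hs (-1)) => //; rewrite mulN1r oppr_gt0.
  by rewrite -(pmulr_rlt0 _ s0') ega pmulr_rlt0.
(* By [H] the points [y] and [z] are strictly on one side of [e]. The moves from [y] to [y1] and
   [y'] kept the sign, so [y'] and [z] are too, although [form e] vanishes at [w] between them. *)
have := H _ _ bw => Hyz.
have : 0 < form e y' * form e z.
  have [h1 h2] := hy1 e; have [h3 h4] := Uy' e.
  have [yp|yn|y0] := ltgtP (form e y) 0.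
  - have := h4 (h2 yp) => yn'; rewrite nmulr_rgt0 // -(nmulr_rgt0 _ yp) //.
  - have := h3 (h1 yn) => yp'; rewrite pmulr_rgt0 // -(pmulr_rgt0 _ yn) //.
  - by move: Hyz; rewrite y0 mul0r ltxx.
move=> hyz; have : (1 - s0) * (form e y' * form e z) + s0 * (form e z) ^+ 2 = 0.
  by rewrite expr2 !mulrA -mulrDl ew mul0r.
have : 0 < (1 - s0) * (form e y' * form e z) by rewrite mulr_gt0.
have : 0 <= s0 * (form e z) ^+ 2 by rewrite mulr_ge0// sqr_ge0.
by move=> h1 h2 h3; move: h2; rewrite ltNge => /negP; apply; lra.
Qed.

Lemma fig_on_line x : fig x -> nbhs x fig \/ exists i k,
  (forall k, 0 <= form (i, k) x) /\ form (i, k) x = 0.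
Proof.
move=> [i hi]; have [[k ik]|nk] := pselect (exists k, form (i, k) x = 0).
  by right; exists i, k.
left; apply: filterS (near_form_sign c x) => y hy; exists i => k.
apply/ltW/(hy _).1; rewrite lt_def hi andbT; apply/eqP => h; apply: nk.
by exists k.
Qed.

Lemma coin_sym e e' : coin e e' -> coin e' e.
Proof.
move=> h; have [k k0 hk] := form_coin cpos h.
by split; apply: (mulfI k0); rewrite -hk mulr0; [exact: orientl|exact: orientr].
Qed.

Lemma coin_trans e e' e2 : coin e e' -> coin e' e2 -> coin e e2.
Proof.
move=> [h1 h2] h; have [k k0 hk] := form_coin cpos h.
by split; rewrite hk ?h1 ?h2 mulr0.
Qed.

Lemma coin_form0 e e' x : coin e e' -> form e x = 0 <-> form e' x = 0.
Proof.
move=> /(form_coin cpos)[k k0 ->]; split=> [->|/eqP]; first by rewrite mulr0.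
by rewrite mulf_eq0 (negbTE k0) => /eqP.
Qed.

Lemma coin_same i k k' : coin (i, k) (i, k') -> k = k'.
Proof.
have [e1 e2 e3 e4 [e5 e6]] := ord3E.
move=> []; rewrite !formE /=; move: k k'.
have := cpos i; rewrite /pos3 => o.
by do 2 apply: ord3P => //; rewrite ?(e1,e2,e3) ?(orientl,orientr) => h1 h2;
  exfalso; move: o h1 h2; rewrite /orient; lra.
Qed.

(** The point [x] is on the line of [e], but perhaps not on the edge [e] itself. A triangle of the
    figure containing [x] has an edge through it, as otherwise it would cover both sides. Since [x]
    is simple, this edge is on the same line and [x] is none of its end points, so it contains a
    short boundary segment starting at [x]. *)
Lemma bpoint_segment e x : bpoint e x -> exists i k q,
  [/\ coin e (i, k), x <> q, form (i, k) x = 0, form (i, k) q = 0 &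
   segment x q `<=` segment (c i k) (c i (k + 1)) `&` boundary fig].
Proof.
move=> be; have [[ex sx] fx ncov] := be.
have [i [k [hi ik]]] : exists i k, (forall k, 0 <= form (i, k) x) /\ form (i, k) x = 0.
  move: fx => [i hi]; have [[k ik]|nk] := pselect (exists k, form (i, k) x = 0).
    by exists i, k.
  case: ncov; split; exists i => k; left; rewrite lt_def hi andbT; apply/eqP => h;
    by apply: nk; exists k.
have ck := sx _ ik.
have ok k' : k' <> k -> 0 < form (i, k') x.
  move=> kk; rewrite lt_def hi andbT; apply/eqP => h; apply: kk.
  by apply: (@coin_same i); apply: coin_trans (coin_sym (sx _ h)) ck.
have [t t0 ht] := near_ray_gt0 (c i (k + 1) - c i k)
  (filterI (bpoint_boundary cpos be) (near_form_sign c x)).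
have nek := pos3_neq (k := k) (cpos i).
have on s : form (i, k) (x + s *: (c i (k + 1) - c i k)) = 0.
  by rewrite formE orient_add -/(form (i, k) x) ik /= !mxE; ring.
exists i, k, (x + t *: (c i (k + 1) - c i k)); split=> //.
  move=> /eqP; rewrite -subr_eq0 opprD addrA subrr add0r oppr_eq0 scaler_eq0.
  rewrite (gt_eqF t0) /= subr_eq0 => /eqP e1; exact: nek.
rewrite segmentE => y [s [/andP[s0 s1] ->]].
rewrite [x + _ - x]addrC addrA [- x + x]addrC subrr add0r scalerA.
have := ht (s * t); rewrite ger0_norm ?mulr_ge0 ?(ltW t0)// ger_pMl//.
move=> /(_ s1)[hb hs]; split; last first.
  by apply: hb; apply/(coin_form0 _ ck).
have := on (s * t); have : forall k', 0 <= form (i, k') (x + (s * t) *: (c i (k + 1) - c i k)).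
  move=> k'; have [->|/eqP kk] := eqVneq k' k; first by rewrite on.
  exact/ltW/(hs _).1/ok.
move: (x + _) => v hv vk.
have [a va] := orient0_line nek vk.
rewrite segmentE; exists a; split=> //.
have := pos3k k (cpos i); have := hv (k + 1); have := hv (k + 2%:R).
have [e1 e2 e3 e4 [e5 e6]] := ord3E.
rewrite !formE /= va -![k + _ + _]addrA e2 e3 addr0 !orient_line orientl orientr !mulr0 add0r addr0.
have -> : orient (c i (k + 2%:R)) (c i k) (c i (k + 1)) =
  orient (c i k) (c i (k + 1)) (c i (k + 2%:R)) by rewrite /orient; ring.
have -> : orient (c i (k + 1)) (c i (k + 2%:R)) (c i k) =
  orient (c i k) (c i (k + 1)) (c i (k + 2%:R)) by rewrite /orient; ring.
move=> h1 h2 o; rewrite pmulr_lge0// in h1; rewrite pmulr_lge0 ?subr_ge0// in h2.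
by rewrite h1.
Qed.

Definition bl (S : set (pt R)) (p q : pt R) : Prop :=
  p <> q /\ segment p q `<=` boundary S.

Lemma segment_zero e p q x y : x <> y -> segment p q x -> segment p q y ->
  form e x = 0 -> form e y = 0 -> form e p = 0 /\ form e q = 0.
Proof.
move=> xy; rewrite segmentE => -[a [_ xa]] [b [_ yb]]; rewrite xa yb !form_line => h1 h2.
have ab : a - b != 0.
  by rewrite subr_eq0; apply/eqP => ab; apply: xy; rewrite xa yb ab.
split; apply: (mulfI ab); rewrite mulr0.
  transitivity (a * ((1 - b) * form e p + b * form e q) -
    b * ((1 - a) * form e p + a * form e q)); first by ring.
  by rewrite h1 h2; ring.
transitivity ((1 - b) * ((1 - a) * form e p + a * form e q) -
   (1 - a) * ((1 - b) * form e p + b * form e q)); first by ring.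
by rewrite h1 h2; ring.
Qed.

Lemma boundary_on_line x : boundary fig x -> exists e, form e x = 0.
Proof.
move=> [cx ix]; have fx : fig x by move: cx; rewrite -(iffLR (closure_id _) (closed_fig (c := c))).
by have [//|[i [k [_ h]]]] := fig_on_line fx; exists (i, k).
Qed.

(** The pigeonhole principle is used twice. The boundary is covered by finitely many lines, so one
    of them, that of [e], contains the segment; and the other lines cannot cover the segment, so it
    has a simple point. Were both sides covered there, the point would be interior. *)
Lemma bl_bpoint p q : bl fig p q ->
  exists e x, bpoint e x /\ forall v, orient p q v = 0 <-> form e v = 0.
Proof.
move=> [pq sb].
have [e [x0 [y0 [xy0 sx0 sy0 ex0 ey0]]]] :=
  segment_pigeon (E := (I * 'I_3)%type) (Q := fun e x => form e x = 0) pq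
    (fun x sx => boundary_on_line (sb _ sx)).
have [ep eq] := segment_zero xy0 sx0 sy0 ex0 ey0.
have [k hk] := orient_coin pq ep eq.
have k0 : k != 0.
  by apply/eqP => k0; have := form_apex cpos e; rewrite formE hk k0 mul0r ltxx.
have same v : orient p q v = 0 <-> form e v = 0.
  rewrite formE hk; split=> [->|/eqP]; first by rewrite mulr0.
  by rewrite mulf_eq0 (negbTE k0) => /eqP.
have one x : segment p q x -> form e x = 0.
  by rewrite segmentE => -[a [_ ->]]; rewrite form_line ep eq; ring.
have [x [sx gx]] : exists x, segment p q x /\ simple c e x.
  apply: contrapT => ng.
  have bad x : segment p q x -> exists e', form e' x = 0 /\ ~ coin e e'.
    move=> sx; apply: contrapT => nb; apply: ng; exists x; split=> //; split.
      exact: one.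
    by move=> e' e'x; apply: contrapT => nc; apply: nb; exists e'.
  have [e' [x [y [xy sx sy [e'x nc] [e'y _]]]]] := segment_pigeon pq bad.
  have [//|[ne xv]] := coin_or_vtx (one _ sx) e'x.
  have yv := vtx_uniq ne (one _ sy) e'y.
  by apply: xy; rewrite xv yv.
exists e, x; split=> //; have [cx ix] := sb _ sx.
have fx : fig x by move: cx; rewrite -(iffLR (closure_id _) (closed_fig (c := c))).
split=> // -[cp cm]; apply: ix.
rewrite /interior /=; apply: filterS (fig_near cpos gx) => y [h1 h2].
have [ey|ey|ey] := ltgtP (form e y) 0.
- by apply/(h2 (-1)) => //; rewrite mulN1r oppr_gt0.
- by apply/(h2 1) => //; rewrite mul1r.
- by apply/(h1 ey).
Qed.

Lemma bpoint_bl e x : bpoint e x ->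
  exists p q, bl fig p q /\ forall v, orient p q v = 0 <-> form e v = 0.
Proof.
move=> /bpoint_segment[i [k [q [ck xq ix iq sb]]]].
exists x, q; split; first by split=> // y /sb[].
move=> v; rewrite (coin_form0 _ ck).
have [l hl] := orient_coin xq ix iq.
have l0 : l != 0.
  by apply/eqP => l0; have := form_apex cpos (i, k); rewrite formE hl l0 mul0r ltxx.
rewrite formE hl; split=> [->|/eqP]; first by rewrite mulr0.
by rewrite mulf_eq0 (negbTE l0) => /eqP.
Qed.

Lemma segment_line (p q a b v : pt R) : p <> q -> segment a b p -> segment a b q ->
  orient p q v = 0 <-> orient a b v = 0.
Proof.
move=> pq sp sq.
have ab : a <> b.
  move=> ab; move: sp sq; rewrite ab !segmentE => -[s [_ pe]] [s' [_ qe]]; apply: pq.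
  by rewrite pe qe subrr !scaler0.
have on x : segment a b x -> orient a b x = 0.
  by rewrite segmentE => -[s [_ ->]]; rewrite orient_line orientl orientr; ring.
have [l hl] := orient_coin pq (on _ sp) (on _ sq).
rewrite hl; split=> [->|/eqP]; first by rewrite mulr0.
rewrite mulf_eq0 => /orP[/eqP l0|/eqP//].
exfalso; pose n : pt R := \col_i (if i == 0 then - (b 1 0 - a 1 0) else b 0 0 - a 0 0).
have := hl (a + 1 *: n); rewrite l0 mul0r orient_add orientl add0r mul1r !mxE /=.
by apply/eqP; rewrite mulrN opprK -!expr2 gt_eqF// sqr_dist_gt0.
Qed.

(** [Ts] may contain degenerate triangles besides the [tri (c i)], as long as the figure is the
    same. A boundary segment may be pieced together from several edges, but by [bpoint_segment] some
    edge on its line contains a boundary segment of its own. *)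
Lemma ts_lineP (Ts : set (set (pt R))) (l : set (pt R)) :
  figure Ts = fig -> (forall i, Ts (tri (c i))) ->
  ts_line Ts l <-> exists p q, bl fig p q /\ l = [set v | orient p q v = 0].
Proof.
move=> figT hT; split.
  move=> [T [e [TT [a [b [_ _ ab ->]]] [p [q [pq]]]]]]; rewrite figT => sb ->.
  exists p, q; split; first by split=> // x /sb[].
  rewrite line_through_segment//; apply/seteqP; split=> v /=.
    by move/(segment_line v pq (sb _ (@segl _ p q)).1 (sb _ (@segr _ p q)).1).
  by move/(segment_line v pq (sb _ (@segl _ p q)).1 (sb _ (@segr _ p q)).1).
move=> [p [q [/bl_bpoint[e [x [be same]]] ->]]].
have [i [k [q' [ck xq ix iq sb]]]] := bpoint_segment be.
exists (tri (c i)), (segment (c i k) (c i (k + 1))); split=> //.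
- by apply/edge_tri => //; exists k.
- by rewrite figT; exists x, q'.
rewrite line_through_segment; last exact: pos3_neq.
by apply/seteqP; split=> v /=; rewrite same (coin_form0 _ ck).
Qed.

Lemma separation_bl y z : fig y -> ~ fig z ->
  exists p q, bl fig p q /\ orient p q y * orient p q z <= 0.
Proof.
move=> fy fz; have [e [w [be h]]] := separation fy fz.
have [p [q [b same]]] := bpoint_bl be; exists p, q; split=> //.
have [k hk] := orient_coin b.1 (iffLR (same p) (orientl _ _)) (iffLR (same q) (orientr _ _)).
have k0 : k != 0.
  by apply/eqP => k0; have := form_apex cpos e; rewrite formE hk k0 mul0r ltxx.
move: h; rewrite !formE !hk mulrACA -expr2 pmulr_rle0// exprn_even_gt0//.
Qed.

End SceneLines.

(** * Neighbours in cyclic lists *)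

Section CyclicSeq.
Context {T : eqType}.
Implicit Types (s : seq T) (x : T).

Lemma next_nth_uniq x0 s i : uniq s -> (i < size s)%N ->
  next s (nth x0 s i) = if (i.+1 < size s)%N then nth x0 s i.+1 else nth x0 s 0.
Proof.
case: s => [//|y s] us hi; rewrite next_nth mem_nth// index_uniq//=.
case: ifP => h; first by apply: set_nth_default.
by rewrite nth_default//; move: h; rewrite ltnS ltnNge => /negbFE.
Qed.

Lemma next_neq s x : uniq s -> (1 < size s)%N -> x \in s -> next s x != x.
Proof.
move=> us s1 xs; rewrite -{1 2}(nth_index x xs) next_nth_uniq ?index_mem//.
case: ifP => h; first by rewrite nth_uniq ?index_mem// gtn_eqF.
rewrite nth_uniq ?index_mem ?(ltnW s1)// eq_sym.
by apply/eqP => e; move: h; rewrite e s1.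
Qed.

Lemma next_next_neq s x : uniq s -> (2 < size s)%N -> x \in s ->
  next s (next s x) != x.
Proof.
move=> us s2 xs; have s0 : (0 < size s)%N by apply: ltn_trans s2.
have s1 : (1 < size s)%N by apply: ltn_trans s2.
have hi : (index x s < size s)%N by rewrite index_mem.
rewrite -{1 2}(nth_index x xs) next_nth_uniq//.
have := hi; move: (index x s) => i {}hi.
case: ifP => h; rewrite next_nth_uniq//; case: ifP => h'; rewrite nth_uniq//.
- by rewrite gtn_eqF.
- by apply/eqP => e; move: h'; rewrite -e s2.
- by apply/eqP => e; move: h; rewrite -e s2.
- by rewrite s1 in h'.
Qed.

End CyclicSeq.

Lemma next_map_inj (T T' : eqType) (f : T -> T') s x : {in s &, injective f} ->
  uniq s -> x \in s -> next (map f s) (f x) = f (next s x).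
Proof.
move=> fi us xs; rewrite -{1 2}(nth_index x xs).
have hi : (index x s < size s)%N by rewrite index_mem.
have um : uniq (map f s) by rewrite map_inj_in_uniq.
have s0 : (0 < size s)%N by apply: leq_ltn_trans hi.
rewrite -(nth_map x (f x) f hi) !next_nth_uniq ?size_map//.
by case: ifP => h; rewrite (nth_map x).
Qed.

(** * Faces of the line arrangement *)

Section Polygons.
Context {R : realType}.
Implicit Types (p q r u v w x y z g : pt R) (s t : R) (S C D F : set (pt R)) (vs : seq (pt R)).

Lemma orient_centroid p q vs : (0 < size vs)%N ->
  (size vs)%:R * orient p q (centroid vs) = \sum_(v <- vs) orient p q v.
Proof.
move=> s0; pose lin (v : pt R) := (q 0 0 - p 0 0) * v 1 0 - (q 1 0 - p 1 0) * v 0 0.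
have oE x : orient p q x = lin x - lin p by rewrite /orient /lin; ring.
have sE (us : seq (pt R)) : lin (\sum_(v <- us) v) = \sum_(v <- us) lin v.
  elim: us => [|a us IH]; first by rewrite !big_nil /lin !mxE; ring.
  by rewrite !big_cons -IH /lin !mxE; ring.
have zE k x : lin (k *: x) = k * lin x by rewrite /lin !mxE; ring.
rewrite oE zE sE mulrBr mulrA divff ?mul1r ?pnatr_eq0 -?lt0n//.
rewrite [in RHS](eq_bigr (fun v => lin v - lin p)); last by move=> v _; exact: oE.
elim: (vs) => [|a us IH] /=; first by rewrite !big_nil mul0r subrr.
by rewrite !big_cons -IH -natr1; ring.
Qed.

Lemma orient_centroid_ge0 p q vs (k : R) : (0 < size vs)%N ->
  (forall v, v \in vs -> 0 <= k * orient p q v) ->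
  (exists2 v, v \in vs & orient p q v != 0) -> k != 0 ->
  0 < k * orient p q (centroid vs).
Proof.
move=> s0 h [v vv v0] k0; rewrite -(@pmulr_rgt0 _ (size vs)%:R) ?ltr0n//.
rewrite mulrCA orient_centroid// mulr_sumr big_seq lt_def sumr_ge0 ?andbT//.
rewrite psumr_neq0//; apply/hasP; exists v => //; rewrite vv /=.
by rewrite lt_def h// mulf_neq0.
Qed.

Lemma segment_component D x y : segment x y `<=` D -> connected_component D x y.
Proof.
move=> sD; apply: (@connected_component_max _ D (segment x y)) => //; try exact: segl; try exact: segr.
have -> : segment x y = (fun s : R => x + s *: (y - x)) @` `[0, 1].
  rewrite segmentE; apply/seteqP; split=> [_ [s [s01 ->]]|_ [s s01 <-]].
    by exists s => //=; rewrite in_itv.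
  by exists s; split=> //; move: s01; rewrite /= in_itv.
apply: connected_continuous_connected.
  by apply/connected_intervalP; exact: interval_is_interval.
by apply: continuous_subspaceT; exact: continuous_ray.
Qed.

Lemma connected_orient C p q x y : connected C ->
  (forall z, C z -> orient p q z != 0) -> C x -> C y ->
  0 < orient p q x * orient p q y.
Proof.
move=> cC nz Cx Cy; rewrite ltNge; apply/negP => h.
have : connected (orient p q @` C).
  apply: connected_continuous_connected => //.
  by apply: continuous_subspaceT; exact: continuous_orient.
move=> /connected_intervalP itv.
have key a b : C a -> C b -> orient p q a <= 0 <= orient p q b -> False.
  move=> Ca Cb ab; have := itv (orient p q a) (orient p q b).
  move=> /(_ (ex_intro2 _ _ a Ca erefl) (ex_intro2 _ _ b Cb erefl) 0 ab)[z Cz z0].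
  by have := nz _ Cz; rewrite z0 eqxx.
have [xn|xp] := leP (orient p q x) 0.
  apply: (key x y) => //; rewrite xn /=; rewrite nmulr_rle0// in h.
  by rewrite lt_def xn andbT eq_sym nz.
by apply: (key y x) => //; rewrite (ltW xp) andbT -(pmulr_rle0 _ xp).
Qed.

(** The box is the continuous image of a product of two compact intervals. *)
Lemma compact_box F (M : R) : closed F ->
  (forall x, F x -> `|x 0 0| <= M /\ `|x 1 0| <= M) -> compact F.
Proof.
move=> cF h.
pose e0 : pt R := \col_i (if i == 0 then 1 else 0).
pose e1 : pt R := \col_i (if i == 0 then 0 else 1).
pose f (a : R * R) : pt R := a.1 *: e0 + a.2 *: e1.
have cf : continuous f.
  move=> a; apply: cvgD.
    by apply: cvgZr_tmp; exact: cvg_fst.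
  by apply: cvgZr_tmp; exact: cvg_snd.
have cB : compact (f @` (`[- M, M] `*` `[- M, M])).
  apply: continuous_compact; first exact: continuous_subspaceT.
  by apply: compact_setX; exact: segment_compact.
apply: (subclosed_compact _ cB) => // x /h[h0 h1].
exists (x 0 0, x 1 0); first by split; rewrite /= in_itv /= -ler_norml.
by apply: pt_eqP; rewrite /f !mxE /=; ring.
Qed.

(** A lexicographic maximum: among the points maximising [orient p q], one is chosen that maximises
    the form of the perpendicular line through [p] and [n]. A point is determined by these two
    values, so it is extreme. *)
Lemma extreme_max F p q : p <> q -> compact F -> F !=set0 ->
  exists2 v, extreme F v & forall y, F y -> orient p q y <= orient p q v.
Proof.
move=> pq cF F0.
pose n : pt R := p + \col_i (if i == 0 then - (q 1 0 - p 1 0) else q 0 0 - p 0 0).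
have [a aF amax] : exists2 a, a \in F & forall t : pt R, t \in F -> orient p q t <= orient p q a.
  apply: compact_EVT_max => //.
  by apply: continuous_subspaceT; exact: continuous_orient.
rewrite inE in aF.
pose G := F `&` [set y | orient p q a <= orient p q y].
have cG : compact G.
  apply: compact_closedI => //.
  apply: (@preimage_closed _ _ (orient p q) [set z | orient p q a <= z]); last exact: closed_ge.
  by move=> y _; exact: continuous_orient.
have [v vG vmax] : exists2 v, v \in G & forall t : pt R, t \in G -> orient p n t <= orient p n v.
  apply: compact_EVT_max => //; first by exists a; split; [|exact: lexx].
  by apply: continuous_subspaceT; exact: continuous_orient.
move: vG; rewrite inE => -[vF]; move=> av.
have amax' y : F y -> orient p q y <= orient p q v.
  by move=> Fy; apply: le_trans av; apply: amax; rewrite inE.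
exists v => //; split=> // b b' s Fb Fb' /andP[s0 s1] vE.
have vE' : v = b + s *: (b' - b) by rewrite vE scalerBr scalerBl scale1r addrAC addrA.
have s1' : 0 < 1 - s by rewrite subr_gt0.
have key (h h' hv : R) : h <= hv -> h' <= hv -> (1 - s) * h + s * h' = hv -> h = hv /\ h' = hv.
  move=> h1 h2 e; have : (1 - s) * (hv - h) + s * (hv - h') = 0.
    by transitivity (hv - ((1 - s) * h + s * h')); [ring|rewrite e subrr].
  have : 0 <= (1 - s) * (hv - h) by rewrite mulr_ge0 ?subr_ge0// ltW.
  have : 0 <= s * (hv - h') by rewrite mulr_ge0 ?subr_ge0// ltW.
  move=> a1 a2 a3.
  have /eqP : (1 - s) * (hv - h) = 0 by lra.
  have /eqP : s * (hv - h') = 0 by lra.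
  by rewrite !mulf_eq0 (gt_eqF s0) (gt_eqF s1') /= !subr_eq0 => /eqP <- /eqP <-.
have [b1 b1'] : orient p q b = orient p q v /\ orient p q b' = orient p q v.
  by apply: key; [exact: amax'|exact: amax'|rewrite -orient_line -vE'].
have inG y : F y -> orient p q y = orient p q v -> y \in G.
  by move=> Fy yv; rewrite inE; split=> //=; rewrite yv.
have [b2 b2'] : orient p n b = orient p n v /\ orient p n b' = orient p n v.
  by apply: key; [apply: vmax; exact: inG..|rewrite -orient_line -vE'].
have d0 := sqr_dist_gt0 pq.
have e1 : orient p q b = orient p q b' by rewrite b1 b1'.
have e2 : orient p n b = orient p n b' by rewrite b2 b2'.
move: e1 e2; rewrite /orient /n !mxE /= => e1 e2.
have nz : (q 0 0 - p 0 0) ^+ 2 + (q 1 0 - p 1 0) ^+ 2 != 0 by rewrite gt_eqF.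
set A := q 0 0 - p 0 0 in e1 e2 nz *; set B := q 1 0 - p 1 0 in e1 e2 nz *.
have E1 : A * (b 1 0 - b' 1 0) - B * (b 0 0 - b' 0 0) = 0 by lra.
have E2 : - B * (b 1 0 - b' 1 0) - A * (b 0 0 - b' 0 0) = 0 by lra.
apply: pt_eqP; apply: (mulfI nz); apply/eqP; rewrite -subr_eq0; apply/eqP.
  transitivity (- B * (A * (b 1 0 - b' 1 0) - B * (b 0 0 - b' 0 0)) -
    A * (- B * (b 1 0 - b' 1 0) - A * (b 0 0 - b' 0 0))); first by ring.
  by rewrite E1 E2; ring.
transitivity (A * (A * (b 1 0 - b' 1 0) - B * (b 0 0 - b' 0 0)) -
    B * (- B * (b 1 0 - b' 1 0) - A * (b 0 0 - b' 0 0))); first by ring.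
by rewrite E1 E2; ring.
Qed.

(* The kept faces, described by the boundary of S alone: the lines drawn are
   those that carry a segment bl S p q. *)
Definition good_polygon S vs : Prop :=
 [/\ uniq vs, (2 < size vs)%N,
   forall v, v \in vs -> exists k : R, forall u, u \in vs -> u != v ->
     u != next vs v -> 0 < k * orient v (next vs v) u,
   forall v, v \in vs -> exists p q,
     [/\ bl S p q, orient p q v = 0 & orient p q (next vs v) = 0] &
   (forall p q, bl S p q -> (forall v, v \in vs -> 0 <= orient p q v) \/
                            (forall v, v \in vs -> orient p q v <= 0)) /\
   S (centroid vs)].

Lemma near_seq (U : eqType) (l : seq U) x (P : U -> set (pt R)) :
  (forall j, j \in l -> nbhs x (P j)) -> nbhs x [set y | forall j, j \in l -> P j y].
Proof.
elim: l => [|a l IH] h; first by apply: filterS filterT.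
have h1 := h a (mem_head _ _).
have h2 : nbhs x [set y | forall j, j \in l -> P j y].
  by apply: IH => j jl; apply: h; rewrite inE jl orbT.
apply: filterS2 h1 h2 => y y1 y2 j; rewrite inE => /orP[/eqP ->//|]; exact: y2.
Qed.

(** A discrete intermediate value theorem. It starts at index 1 because index 0 is the common apex
    of the fan in [poly_fan]. *)
Lemma sign_change (g : nat -> R) n : (1 < n)%N -> g 1 * g n <= 0 ->
  exists2 i, (0 < i < n)%N & g i * g i.+1 <= 0.
Proof.
move=> n1 h; apply: contrapT => ne.
have ne' i : (0 < i < n)%N -> 0 < g i * g i.+1.
  by move=> hi; rewrite ltNge; apply/negP => h'; apply: ne; exists i.
have g10 : g 1 != 0 by apply/eqP => e; have := ne' 1 n1; rewrite e mul0r ltxx.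
suff : forall i, (0 < i <= n)%N -> 0 < g 1 * g i.
  by move=> /(_ n); rewrite leqnn (ltnW n1) ltNge h => /(_ isT).
elim=> [//|[|i] IH hi]; first by rewrite -expr2 exprn_even_gt0.
have h1 := IH (ltnW hi); have h2 := ne' i.+1 hi.
have : 0 < (g 1 * g i.+1) * (g i.+1 * g i.+2) by rewrite mulr_gt0.
rewrite (_ : _ * _ = (g 1 * g i.+2) * g i.+1 ^+ 2); last by ring.
rewrite pmulr_lgt0// exprn_even_gt0//=; apply/eqP => e.
by move: h2; rewrite e mul0r ltxx.
Qed.

Lemma zero_between (a b : R) : a * b <= 0 ->
  exists s, 0 <= s <= 1 /\ (1 - s) * a + s * b = 0.
Proof.
move=> ab; have [e|e] := eqVneq a 0.
  by exists 0; rewrite lexx ler01 e mulr0 mul0r addr0.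
have d : a - b != 0.
  rewrite subr_eq0; apply/eqP => e'; move: ab; rewrite -e' -expr2 => h.
  by move: (exprn_even_gt0 (n := 2) a isT); rewrite /= e ltNge h.
exists (a / (a - b)); split; last by field.
have [an|ap] := ltP a 0.
  have b0 : 0 <= b by rewrite -(nmulr_rle0 _ an).
  have dn : a - b < 0 by lra.
  by rewrite -mulrNN -invrN divr_ge0 ?ler_pdivrMr; lra.
have {}ap : 0 < a by rewrite lt_def e.
have b0 : b <= 0 by rewrite -(pmulr_rle0 _ ap).
have dn : 0 < a - b by lra.
by rewrite divr_ge0 ?ler_pdivrMr; lra.
Qed.

Lemma convex_zero (s a b : R) : 0 < s < 1 -> 0 <= a -> 0 <= b ->
  (1 - s) * a + s * b = 0 -> a = 0 /\ b = 0.
Proof.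
move=> /andP[s0 s1] a0 b0 e; have s1' : 0 < 1 - s by rewrite subr_gt0.
have h1 : 0 <= (1 - s) * a by rewrite mulr_ge0// ltW.
have h2 : 0 <= s * b by rewrite mulr_ge0// ltW.
have /eqP : (1 - s) * a = 0 by lra.
have /eqP : s * b = 0 by lra.
by rewrite !mulf_eq0 (gt_eqF s0) (gt_eqF s1') /= => /eqP -> /eqP ->.
Qed.

End Polygons.

(** * A good polygon is a kept face *)

Section GoodPolygonFace.
Context {R : realType} (S : set (pt R)) (vs : seq (pt R)).
Hypothesis GP : good_polygon S vs.
Hypothesis sep : forall y z, S y -> ~ S z ->
  exists p q, bl S p q /\ orient p q y * orient p q z <= 0.
Implicit Types (p q r u v w x y z : pt R) (s t : R).
Local Notation nx := (next vs).
Let g := centroid vs.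

Let us : uniq vs. Proof. by case: GP. Qed.
Let s2 : (2 < size vs)%N. Proof. by case: GP. Qed.
Let s1 : (1 < size vs)%N. Proof. exact: ltn_trans s2. Qed.
Let s0 : (0 < size vs)%N. Proof. exact: ltn_trans s1. Qed.

(** The factor at the centroid [g] makes the form positive on the inner side, whichever way [vs]
    runs around the polygon. *)
Definition side v y : R := orient v (nx v) g * orient v (nx v) y.

Let side_pos v u : v \in vs -> u \in vs -> u != v -> u != nx v -> 0 < side v u.
Proof.
move=> vv uu uv un; have [_ _ /(_ _ vv)[k hk] _ _] := GP.
have h1 := hk _ uu uv un.
have k0 : k != 0 by apply: contraTneq h1 => ->; rewrite mul0r ltxx.
have : 0 < k * orient v (nx v) g.
  apply: orient_centroid_ge0 => //; last first.
    by exists u => //; apply: contraTneq h1 => ->; rewrite mulr0 ltxx.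
  move=> w ww; have [->|wv] := eqVneq w v; first by rewrite orientl mulr0.
  have [->|wn] := eqVneq w (nx v); first by rewrite orientr mulr0.
  exact/ltW/hk.
rewrite /side; move: (orient _ _ _) => a ka; move: h1; move: (orient _ _ _) => b kb.
have : 0 < (k * a) * (k * b) by rewrite mulr_gt0.
by rewrite mulrACA -expr2 pmulr_rgt0// exprn_even_gt0.
Qed.

Let nx_in v : v \in vs -> nx v \in vs. Proof. by rewrite mem_next. Qed.

Let side_line v x y s : side v (x + s *: (y - x)) = (1 - s) * side v x + s * side v y.
Proof. by rewrite /side orient_line; ring. Qed.

Let side_g v : v \in vs -> 0 < side v g.
Proof.
move=> vv; have h := side_pos vv (nx_in (nx_in vv)) (next_next_neq us s2 vv)
  (next_neq us s1 (nx_in vv)).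
rewrite /side -expr2 exprn_even_gt0//=; apply: contraTneq h.
by rewrite /side => ->; rewrite mul0r ltxx.
Qed.

Let side0 v : side v v = 0. Proof. by rewrite /side orientl mulr0. Qed.

Let side1 v : side v (nx v) = 0. Proof. by rewrite /side orientr mulr0. Qed.

Definition poly : set (pt R) := [set y | forall v, v \in vs -> 0 <= side v y].

Definition poly_int : set (pt R) := [set y | forall v, v \in vs -> 0 < side v y].

Let poly_convex x y s : poly x -> poly y -> 0 <= s <= 1 -> poly (x + s *: (y - x)).
Proof.
move=> px py /andP[s0' s1'] v vv; rewrite side_line.
by rewrite addr_ge0// mulr_ge0 ?px ?py// subr_ge0.
Qed.

Let vs_poly v : v \in vs -> poly v.
Proof.
move=> vv u uu; have [->|vu] := eqVneq v u; first by rewrite side0.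
have [->|vn] := eqVneq v (nx u); first by rewrite side1.
exact/ltW/side_pos.
Qed.

Let side_eq0 v y : v \in vs -> side v y = 0 -> orient v (nx v) y = 0.
Proof.
move=> /side_g h /eqP; rewrite mulf_eq0 => /orP[/eqP e|/eqP//].
by move: h; rewrite /side e mul0r ltxx.
Qed.

Let vs_extreme v : v \in vs -> extreme poly v.
Proof.
move=> vv; split; first exact: vs_poly.
move=> p q s pp pq s01 vE.
have vE' : v = p + s *: (q - p) by rewrite vE scalerBr scalerBl scale1r addrAC addrA.
pose u := prev vs v.
have uu : u \in vs by rewrite mem_prev.
have nu : nx u = v by exact: next_prev.
have uv : u != v by rewrite -nu eq_sym next_neq.
have un : u != nx v by rewrite -nu eq_sym next_next_neq.
have o : orient v (nx v) u != 0.
  by apply: contraTneq (side_pos vv uu uv un); rewrite /side => ->; rewrite mulr0 ltxx.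
have [p1 q1] : side v p = 0 /\ side v q = 0.
  by apply: (convex_zero s01); rewrite ?pp ?pq// -side_line -vE' side0.
have [p2 q2] : side u p = 0 /\ side u q = 0.
  by apply: (convex_zero s01); rewrite ?pp ?pq// -side_line -vE'; have := side1 u; rewrite nu.
have := side_eq0 uu p2; have := side_eq0 uu q2; rewrite nu => q2' p2'.
by rewrite (orient_cross o (side_eq0 vv p1) p2') (orient_cross o (side_eq0 vv q1) q2').
Qed.

(* Fan triangulation from the first vertex: the ray from it through y hits
   an opposite side. *)
Let poly_fan y : poly y -> exists v0 u, [/\ v0 \in vs, u \in vs & triangle v0 u (nx u) y].
Proof.
move=> py; pose V i := nth 0 vs i; set v0 := V 0%N.
have VV i : (i < size vs)%N -> V i \in vs by move=> ?; rewrite mem_nth.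
have v0v : v0 \in vs by rewrite VV.
have [->|yv0] := eqVneq y v0.
  by exists v0, (V 1%N); rewrite VV// mem_nth//; split=> //; apply: sub_hull; left; left.
exists v0; pose m := (size vs).-1.
have mE : size vs = m.+1 by rewrite prednK.
have nxV i : (i < m)%N -> nx (V i) = V i.+1.
  by move=> im; rewrite next_nth_uniq// ?mE ?ltnS ?im// ltnW.
have nxm : nx (V m) = v0 by rewrite next_nth_uniq// ?mE// ltnn.
have m1 : (1 < m)%N by rewrite -ltnS -mE.
have m0 : (0 < m)%N by apply: ltn_trans m1.
have Vneq i j : (i < size vs)%N -> (j < size vs)%N -> i != j -> V i != V j.
  by move=> hi hj; rewrite nth_uniq.
pose h i := orient v0 y (V i).
(* The two neighbours of [v0] are on different sides of the line from [v0] through [y], because [y]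
   lies in the angle that the polygon has at [v0]. *)
have hm : h 1%N * h m <= 0.
  have a1 : 0 <= side v0 y by exact: py.
  have a2 : 0 <= side (V m) y by apply: py; rewrite VV// mE.
  have a3 : 0 < side v0 (V m).
    by apply: side_pos; rewrite ?VV ?mE// ?nxV//; apply: Vneq; rewrite ?mE// gtn_eqF.
  have a4 : 0 < side (V m) (V 1%N).
    apply: side_pos; rewrite ?VV ?mE// ?nxm//; apply: Vneq; rewrite ?mE//.
    by rewrite ltn_eqF.
  move: a1 a2 a3 a4; rewrite /side nxm (nxV 0%N)//.
  rewrite (_ : orient (V m) v0 (V 1%N) = orient v0 (V 1%N) (V m)); last by rewrite /orient; ring.
  rewrite /h (_ : orient v0 y (V 1%N) = - orient v0 (V 1%N) y); last by rewrite /orient; ring.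
  rewrite (_ : orient v0 y (V m) = orient (V m) v0 y); last by rewrite /orient; ring.
  set a := orient v0 (V 1%N) g; set b := orient (V m) v0 g.
  set x := orient v0 (V 1%N) y; set z := orient (V m) v0 y; set k := orient v0 (V 1%N) (V m).
  move=> ax bz ak bk; rewrite mulNr oppr_le0.
  have ab : 0 < a * b.
    have : 0 < (a * k) * (b * k) by rewrite mulr_gt0.
    rewrite mulrACA -expr2 pmulr_lgt0// exprn_even_gt0//=.
    by apply: contraTneq ak => ->; rewrite mulr0 ltxx.
  by rewrite -(pmulr_rge0 _ ab) mulrACA mulr_ge0.
have [i /andP[i0 im] hi] := sign_change m1 hm.
have ilt : (i < size vs)%N by rewrite mE ltnS ltnW.
have i1lt : (i.+1 < size vs)%N by rewrite mE ltnS.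
have [s [s01 sE]] := zero_between hi.
exists (V i); split; [exact: v0v|exact: VV|rewrite nxV//].
pose w := V i + s *: (V i.+1 - V i).
have ow : orient v0 y w = 0 by rewrite /w orient_line.
have [l wl] := orient0_line (fun e => negP yv0 (introT eqP (esym e))) ow.
have sw : side (V i) w = 0.
  by rewrite /w side_line side0 -nxV// side1 !mulr0 addr0.
have sv0 : 0 < side (V i) v0.
  by apply: side_pos; rewrite ?VV// ?nxV//; apply: Vneq => //; rewrite ltn_eqF.
have sy : 0 <= side (V i) y by apply: py; exact: VV.
have pw : poly w by apply: poly_convex => //; apply: vs_poly; exact: VV.
have slE : (1 - l) * side (V i) v0 + l * side (V i) y = 0 by rewrite -side_line -wl.
have tw : triangle v0 (V i) (V i.+1) w.
  by apply: hullP => //; apply: sub_hull; [left; right|right].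
have tv0 : triangle v0 (V i) (V i.+1) v0 by apply: sub_hull; left; left.
have [l1|l1] := leP 1 l.
  have l0 : 0 < l by exact: lt_le_trans l1.
  have -> : y = v0 + l^-1 *: (w - v0).
    by rewrite wl; apply: pt_eqP; rewrite !mxE; field; rewrite gt_eqF.
  by apply: hullP => //; rewrite invr_ge0 (ltW l0) invf_le1.
(* For [0 <= l < 1] the form [side (V i)] would be positive at [w], where it vanishes. *)
have l0 : l < 0.
  have : 0 < (1 - l) * side (V i) v0 by rewrite mulr_gt0// subr_gt0.
  move=> h1; rewrite ltNge; apply/negP => l0.
  have : 0 <= l * side (V i) y by rewrite mulr_ge0.
  by move=> h2; have := ltr_wpDr h2 h1; rewrite slE ltxx.
(* With [l < 0] the vertex [v0] would be strictly between the polygon points [w] and [y]. *)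
have [_ /(_ w y (- l / (1 - l)) pw py)] := vs_extreme v0v.
have l1' : 0 < 1 - l by rewrite subr_gt0.
have e : w = y -> False.
  move=> wy; have : orient (V i) (nx (V i)) w = 0 by apply: side_eq0 => //; exact: VV.
  move: wl; rewrite wy => /eqP; rewrite -subr_eq0.
  rewrite (_ : y - (v0 + l *: (y - v0)) = (1 - l) *: (y - v0)); last by apply: pt_eqP; rewrite !mxE; ring.
  by rewrite scaler_eq0 gt_eqF//= subr_eq0 (negbTE yv0).
move=> H; exfalso; apply: e; apply: H.
  by rewrite divr_gt0 ?oppr_gt0//= ltr_pdivrMr// mul1r; lra.
by rewrite wl; apply: pt_eqP; rewrite !mxE; field; rewrite gt_eqF.
Qed.

Lemma good_polygon_side v : v \in vs -> 0 < side v g.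
Proof. exact: side_g. Qed.

Let near_side x : \forall y \near x, forall v, v \in vs -> 0 < side v x -> 0 < side v y.
Proof.
apply: near_seq => v vv; have [h|h] := pselect (0 < side v x); last first.
  by apply: filterS filterT => y _ /h.
have o0 : orient v (nx v) g != 0.
  by apply: contraTneq h; rewrite /side => ->; rewrite mul0r ltxx.
move: h; rewrite /side; move: o0; rewrite neq_lt => /orP[] o0.
  rewrite nmulr_rgt0// => h; apply: filterS (near_orient_lt0 h) => y hy _.
  by rewrite nmulr_rgt0.
rewrite pmulr_rgt0// => h; apply: filterS (near_orient_gt0 h) => y hy _.
by rewrite pmulr_rgt0.
Qed.

Let poly_int_sub y : poly_int y -> poly y. Proof. by move=> h v /h/ltW. Qed.

Let poly_weak p q (k : R) y : (forall v, v \in vs -> 0 <= k * orient p q v) ->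
  poly y -> 0 <= k * orient p q y.
Proof.
move=> h /poly_fan[v0 [u [v0v uv]]]; rewrite triangleE => -[a [b [c [a0 b0 c0 e ->]]]].
rewrite (orient_comb _ _ _ _ _ e) (_ : k * _ = a * (k * orient p q v0) +
  b * (k * orient p q u) + c * (k * orient p q (nx u))); last by ring.
by apply: addr_ge0; [apply: addr_ge0|]; apply: mulr_ge0 => //; apply: h => //; exact: nx_in.
Qed.

(** The vertices are weakly on one side of the line and not all on it. An interior point of the
    polygon on the line could be pushed slightly across it, contradicting [poly_weak]; so interior
    points, like the centroid, are strictly on that side. *)
Let bl_sign p q y : bl S p q -> poly_int y -> 0 < orient p q g * orient p q y.
Proof.
move=> b py; have [_ _ hk _ [/(_ _ _ b) hpq _]] := GP.
have [k [k0 hk']] : exists k : R, k != 0 /\ forall v, v \in vs -> 0 <= k * orient p q v.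
  case: hpq => h; first by exists 1; split; [exact: oner_neq0|move=> v vv; rewrite mul1r h].
  by exists (-1); split; [rewrite oppr_eq0 oner_neq0|move=> v vv; rewrite mulN1r oppr_ge0 h].
have [v vv v0] : exists2 v, v \in vs & orient p q v != 0.
  apply: contrapT => n; have z v : v \in vs -> orient p q v = 0.
    by move=> vv; apply/eqP; apply: contrapT => /negP h; apply: n; exists v.
  pose v := nth 0 vs 0; have vv : v \in vs by rewrite mem_nth.
  have := side_pos vv (nx_in (nx_in vv)) (next_next_neq us s2 vv) (next_neq us s1 (nx_in vv)).
  have [s vE] := orient0_line b.1 (z _ vv).
  have [s' nE] := orient0_line b.1 (z _ (nx_in vv)).
  have [t tE] := orient0_line b.1 (z _ (nx_in (nx_in vv))).
  rewrite /side (_ : orient v (nx v) (nx (nx v)) = 0) ?mulr0 ?ltxx//.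
  by rewrite tE nE {1}vE /orient !mxE; ring.
have kg : 0 < k * orient p q g by apply: orient_centroid_ge0 => //; exists v.
have ky : 0 < k * orient p q y.
  rewrite lt_def (poly_weak hk')//; last exact: poly_int_sub.
  rewrite andbT mulf_neq0//; apply/eqP => oy.
  pose n : pt R := \col_i (if i == 0 then - (q 1 0 - p 1 0) else q 0 0 - p 0 0).
  have [t t0 ht] := near_ray_gt0 (- k *: n) (near_side y).
  have : poly (y + t *: (- k *: n)).
    apply: poly_int_sub => u uu; apply: ht => //; first by rewrite gtr0_norm.
    exact: py.
  move=> /(poly_weak hk'); rewrite scalerA orient_add oy add0r !mxE /=.
  have d0 := sqr_dist_gt0 b.1.
  rewrite (_ : k * _ = - (k ^+ 2 * (t * ((q 0 0 - p 0 0) ^+ 2 + (q 1 0 - p 1 0) ^+ 2)))); last by ring.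
  by rewrite oppr_ge0 leNgt (mulr_gt0 _ (mulr_gt0 t0 d0))// exprn_even_gt0.
have : 0 < (k * orient p q g) * (k * orient p q y) by rewrite mulr_gt0.
by rewrite mulrACA -expr2 pmulr_rgt0// exprn_even_gt0.
Qed.

Let poly_int_g : poly_int g. Proof. exact: side_g. Qed.

Let Sg : S g. Proof. by case: GP => _ _ _ _ []. Qed.

Let poly_int_S y : poly_int y -> S y.
Proof.
move=> py; apply: contrapT => /(sep Sg)[p [q [b]]].
by rewrite leNgt (bl_sign b py).
Qed.

Let poly_int_convex x y s : poly_int x -> poly_int y -> 0 <= s <= 1 ->
  poly_int (x + s *: (y - x)).
Proof.
move=> px py /andP[s0' s1'] v vv; rewrite side_line.
move: s1'; rewrite le_eqVlt => /orP[/eqP ->|s1'].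
  by rewrite subrr mul0r add0r mul1r py.
apply: ltr_wpDr; first by apply: mulr_ge0 => //; exact/ltW/py.
by apply: mulr_gt0; [rewrite subr_gt0|exact: px].
Qed.

Let closed_poly : closed poly.
Proof.
have -> : poly = \bigcap_(v in [set` vs]) [set y | 0 <= side v y].
  by apply/seteqP; split=> y h v; exact: h.
apply: closed_bigI => v vv; have gv := side_g vv.
apply: (@preimage_closed _ _ (side v) [set z | 0 <= z]); last exact: closed_ge.
move=> y _; apply: (@cvgM R _ _ (nbhs_filter y)); first exact: cvg_cst.
exact: continuous_orient.
Qed.

Definition cut_hull : set (pt R) :=
  hull S `\` \bigcup_(l in [set l | exists p q, bl S p q /\ l = [set v | orient p q v = 0]]) l.

Let poly_int_cut y : poly_int y -> cut_hull y.
Proof.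
move=> py; split; first by apply: sub_hull; exact: poly_int_S.
move=> [_ [p [q [b ->]]] /= h].
by have := bl_sign b py; rewrite h mulr0 ltxx.
Qed.

(** Points of the component are inside because each side of the polygon is on a drawn line;
    conversely the open polygon is convex and meets no drawn line. *)
Let componentE : connected_component cut_hull g = poly_int.
Proof.
apply/seteqP; split=> y.
  move=> hy v vv; have [_ _ _ /(_ _ vv)[p [q [b vp vn]]] _] := GP.
  have vnv : v <> nx v by move=> /eqP; rewrite eq_sym (negbTE (next_neq us s1 vv)).
  have [k hk] := orient_coin vnv vp vn.
  have vpq : 0 < orient p q g * orient p q y.
    apply: (@connected_orient _ (connected_component cut_hull g)) => //.
    - exact: component_connected.
    - move=> z /connected_component_sub[_ nz]; apply/eqP => zz; apply: nz.
      by exists [set v | orient p q v = 0] => //; exists p, q.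
    - by apply: connected_component_refl; exact: poly_int_cut.
  move: vpq; rewrite !hk mulrACA -expr2 /side => h.
  have k0 : k != 0 by apply: contraTneq h => ->; rewrite expr0n mul0r ltxx.
  by move: h; rewrite pmulr_rgt0// exprn_even_gt0.
move=> py; apply: segment_component; rewrite segmentE => _ [s [s01 ->]].
by apply: poly_int_cut; exact: poly_int_convex.
Qed.

Let closure_poly_int : closure poly_int = poly.
Proof.
apply/seteqP; split.
  move=> y h; rewrite (iffLR (closure_id _) closed_poly).
  by move: y h; apply: closureS => y /poly_int_sub.
move=> y py B /(near_ray_gt0 (g - y))[t t0 ht].
pose t1 := Num.min t 1.
have t10 : 0 < t1 by rewrite lt_min t0 ltr01.
have t11 : t1 <= 1 by rewrite ge_min lexx orbT.
exists (y + t1 *: (g - y)); split; last by apply: ht; rewrite gtr0_norm// ge_min lexx.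
move=> v vv; rewrite side_line; apply: ltr_wpDl.
  by apply: mulr_ge0; [rewrite subr_ge0|exact: py].
by apply: mulr_gt0 => //; exact: side_g.
Qed.

Lemma good_polygon_face (Ts : set (set (pt R))) : figure Ts = S ->
  (forall l, ts_line Ts l <-> exists p q, bl S p q /\ l = [set v | orient p q v = 0]) ->
  ts_kept_face Ts vs.
Proof.
move=> figT hT; split; last by rewrite figT.
have tsE : ts_line Ts = [set l | exists p q, bl S p q /\ l = [set v | orient p q v = 0]].
  by apply/seteqP; split=> l /hT.
exists poly.
  exists g; rewrite figT tsE; first exact: poly_int_cut poly_int_g.
  by have := componentE; rewrite /cut_hull => ->; rewrite closure_poly_int.
split; first exact: us.
- move=> v; split; first exact: vs_extreme.
  move=> [pv ev]; have [v0 [u [v0v uv tv]]] := poly_fan pv.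
  have : extreme (triangle v0 u (nx u)) v.
    split=> // p q s tp tq; apply: ev.
      by move: p tp {tq tv}; apply: hull_min => //; move=> p [[->|->]|->]; apply: vs_poly => //; exact: nx_in.
    by move: q tq {tp tv}; apply: hull_min => //; move=> q [[->|->]|->]; apply: vs_poly => //; exact: nx_in.
  by move=> /extreme_triangle[->|->|->] //; exact: nx_in.
- move=> v vv y; rewrite segmentE => -[s [s01 yE]].
  have py : poly y by rewrite yE; apply: poly_convex => //; apply: vs_poly => //; exact: nx_in.
  have y0 : side v y = 0 by rewrite yE side_line side0 side1 !mulr0 addr0.
  split; first exact: subset_closure.
  move=> /(near_ray_gt0 (g - y))[t t0 ht].
  have := ht (- t); rewrite normrN gtr0_norm// lexx => /(_ isT) /(_ _ vv).
  rewrite side_line y0 mulr0 add0r mulNr oppr_ge0 leNgt.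
  by rewrite mulr_gt0// side_g.
Qed.

End GoodPolygonFace.

(** * A kept face is a good polygon *)

Section SceneFaces.
Context {R : realType} {I : finType} (c : I -> 'I_3 -> pt R).
Hypothesis cpos : forall i, pos3 (c i).
Implicit Types (p q u v w x y z : pt R) (s t : R) (vs : seq (pt R)).
Local Notation form := (form c).
Local Notation fig := (fig c).

Let closed_scaled_orient (k : R) p q : closed [set y : pt R | 0 <= k * orient p q y].
Proof.
apply: (@preimage_closed _ _ (fun y => k * orient p q y) [set z | 0 <= z]); last exact: closed_ge.
move=> y _; apply: (@cvgM R _ _ (nbhs_filter y)); first exact: cvg_cst.
exact: continuous_orient.
Qed.

Definition box (M : R) : set (pt R) := [set y | forall i, `|y i 0| <= M].

Let box_convex M x y s : box M x -> box M y -> 0 <= s <= 1 -> box M (x + s *: (y - x)).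
Proof.
move=> bx by' /andP[s0 s1] i; rewrite !mxE.
rewrite (_ : _ + _ = (1 - s) * x i 0 + s * y i 0); last by ring.
apply: le_trans (ler_normD _ _) _; rewrite !normrM (ger0_norm s0) ger0_norm ?subr_ge0//.
have := by' i; have := bx i; move: `|x i 0| `|y i 0| => b a hb ha.
have h1 : (1 - s) * b <= (1 - s) * M by rewrite ler_wpM2l// subr_ge0.
have h2 : s * a <= s * M by rewrite ler_wpM2l.
by rewrite (le_trans (lerD h1 h2))// -mulrDl subrK mul1r.
Qed.

Let closed_box M : closed (box M).
Proof.
have -> : box M = \bigcap_(i in [set: 'I_2]) ([set y | y i 0 <= M] `&` [set y | - M <= y i 0]).
  apply/seteqP; split=> y h i; first by move=> _; have := h i; rewrite ler_norml => /andP[].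
  by have [h1 h2] := h i Logic.I; rewrite ler_norml; apply/andP.
apply: closed_bigI => i _; apply: closedI.
  apply: (@preimage_closed _ _ (fun y : pt R => y i 0) [set z | z <= M]); last exact: closed_le.
  by move=> y _; exact: coord_continuous.
apply: (@preimage_closed _ _ (fun y : pt R => y i 0) [set z | - M <= z]); last exact: closed_ge.
by move=> y _; exact: coord_continuous.
Qed.

Let hull_fig_box : exists M, hull fig `<=` box M.
Proof.
exists (\sum_i \sum_k \sum_j `|c i k j 0|); apply: hull_min; first exact: box_convex.
rewrite figE// => x [i _]; move: x; apply: hull_min; first exact: box_convex.
have h k : box (\sum_i \sum_k \sum_j `|c i k j 0|) (c i k).
  move=> j; rewrite (bigD1 i)//= (bigD1 k)//= (bigD1 j)//= -!addrA lerDl.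
  by rewrite !addr_ge0// !sumr_ge0// => *; rewrite !sumr_ge0// => *; rewrite sumr_ge0.
by move=> x [[->|->]|->].
Qed.

(** There are infinitely many boundary segments, but their lines are among the finitely many lines
    of edges, so one neighbourhood serves all of them. *)
Let near_bl_sign x : \forall y \near x, forall p q, bl fig p q ->
  0 < orient p q x * orient p q x -> 0 < orient p q x * orient p q y.
Proof.
apply: filterS (near_form_sign c x) => y hy p q b _x.
have [e [w [be same]]] := bl_bpoint cpos b.
have [k hk] := orient_coin b.1 (iffLR (same p) (orientl _ _)) (iffLR (same q) (orientr _ _)).
have k0 : k != 0.
  by apply/eqP => k0; have := form_apex cpos e; rewrite formE hk k0 mul0r ltxx.
have k2 : 0 < k * k by rewrite -expr2 exprn_even_gt0.
have [h1 h2] := hy e; rewrite !formE !hk in h1 h2.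
rewrite -(pmulr_rgt0 _ k2) mulrACA.
have [kx|kx|kx] := ltgtP (k * orient p q x) 0.
- by rewrite nmulr_rgt0// h2.
- by rewrite pmulr_rgt0// h1.
- move/eqP: kx; rewrite mulf_eq0 (negbTE k0) /= => /eqP ox.
  by move: _x; rewrite ox mul0r ltxx.
Qed.

(** The component of [x] is compared with the open cell of [x] in the arrangement of boundary lines.
    By separation from the centroid this cell lies in the figure, hence in the component; so [F] has
    interior points and its boundary is on boundary lines. *)
Lemma kept_face_good (Ts : set (set (pt R))) vs :
  figure Ts = fig -> (forall i, Ts (tri (c i))) ->
  ts_kept_face Ts vs -> good_polygon fig vs.
Proof.
move=> figT hT [[F [x]]]; rewrite figT.
have -> : ts_line Ts = [set l | exists p q, bl fig p q /\ l = [set v | orient p q v = 0]].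
  by apply/seteqP; split=> l /(ts_lineP cpos _ figT hT).
rewrite -/(cut_hull fig) => Dx FE [us ev sb] Sg.
set D := cut_hull fig in Dx FE; set C := connected_component D x in FE.
set g := centroid vs in Sg.
have nz y p q : D y -> bl fig p q -> orient p q y != 0.
  move=> [_ h] b; apply/eqP => e; apply: h.
  by exists [set v | orient p q v = 0] => //; exists p, q.
have CD : C `<=` D by exact: connected_component_sub.
have Cx : C x by exact: connected_component_refl.
have Cs y p q : C y -> bl fig p q -> 0 < orient p q x * orient p q y.
  move=> Cy b; apply: (@connected_orient _ C) => //; first exact: component_connected.
  by move=> z /CD Dz; exact: nz.
have Fs y p q : F y -> bl fig p q -> 0 <= orient p q x * orient p q y.
  move=> Fy b; have := closed_scaled_orient (k := orient p q x) (p := p) (q := q).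
  move=> /closure_id cl.
  suff : closure [set y : pt R | 0 <= orient p q x * orient p q y] y by rewrite -cl.
  move: Fy; rewrite FE; apply: closureS => z Cz; exact/ltW/Cs.
have [M hM] := hull_fig_box.
have FM : F `<=` box M.
  rewrite FE (iffLR (closure_id _) (closed_box (M := M))); apply: closureS => y /CD[hy _].
  exact: hM.
have cF : compact F.
  apply: (@compact_box _ F M); first by rewrite FE; exact: closed_closure.
  by move=> y /FM h; split; exact: h.
have FC : C `<=` F by rewrite FE; exact: subset_closure.
have Fx : F x by exact: FC.
(* As [F] is compact, every line form attains its maximum on [F] at a listed vertex. This is the
   only way in which the list is used as the complete list of extreme points. *)
have Lex p q : p <> q -> exists2 v, v \in vs & forall y, F y -> orient p q y <= orient p q v.
  move=> pq; have [v ve vm] := extreme_max pq cF (ex_intro _ x Fx).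
  by exists v => //; apply/ev.
have inF v : v \in vs -> F v by move=> /ev[].
have [i0 _] := Sg.
have ab := pos3_neq (k := 0) (cpos i0).
have s0 : (0 < size vs)%N by have [v + _] := Lex _ _ ab; case: (vs).
have xg p q : bl fig p q -> 0 < orient p q x * orient p q g.
  move=> b; have x0 := nz _ _ _ Dx b.
  apply: orient_centroid_ge0 => //; first by move=> v /inF Fv; exact: Fs.
  apply: contrapT => n; have z v : v \in vs -> orient p q v = 0.
    by move=> vv; apply/eqP; apply: contrapT => /negP h; apply: n; exists v.
  move: x0; rewrite neq_lt => /orP[] h.
    have [v vv /(_ x Fx)] := Lex q p (fun e => b.1 (esym e)).
    by rewrite !(orientC p q) (z _ vv) oppr0 leNgt oppr_gt0 h.
  by have [v vv /(_ x Fx)] := Lex p q b.1; rewrite (z _ vv) leNgt h.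
(* The cell is defined without reference to the hull, which makes it open; that it lies in the hull
   follows from [cellS]. *)
pose cell : set (pt R) := [set y | forall p q, bl fig p q -> 0 < orient p q x * orient p q y].
have cellS y : cell y -> fig y.
  move=> cy; apply: contrapT => /(separation_bl cpos Sg)[p [q [b]]].
  have := mulr_gt0 (xg _ _ b) (cy _ _ b); rewrite mulrACA -expr2 => h.
  rewrite leNgt -(@pmulr_rgt0 _ (orient p q x ^+ 2)) ?h//.
  by rewrite exprn_even_gt0//= nz.
have cellD y : cell y -> D y.
  move=> cy; split; first by apply: sub_hull; exact: cellS.
  by move=> [_ [p [q [b ->]]] /= e]; have := cy _ _ b; rewrite e mulr0 ltxx.
have cellx : cell x by move=> p q b; rewrite -expr2 exprn_even_gt0//= nz.
have cellC y : cell y -> C y.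
  move=> cy; apply: segment_component; rewrite segmentE => _ [s [/andP[sg s1] ->]].
  apply: cellD => p q b; rewrite orient_line mulrDr !(mulrCA (orient p q x)).
  have hx := cellx _ _ b; have hy := cy _ _ b.
  move: s1; rewrite le_eqVlt => /orP[/eqP ->|s1].
    by rewrite subrr mul0r add0r mul1r.
  apply: ltr_wpDr; first by apply: mulr_ge0 => //; exact: ltW.
  by apply: mulr_gt0 => //; rewrite subr_gt0.
have cell_near y : cell y -> nbhs y cell.
  move=> cy; apply: filterS (near_bl_sign y) => z hz p q b.
  have hy := cy _ _ b; have y0 : orient p q y != 0.
    by apply: contraTneq hy => ->; rewrite mulr0 ltxx.
  have y2 : 0 < orient p q y ^+ 2 by rewrite exprn_even_gt0.
  have := hz _ _ b; rewrite -expr2 => /(_ y2) h.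
  rewrite -(pmulr_lgt0 _ y2) (_ : orient p q x * orient p q z * orient p q y ^+ 2 = (orient p q x * orient p q y) *
    (orient p q y * orient p q z)); last by ring.
  exact: mulr_gt0.
have bF y : boundary F y -> exists p q, bl fig p q /\ orient p q y = 0.
  move=> [cy iy]; apply: contrapT => n; apply: iy.
  have Fy : F y by move: cy; rewrite FE -(iffLR (closure_id _) (@closed_closure _ C)).
  have cly : cell y.
    move=> p q b; rewrite lt_def Fs// andbT mulf_neq0//; first exact: nz.
    by apply/eqP => e; apply: n; exists p, q.
  by rewrite /interior /=; apply: filterS (cell_near _ cly) => z /cellC/FC.
(* If all vertices were on one line, so would be [F] by [Lex], although it contains a neighbourhood
   of [x]. This also forces at least three vertices. *)
have noline p q : p <> q -> exists2 v, v \in vs & orient p q v != 0.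
  move=> pq; apply: contrapT => n; have z v : v \in vs -> orient p q v = 0.
    by move=> vv; apply/eqP; apply: contrapT => /negP h; apply: n; exists v.
  have zF y : F y -> orient p q y = 0.
    move=> Fy; apply/eqP; rewrite eq_le; apply/andP; split.
      by have [v vv /(_ _ Fy)] := Lex p q pq; rewrite (z _ vv).
    have [v vv /(_ _ Fy)] := Lex q p (fun e => pq (esym e)).
    by rewrite !(orientC p q) (z _ vv) oppr0 oppr_le0.
  pose n' : pt R := \col_i (if i == 0 then - (q 1 0 - p 1 0) else q 0 0 - p 0 0).
  have [t t0 /(_ t)] := near_ray_gt0 n' (cell_near _ cellx).
  rewrite gtr0_norm// lexx => /(_ isT)/cellC/FC/zF; rewrite orient_add zF// add0r !mxE /=.
  apply/eqP; rewrite mulrN opprK -!expr2 mulf_neq0 ?gt_eqF//.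
  exact: sqr_dist_gt0.
have s2 : (2 < size vs)%N.
  case: (vs) us noline => [|v [|w [|w' l]]]//=.
  - by move=> _ /(_ _ _ ab)[].
  - move=> _ nl; have [q vq] : exists q, v <> q.
      have [e|e] := pselect (v = c i0 0); last by exists (c i0 0).
      by exists (c i0 (0 + 1)); rewrite e.
    by have [u] := nl _ _ vq; rewrite inE => /eqP ->; rewrite orientl eqxx.
  - rewrite inE andbT => /eqP vw /(_ _ _ vw)[u].
    by rewrite !inE => /orP[]/eqP ->; rewrite ?orientl ?orientr eqxx.
have s1 : (1 < size vs)%N by exact: ltn_trans s2.
have sides v : v \in vs -> exists p q, [/\ bl fig p q, orient p q v = 0 & orient p q (next vs v) = 0].
  move=> vv; have vn : v <> next vs v.
    by move=> /eqP; rewrite eq_sym (negbTE (next_neq us s1 vv)).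
  have bQ y : segment v (next vs v) y -> exists e, form e y = 0 /\ exists w, bpoint c e w.
    move=> /(sb _ vv)/bF[p [q [b e0]]]; have [e [w [be same]]] := bl_bpoint cpos b.
    by exists e; split; [apply/same|exists w].
  have [e [y [z [yz sy sz [ey [w be]] [ez _]]]]] := segment_pigeon vn bQ.
  have [e1 e2] := segment_zero yz sy sz ey ez.
  have [p [q [b same]]] := bpoint_bl cpos be.
  by exists p, q; split=> //; apply/same.
split=> //; last first.
  split=> // p q b; have x0 := nz _ _ _ Dx b.
  move: x0; rewrite neq_lt => /orP[] h; [right|left] => v /inF/Fs/(_ b).
    by rewrite nmulr_rge0.
  by rewrite pmulr_rge0.
move=> v vv; have [p [q [b vp np]]] := sides _ vv.
have vn : v <> next vs v.
  by move=> /eqP; rewrite eq_sym (negbTE (next_neq us s1 vv)).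
have nv : next vs v \in vs by rewrite mem_next.
have [k hk] := orient_coin vn vp np.
exists (orient p q x * k) => u uu /eqP uv /eqP un.
have h : 0 <= orient p q x * k * orient v (next vs v) u.
  by rewrite -mulrA -hk; apply: Fs => //; exact: inF.
rewrite lt_def h andbT mulf_neq0//.
  have := nz _ _ _ Dx b => x0; rewrite mulf_neq0//.
  by apply: contra_neq x0 => k0; rewrite hk k0 mul0r.
(* Strictness comes from extremality: of three distinct collinear points one is strictly between the
   others, and the cases [s < 0], [0 < s < 1] and [1 < s] tell which. *)
apply/eqP => o; have [s uE] := orient0_line vn o.
have [_ ev1] := iffLR (ev _) vv; have [_ ev2] := iffLR (ev _) nv.
have [_ ev3] := iffLR (ev _) uu.
have [sn|sp|sz] := ltgtP s 0; last by apply: uv; rewrite uE sz scale0r addr0.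
  apply: un; apply/esym; apply: (ev1 _ _ (1 - s)^-1) => //; try exact: inF.
    have h1 : 1 < 1 - s by lra.
    by rewrite invr_gt0 invf_lt1// (lt_trans ltr01).
  rewrite uE; have d : 1 - s != 0 by rewrite gt_eqF//; lra.
  by apply: pt_eqP; rewrite !mxE; field.
have [s1'|s1'|s1'] := ltgtP s 1; last by apply: un; rewrite uE s1' scale1r addrC subrK.
  apply: vn; apply: (ev3 _ _ s); [exact: inF|exact: inF|by rewrite sp|].
  by rewrite uE; apply: pt_eqP; rewrite !mxE; ring.
apply: uv; apply/esym; apply: (ev2 _ _ s^-1); [exact: inF|exact: inF| |].
  by rewrite invr_gt0 sp invf_lt1.
rewrite uE; have d : s != 0 by rewrite gt_eqF.
by apply: pt_eqP; rewrite !mxE; field.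
Qed.

Lemma kept_faceP (Ts : set (set (pt R))) vs :
  figure Ts = fig -> (forall i, Ts (tri (c i))) ->
  ts_kept_face Ts vs <-> good_polygon fig vs.
Proof.
move=> figT hT; split; first exact: kept_face_good.
move=> gp; apply: (good_polygon_face gp) => //; first exact: separation_bl.
by move=> l; exact: ts_lineP.
Qed.

End SceneFaces.

(** * Affine invariance of the spatial triangulation *)

Section AffineInvariance.
Context {R : realType}.
Implicit Types (a : pt R -> pt R) (S : set (pt R)) (Ts : set (set (pt R))) (vs : seq (pt R)).

Lemma affinity_continuous a : affinity a -> continuous a.
Proof.
move=> [M [b [_ aE]]] x.
have -> : a = (fun v : pt R => v 0 0 *: (col 0 M) + v 1 0 *: (col 1 M) + b).
  by apply/funext => v; rewrite aE; apply: pt_eqP; rewrite !addmx00 mulmx2E !mxE; ring.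
apply: (@cvgD _ _ _ _ (nbhs_filter x)); last exact: cvg_cst.
by apply: (@cvgD _ _ _ _ (nbhs_filter x)); apply: (@cvgZr_tmp _ _ _ _ (nbhs_filter x));
  exact: coord_continuous.
Qed.

Lemma boundary_affinity a S x : affinity a -> boundary S x -> boundary (a @` S) (a x).
Proof.
move=> ha [cx ix]; split.
  move=> B hB; have [y [Sy By]] := cx _ (affinity_continuous ha hB).
  by exists (a y); split=> //; exists y.
move=> h; apply: ix; rewrite /interior /=.
have : nbhs x (a @^-1` (a @` S)) by exact: (affinity_continuous ha h).
by apply: filterS => y [z Sz /(affinity_inj ha) <-].
Qed.

Lemma bl_affinity a S p q : affinity a -> bl S p q -> bl (a @` S) (a p) (a q).
Proof.
move=> ha [pq sb]; split; first by move/(affinity_inj ha).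
rewrite -affinity_segment// => _ [x /sb hx <-]; exact: boundary_affinity.
Qed.

Lemma centroid_affinity a vs : affinity a -> (0 < size vs)%N ->
  centroid (map a vs) = a (centroid vs).
Proof.
move=> [M [b [_ aE]]] s0; rewrite /centroid size_map aE.
have n0 : (size vs)%:R != 0 :> R by rewrite pnatr_eq0 -lt0n.
apply: (scalerI n0); rewrite scalerDr -scalemxAr !scalerA divff// !scale1r.
elim: vs {s0 n0} => [|v vs IH] /=; first by rewrite !big_nil mulmx0 scale0r addr0.
rewrite !big_cons IH aE mulmxDr -natr1 scalerDl scale1r.
by rewrite -!addrA; congr (_ + _); rewrite addrC -!addrA; congr (_ + _); rewrite addrC.
Qed.

Lemma good_polygon_affinity a S vs : affinity a -> good_polygon S vs ->
  good_polygon (a @` S) (map a vs).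
Proof.
move=> ha [us s2 hk hs [hw Sg]]; have ai := affinity_inj ha.
have [k0 k0n ok0] := affinity_orient ha.
have s0 : (0 < size vs)%N by apply: leq_trans s2.
have nxE v : v \in vs -> next (map a vs) (a v) = a (next vs v).
  by move=> vv; apply: next_map_inj => //; exact: in2W.
split.
- by rewrite map_inj_uniq.
- by rewrite size_map.
- move=> _ /mapP[v vv ->]; have [k hv] := hk _ vv.
  (* Dividing by [k0], the factor by which the affinity scales orientation, covers
     orientation-reversing affinities as well. *)
  exists (k / k0) => _ /mapP[u uu ->]; rewrite nxE// => uv un.
  rewrite ok0 -mulrA mulKf//; apply: hv => //.
    by apply: contra_neq uv => ->.
  by apply: contra_neq un => ->.
- move=> _ /mapP[v vv ->]; have [p [q [b vp np]]] := hs _ vv.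
  exists (a p), (a q); rewrite nxE// !ok0 vp np mulr0; split=> //.
  exact: bl_affinity.
- split; last by rewrite centroid_affinity//; exists (centroid vs).
  move=> p q b; have [a' [ha' k k']] := affinity_inv ha.
  have b' : bl S (a' p) (a' q).
    have := bl_affinity ha' b; rewrite image_comp.
    by rewrite (_ : _ @` S = S)//; apply/seteqP; split=> [_ [x Sx /= <-]|x Sx];
      [rewrite k|exists x; rewrite //= k].
  have E v : orient p q (a v) = k0 * orient (a' p) (a' q) v by rewrite -ok0 !k'.
  have [kp|kn] : 0 < k0 \/ k0 < 0 by move: k0n; rewrite neq_lt => /orP[]; auto.
    case: (hw _ _ b') => h; [left|right] => _ /mapP[v vv ->]; rewrite E.
      by rewrite pmulr_rge0// h.
    by rewrite pmulr_rle0// h.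
  case: (hw _ _ b') => h; [right|left] => _ /mapP[v vv ->]; rewrite E.
    by rewrite nmulr_rle0// h.
  by rewrite nmulr_rge0// h.
Qed.

Lemma TS_affinity a Ts Ts' : affinity a -> a @` figure Ts = figure Ts' ->
  (forall vs, ts_kept_face Ts vs <-> good_polygon (figure Ts) vs) ->
  (forall vs, ts_kept_face Ts' vs <-> good_polygon (figure Ts') vs) ->
  [set a @` T | T in TS Ts] = TS Ts'.
Proof.
move=> ha aT hT hT'; have [a' [ha' k k']] := affinity_inv ha.
have key b Us Us' : affinity b -> b @` figure Us = figure Us' ->
  (forall vs, ts_kept_face Us vs <-> good_polygon (figure Us) vs) ->
  (forall vs, ts_kept_face Us' vs <-> good_polygon (figure Us') vs) ->
  forall T, TS Us T -> TS Us' (b @` T).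
  move=> hb bU hU hU' T [vs [v [kv vv ->]]].
  have gp := iffLR (hU vs) kv; have [us s2 _ _ _] := gp.
  have bi := affinity_inj hb.
  exists (map b vs), (b v); split; last 1 first.
  - rewrite affinity_triangle// centroid_affinity ?(leq_trans _ s2)//.
    by rewrite next_map_inj//; exact: in2W.
  - by apply/hU'; rewrite -bU; exact: good_polygon_affinity.
  - exact: map_f.
have aK (A : set (pt R)) : a @` (a' @` A) = A.
  rewrite image_comp; apply/seteqP; split=> [_ [x Ax /= <-]|x Ax].
    by rewrite k'.
  by exists x; rewrite //= k'.
have a'K (A : set (pt R)) : a' @` (a @` A) = A.
  rewrite image_comp; apply/seteqP; split=> [_ [x Ax /= <-]|x Ax].
    by rewrite k.
  by exists x; rewrite //= k.
apply/seteqP; split=> [_ [T hT1 <-]|T hT1]; first exact: key hT1.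
exists (a' @` T); last exact: aK.
by apply: (key a' Ts') => //; rewrite -aT a'K.
Qed.

End AffineInvariance.

(** * Persistence under a change of position *)

Section Decomposition.
Context {R : realType} {I : finType} (c : I -> 'I_3 -> pt R).
Hypothesis cpos : forall i, pos3 (c i).
Implicit Types (d p q u v w x y z : pt R) (s t : R) (e : I * 'I_3).
Local Notation form := (form c).
Local Notation fig := (fig c).
Local Notation ecrs := (ecrs c).
Local Notation vtx := (vtx c).

(* y lies in the closed cell of x. *)
Definition conf x y : Prop := forall e,
  [/\ 0 < form e x -> 0 <= form e y, form e x < 0 -> form e y <= 0
    & form e x = 0 -> form e y = 0].

(* x is in the relative interior of the hull of finitely many vertices of
   the arrangement, all in the closed cell of x. *)
Definition decomp x : Prop := exists W : seq ((I * 'I_3) * (I * 'I_3)),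
  [/\ (0 < size W)%N,
      forall w : (I * 'I_3) * (I * 'I_3), w \in W -> ecrs w.1 w.2 != 0 /\ conf x (vtx w.1 w.2)
    & forall e, form e x != 0 -> exists2 w : (I * 'I_3) * (I * 'I_3), w \in W & form e (vtx w.1 w.2) != 0].

Lemma conf_trans y x z : conf x y -> conf y z -> conf x z.
Proof.
move=> xy yz e; have [h1 h2 h3] := xy e; have [k1 k2 k3] := yz e; split=> h.
- by have := h1 h; rewrite le_eqVlt eq_sym => /orP[/eqP/k3 ->//|/k1].
- by have := h2 h; rewrite le_eqVlt => /orP[/eqP/k3 ->//|/k2].
- exact/k3/h3.
Qed.

Lemma decomp_join x y z : conf x y -> conf x z ->
  (forall e, form e x != 0 -> form e y != 0 \/ form e z != 0) ->
  decomp y -> decomp z -> decomp x.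
Proof.
move=> xy xz h [W [W0 hW nW]] [W' [W0' hW' nW']]; exists (W ++ W'); split.
- by rewrite size_cat addn_gt0 W0.
- move=> w; rewrite mem_cat => /orP[/hW|/hW'] [w0 cw]; split=> //.
    exact: conf_trans cw.
  exact: conf_trans cw.
- move=> e /h[/nW|/nW'] [w wW hw]; exists w => //; rewrite mem_cat wW ?orbT//.
Qed.

Lemma decomp_vertex e e' : ecrs e e' != 0 -> decomp (vtx e e').
Proof.
move=> h; exists [:: (e, e')]; split=> // [w|e2 he2].
  by rewrite inE => /eqP -> /=; split=> // e2; split=> // /ltW.
by exists (e, e'); rewrite ?mem_head.
Qed.

(** The linear part of [form e], evaluated in the direction [d]. *)
Definition lin e d : R :=
  (c e.1 (e.2 + 1) 0 0 - c e.1 e.2 0 0) * d 1 0 - (c e.1 (e.2 + 1) 1 0 - c e.1 e.2 1 0) * d 0 0.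

Lemma form_add e x d s : form e (x + s *: d) = form e x + s * lin e d.
Proof. exact: orient_add. Qed.

(** The three edge vectors of a triangle add up to 0, and so do the three values of [lin]. If none
    were negative all would be 0, although two edge vectors are independent. Hence every ray from a
    point of a triangle leaves it, which makes [walk] stop. *)
Lemma lin_neg i d : d != 0 -> exists k, lin (i, k) d < 0.
Proof.
move=> d0; apply: contrapT => n; have h k : 0 <= lin (i, k) d.
  by rewrite leNgt; apply/negP => h; apply: n; exists k.
have [e1 e2 e3 e4 [e5 e6]] := ord3E.
have l0 := h 0; have l1 := h 1; have l2 := h 2%:R; have o := cpos i.
rewrite /lin /= ?(e1,e2,e3) in l0 l1 l2; rewrite /pos3 /orient in o.
move/eqP: d0; apply; apply: pt_eqP; rewrite !mxE.
  set A := (X in X * _ - _) in l0; set A' := (X in _ - X * _) in l0.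
  set B := (X in X * _ - _) in l1; set B' := (X in _ - X * _) in l1.
  set D := (X in 0 < X) in o.
  have DE : D = A * B' - A' * B by rewrite /D /A /A' /B /B'; ring.
  have z0 : A * d 1 0 - A' * d 0 0 = 0 by rewrite /A /A' /B /B' in l0 l1 l2 *; lra.
  have z1 : B * d 1 0 - B' * d 0 0 = 0 by rewrite /A /A' /B /B' in l0 l1 l2 *; lra.
  apply: (mulfI (lt0r_neq0 o)); rewrite mulr0.
  transitivity (B * (A * d 1 0 - A' * d 0 0) - A * (B * d 1 0 - B' * d 0 0)).
    by rewrite DE; ring.
  by rewrite z0 z1; ring.
set A := (X in X * _ - _) in l0; set A' := (X in _ - X * _) in l0.
set B := (X in X * _ - _) in l1; set B' := (X in _ - X * _) in l1.
set D := (X in 0 < X) in o.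
have DE : D = A * B' - A' * B by rewrite /D /A /A' /B /B'; ring.
have z0 : A * d 1 0 - A' * d 0 0 = 0 by rewrite /A /A' /B /B' in l0 l1 l2 *; lra.
have z1 : B * d 1 0 - B' * d 0 0 = 0 by rewrite /A /A' /B /B' in l0 l1 l2 *; lra.
apply: (mulfI (lt0r_neq0 o)); rewrite mulr0.
transitivity (B' * (A * d 1 0 - A' * d 0 0) - A' * (B * d 1 0 - B' * d 0 0)).
  by rewrite DE; ring.
by rewrite z0 z1; ring.
Qed.

(* Walk from x in direction d until the first line transversal to d. *)
Lemma walk i x d : (forall k, 0 <= form (i, k) x) -> d != 0 ->
  (forall e, form e x = 0 -> lin e d = 0) ->
  exists s e, [/\ 0 < s, conf x (x + s *: d), form e (x + s *: d) = 0 & lin e d != 0].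
Proof.
move=> hi d0 hx; have [k lk] := lin_neg i d0.
(* [P e] says that the ray approaches the line of [e] from off it; it then hits this line at the
   time [S e] defined below. *)
pose P e := form e x * lin e d < 0.
have P0 : P (i, k).
  rewrite /P nmulr_llt0// lt_def hi andbT; apply/eqP => h.
  by move: lk; rewrite hx ?ltxx.
pose S e := - form e x / lin e d.
case: (@Order.TotalTheory.arg_minP _ R _ (i, k) P S P0) => e Pe mine.
have lin0 e' : P e' -> lin e' d != 0 by rewrite /P; apply: contraTneq => ->; rewrite mulr0 ltxx.
have Sp e' : P e' -> 0 < S e'.
  move=> h; have l0 := lin0 _ h.
  have l2 : 0 < lin e' d ^+ 2 by rewrite exprn_even_gt0.
  by rewrite -(pmulr_lgt0 _ l2) /S expr2 mulrA divfK// mulNr oppr_gt0.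
have Sz e' : P e' -> form e' x + S e' * lin e' d = 0.
  by move=> h; rewrite /S divfK ?subrr// lin0.
exists (S e), e; split; [exact: Sp| |by rewrite form_add Sz|exact: lin0].
have Se := ltW (Sp _ Pe).
move=> e'; rewrite form_add; split=> h.
- have [l0|l0] := ltP (lin e' d) 0; last first.
    by apply: addr_ge0; [exact: ltW|exact: mulr_ge0].
  have Pe' : P e' by rewrite /P pmulr_rlt0.
  rewrite -(Sz _ Pe') lerD2l; apply: ler_wnM2r; [exact: ltW|exact: mine].
- have [l0|l0] := ltP 0 (lin e' d); last first.
    rewrite -oppr_ge0 opprD -mulrN; apply: addr_ge0; first by rewrite oppr_ge0 ltW.
    by apply: mulr_ge0 => //; rewrite oppr_ge0.
  have Pe' : P e' by rewrite /P nmulr_rlt0.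
  rewrite -(Sz _ Pe') lerD2l; apply: ler_wpM2r; [exact: ltW|exact: mine].
- by rewrite h hx// mulr0 addr0.
Qed.

Let sub_fig i x y : (forall k, 0 <= form (i, k) x) -> conf x y ->
  forall k, 0 <= form (i, k) y.
Proof.
move=> h xy k; have [h1 _ h3] := xy (i, k).
by have := h k; rewrite le_eqVlt eq_sym => /orP[/eqP/h3 ->|/h1].
Qed.

(** As [x] is strictly between the stopping points of the two opposite walks, a form that is nonzero
    at [x] cannot vanish at both. *)
Lemma walk_both i x d : (forall k, 0 <= form (i, k) x) -> d != 0 ->
  (forall e, form e x = 0 -> lin e d = 0) ->
  (forall y e s, conf x y -> form e y = 0 -> lin e d != 0 -> y = x + s *: d -> decomp y) ->
  decomp x.
Proof.
move=> hi d0 hx hD; have [s [e [s0 cy ey le]]] := walk hi d0 hx.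
have d0' : - d != 0 by rewrite oppr_eq0.
have linN e' : lin e' (- d) = - lin e' d by rewrite /lin !mxE; ring.
have hx' e' : form e' x = 0 -> lin e' (- d) = 0.
  by move=> /hx; rewrite linN => ->; rewrite oppr0.
have [s' [e' [s0' cy' ey' le']]] := walk hi d0' hx'.
apply: (decomp_join cy cy') => [e2 ne2||].
- have [z|] := eqVneq (form e2 (x + s *: d)) 0; last by left.
  right; apply: contra_neq ne2 => z'.
  move: z z'; rewrite !form_add linN => z z'.
  have ss : s + s' != 0 by rewrite gt_eqF// addr_gt0.
  apply: (mulfI ss); rewrite mulr0.
  transitivity (s' * (form e2 x + s * lin e2 d) + s * (form e2 x + s' * - lin e2 d)).
    by ring.
  by rewrite z z' !mulr0 addr0.
- exact: hD cy ey le erefl.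
- apply: (hD _ e' (- s') cy' ey') => //; first by rewrite linN oppr_eq0 in le'.
  by rewrite scaleNr scalerN.
Qed.

Lemma lin_end e e' : lin e' (c e.1 (e.2 + 1) - c e.1 e.2) = - ecrs e e'.
Proof. by rewrite /lin /ecrs /crs !mxE; ring. Qed.

Lemma end_dir e : c e.1 (e.2 + 1) - c e.1 e.2 != 0.
Proof. by rewrite subr_eq0; apply/eqP => h; exact: (end_neq cpos (esym h)). Qed.

(** If [x] is not a vertex, walking along the line of [e] both ways ends where a transversal line
    crosses it, that is at vertices. *)
Lemma decomp_line i e x : (forall k, 0 <= form (i, k) x) -> form e x = 0 -> decomp x.
Proof.
move=> hi ex.
have [[e' [e'x ne]]|n] := pselect (exists e', form e' x = 0 /\ ecrs e e' != 0).
  by rewrite (vtx_uniq ne ex e'x); exact: decomp_vertex.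
have par e' : form e' x = 0 -> ecrs e e' = 0.
  by move=> h; apply/eqP; apply: contrapT => /negP h'; apply: n; exists e'.
apply: (walk_both hi (end_dir e)) => [e' /par|y e' s cy e'y].
  by rewrite lin_end => ->; rewrite oppr0.
rewrite lin_end oppr_eq0 => ne _; have [_ _ /(_ ex) ey] := cy e.
by rewrite (vtx_uniq ne ey e'y); exact: decomp_vertex.
Qed.

(** Descent on the dimension of the cell: from a point on no line, walks in opposite directions end
    on lines, where [decomp_line] applies. The triangle containing [x] contains the stopping points
    too. *)
Lemma fig_decomp x : fig x -> decomp x.
Proof.
move=> [i hi]; have [[e ex]|n] := pselect (exists e, form e x = 0).
  exact: decomp_line hi ex.
apply: (walk_both hi (end_dir (i, 0))) => [e ex|y e s cy ey _ _].
  by case: n; exists e.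
exact: decomp_line (sub_fig hi cy) ey.
Qed.

End Decomposition.

(** * Arrangements of the same combinatorial type *)

Section TwoScenes.
Context {R : realType} {I : finType}.
Implicit Types (c : I -> 'I_3 -> pt R) (d p q u v w x y z : pt R) (s t : R)
  (e : I * 'I_3) (vs : seq (pt R)).

(* The arrangements of lines of the two families of triangles have the same
   combinatorial type. *)
Definition same_type c c' : Prop :=
  [/\ forall e e', (ecrs c e e' != 0) = (ecrs c' e e' != 0),
      forall e e', coin c e e' <-> coin c' e e',
      forall e e' e2, ecrs c e e' != 0 ->
        Num.sg (form c e2 (vtx c e e')) = Num.sg (form c' e2 (vtx c' e e'))
    & forall e e', coin c e e' ->
        Num.sg (form c e' (apex c e)) = Num.sg (form c' e' (apex c' e))].

Lemma same_type_sym c c' : same_type c c' -> same_type c' c.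
Proof.
move=> [h1 h2 h3 h4]; split=> [e e'|e e'|e e' e2|e e'].
- by rewrite h1.
- by split=> /h2.
- by rewrite -h1 => h; rewrite h3.
- by move=> /h2 h; rewrite h4.
Qed.

Lemma sg_gt0 (a b : R) : Num.sg a = Num.sg b -> (0 < a) = (0 < b).
Proof. by move=> h; rewrite -sgr_gt0 h sgr_gt0. Qed.

Lemma sg_lt0 (a b : R) : Num.sg a = Num.sg b -> (a < 0) = (b < 0).
Proof. by move=> h; rewrite -sgr_lt0 h sgr_lt0. Qed.

Lemma sg_ge0 (a b : R) : Num.sg a = Num.sg b -> (0 <= a) = (0 <= b).
Proof. by move=> /sg_lt0; rewrite !ltNge => /negb_inj. Qed.

Lemma sg_eq0 (a b : R) : Num.sg a = Num.sg b -> (a == 0) = (b == 0).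
Proof. by move=> h; rewrite -sgr_eq0 h sgr_eq0. Qed.

Variables (c c' : I -> 'I_3 -> pt R).
Hypotheses (cpos : forall i, pos3 (c i)) (cpos' : forall i, pos3 (c' i)).
Hypothesis sty : same_type c c'.

(** [x'] is the centroid of the corresponding vertices in the second arrangement. At the vertices of
    a decomposition each form has weakly the sign it has at [x], and strictly at one of them if it
    is nonzero at [x]; these signs agree in both arrangements and pass to the centroid. *)
Lemma fig_persist x : fig c x ->
  exists x', forall e, Num.sg (form c e x) = Num.sg (form c' e x').
Proof.
move=> /(fig_decomp cpos)[W [W0 hW nW]]; have [h1 h2 h3 h4] := sty.
pose W' := [seq vtx c' w.1 w.2 | w : (I * 'I_3) * (I * 'I_3) <- W].
have W'0 : (0 < size W')%N by rewrite size_map.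
exists (centroid W') => e.
have key (k : R) : (forall w : (I * 'I_3) * (I * 'I_3), w \in W -> 0 <= k * form c e (vtx c w.1 w.2)) ->
    forall v, v \in W' -> 0 <= k * orient (c' e.1 e.2) (c' e.1 (e.2 + 1)) v.
  move=> h v /mapP[w wW ->]; rewrite -formE.
  have := h _ wW; have [w0 _] := hW _ wW; have := h3 _ _ e w0.
  by move=> /(congr1 ( *%R (Num.sg k))); rewrite -!sgrM => /sg_ge0 ->.
have nz : form c e x != 0 -> exists2 v, v \in W' & orient (c' e.1 e.2) (c' e.1 (e.2 + 1)) v != 0.
  move=> /nW[w wW hw]; exists (vtx c' w.1 w.2).
    by apply/mapP; exists w.
  by have [w0 _] := hW _ wW; rewrite -formE -(sg_eq0 (h3 _ _ e w0)).
have [hx|hx|hx] := ltgtP (form c e x) 0.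
- have : 0 < (-1) * orient (c' e.1 e.2) (c' e.1 (e.2 + 1)) (centroid W').
    apply: orient_centroid_ge0; rewrite ?oppr_eq0 ?oner_eq0//.
      apply: key => w wW; have [_ cw] := hW _ wW; have [_ h _] := cw e.
      by rewrite mulN1r oppr_ge0 h.
    by apply: nz; rewrite lt_eqF.
  by rewrite mulN1r oppr_gt0 => h; rewrite !ltr0_sg.
- have : 0 < 1 * orient (c' e.1 e.2) (c' e.1 (e.2 + 1)) (centroid W').
    apply: orient_centroid_ge0; rewrite ?oner_eq0//.
      apply: key => w wW; have [_ cw] := hW _ wW; have [h _ _] := cw e.
      by rewrite mul1r h.
    by apply: nz; rewrite gt_eqF.
  by rewrite mul1r => h; rewrite !gtr0_sg.
- have W'n : (size W')%:R != 0 :> R by rewrite pnatr_eq0 -lt0n.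
  rewrite hx; congr Num.sg; apply/esym/(mulfI W'n); rewrite mulr0 formE orient_centroid//.
  rewrite big_seq big1// => v /mapP[w wW ->].
  have [w0 cw] := hW _ wW; have [_ _ h] := cw e.
  by apply/eqP; rewrite -formE -(sg_eq0 (h3 _ _ e w0)) h.
Qed.

Lemma fig_sign x x' : (forall e, Num.sg (form c e x) = Num.sg (form c' e x')) ->
  fig c x -> fig c' x'.
Proof. by move=> h [i hi]; exists i => k; rewrite -(sg_ge0 (h _)). Qed.

Lemma bpoint_persist e x : bpoint c e x -> exists x', bpoint c' e x'.
Proof.
move=> [[ex sx] fx ncov]; have [h1 h2 h3 h4] := sty.
have [x' hx'] := fig_persist fx; exists x'.
have z e' : form c' e' x' = 0 -> form c e' x = 0.
  by move=> /eqP; rewrite -(sg_eq0 (hx' e')) => /eqP.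
have sx' : simple c' e x'.
  split; first by apply/eqP; rewrite -(sg_eq0 (hx' e)) ex.
  by move=> e' /z/sx/h2.
split=> //; first exact: fig_sign fx.
have cv s : cov c' s e x' -> cov c s e x.
  move=> [i hi]; exists i => k; have [h|[h hs]] := hi k.
    by left; rewrite (sg_gt0 (hx' _)).
  right; have h0 := z _ h; split=> //.
  have := h4 _ _ (sx _ h0) => /(congr1 ( *%R (Num.sg s))); rewrite -!sgrM.
  by move=> /sg_gt0 ->.
by move=> [/cv a /cv b]; exact: ncov.
Qed.

End TwoScenes.

(** * Persistence of good polygons *)

Section PolygonPersistence.
Context {R : realType} {I : finType}.
Variables (c c' : I -> 'I_3 -> pt R).
Hypotheses (cpos : forall i, pos3 (c i)) (cpos' : forall i, pos3 (c' i)).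
Hypothesis sty : same_type c c'.
Implicit Types (d p q u v w x y z : pt R) (s t : R) (e : I * 'I_3) (vs : seq (pt R)).

Definition active (d : I -> 'I_3 -> pt R) e : Prop := exists w, bpoint d e w.

Lemma active_persist e : active c e <-> active c' e.
Proof.
split=> -[w]; first exact: bpoint_persist.
by apply: bpoint_persist => //; exact: same_type_sym.
Qed.

Lemma good_polygon_noline (S : set (pt R)) vs p q : good_polygon S vs -> p <> q ->
  exists2 v, v \in vs & orient p q v != 0.
Proof.
move=> [us s2 hk _ _] pq; apply: contrapT => n; have z v : v \in vs -> orient p q v = 0.
  by move=> vv; apply/eqP; apply: contrapT => /negP h; apply: n; exists v.
pose v := nth 0 vs 0; have vv : v \in vs by rewrite mem_nth// (leq_trans _ s2).
have nv : next vs v \in vs by rewrite mem_next.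
have nnv : next vs (next vs v) \in vs by rewrite mem_next.
have [k /(_ _ nnv (next_next_neq us s2 vv))] := hk _ vv.
have s1 : (1 < size vs)%N by rewrite (leq_trans _ s2).
rewrite (next_neq us s1 nv) => /(_ isT).
have [s vE] := orient0_line pq (z _ vv).
have [s' nE] := orient0_line pq (z _ nv).
have [t tE] := orient0_line pq (z _ nnv).
rewrite (_ : orient v (next vs v) (next vs (next vs v)) = 0) ?mulr0 ?ltxx//.
by rewrite tE nE {1}vE /orient !mxE; ring.
Qed.

Lemma form_orient (d : I -> 'I_3 -> pt R) e p q : (forall i, pos3 (d i)) -> p <> q ->
  form d e p = 0 -> form d e q = 0 ->
  exists2 k, k != 0 & forall x, form d e x = k * orient p q x.
Proof.
move=> dpos pq hp hq; have [k hk] := orient_coin pq hp hq; exists k => //.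
apply/eqP => k0; have := form_apex dpos e.
by rewrite formE hk k0 mul0r ltxx.
Qed.

(** The lines are those of the two sides that meet in [v]. They do not coincide, because the
    predecessor of [v] is off the line of the side that starts at [v]. *)
Lemma good_vertex vs v : good_polygon (fig c) vs -> v \in vs ->
  exists e1 e2, [/\ active c e1, active c e2, ecrs c e1 e2 != 0 & v = vtx c e1 e2].
Proof.
move=> gp vv; have [us s2 hk hs _] := gp.
have s1 : (1 < size vs)%N by rewrite (leq_trans _ s2).
have side u : u \in vs -> exists e, [/\ active c e, form c e u = 0 & form c e (next vs u) = 0].
  move=> uu; have [p [q [b h1 h2]]] := hs _ uu.
  have [e [w [be same]]] := bl_bpoint cpos b.
  by exists e; split; [exists w|exact/same|exact/same].
have [e1 [a1 ev1 en1]] := side v vv.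
have uu : prev vs v \in vs by rewrite mem_prev.
have [e2 [a2 ev2 en2]] := side _ uu; rewrite next_prev// in en2.
exists e1, e2; split=> //; last first.
  have [cn|[ne ->]] := coin_or_vtx cpos ev1 en2; last by [].
  exfalso; have vn : v <> next vs v by move=> /eqP; rewrite eq_sym (negbTE (next_neq us s1 vv)).
  have pv : prev vs v != v by rewrite -{2}(next_prev us v) eq_sym next_neq.
  have pn : prev vs v != next vs v by rewrite -{2}(next_prev us v) eq_sym next_next_neq.
  have [k /(_ _ uu pv pn)] := hk _ vv.
  have := iffRL (coin_form0 cpos _ cn) ev2.
  have [k' k0 ->] := form_orient cpos vn ev1 en1 => /eqP.
  by rewrite mulf_eq0 (negbTE k0) /= => /eqP ->; rewrite mulr0 ltxx.
have [cn|[]//] := coin_or_vtx cpos ev1 en2.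
exfalso; have vn : v <> next vs v by move=> /eqP; rewrite eq_sym (negbTE (next_neq us s1 vv)).
have pv : prev vs v != v by rewrite -{2}(next_prev us v) eq_sym next_neq.
have pn : prev vs v != next vs v by rewrite -{2}(next_prev us v) eq_sym next_next_neq.
have [k /(_ _ uu pv pn)] := hk _ vv.
have := iffRL (coin_form0 cpos _ cn) ev2.
have [k' k0 ->] := form_orient cpos vn ev1 en1 => /eqP.
by rewrite mulf_eq0 (negbTE k0) /= => /eqP ->; rewrite mulr0 ltxx.
Qed.

(** All conditions but the last are signs of forms at the vertices, hence preserved. Two choices of
    crossing lines for a vertex lead to the same moved point, since [mu v] is on the moved version
    of every line through [v]. *)
Lemma good_polygon_persist vs (mu : pt R -> pt R) :
  good_polygon (fig c) vs ->
  (forall v, v \in vs -> exists e1 e2,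
     [/\ ecrs c e1 e2 != 0, v = vtx c e1 e2 & mu v = vtx c' e1 e2]) ->
  [/\ good_polygon (fig c') (map mu vs), {in vs &, injective mu} &
      forall v e, v \in vs -> Num.sg (form c e v) = Num.sg (form c' e (mu v))].
Proof.
move=> gp hmu; have [us s2 hk hs [hw Sg]] := gp; have [h1 h2 h3 h4] := sty.
have s1 : (1 < size vs)%N by rewrite (leq_trans _ s2).
have s0 : (0 < size vs)%N by rewrite (leq_trans _ s2).
have sgE v e : v \in vs -> Num.sg (form c e v) = Num.sg (form c' e (mu v)).
  by move=> /hmu[e1 [e2 [ne -> ->]]]; rewrite h3.
have z v e : v \in vs -> form c e v = 0 <-> form c' e (mu v) = 0.
  by move=> vv; split=> /eqP h; apply/eqP; move: h; rewrite (sg_eq0 (sgE v e vv)).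
have muI : {in vs &, injective mu}.
  move=> v w vv ww e; have [e1 [e2 [ne vE mE]]] := hmu _ vv.
  rewrite vE; apply/esym/vtx_uniq => //; apply/(z w) => //; rewrite -e mE.
    exact: vtx_l.
  by apply: vtx_r; rewrite -h1.
have nxE v : v \in vs -> next (map mu vs) (mu v) = mu (next vs v).
  by move=> vv; exact: next_map_inj.
have nin v : v \in vs -> next vs v \in vs by rewrite mem_next.
have side v : v \in vs -> exists e, [/\ active c e, form c e v = 0 & form c e (next vs v) = 0].
  move=> uu; have [p [q [b e1 e2]]] := hs _ uu.
  have [e [w [be same]]] := bl_bpoint cpos b.
  by exists e; split; [exists w|exact/same|exact/same].
have vn v : v \in vs -> v <> next vs v.
  by move=> vv /eqP; rewrite eq_sym (negbTE (next_neq us s1 vv)).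
have weak e : active c e -> exists2 k : R, k != 0 & forall v, v \in vs -> 0 <= k * form c e v.
  move=> [w /(bpoint_bl cpos)[p [q [b same]]]].
  have [k k0 hk'] := form_orient cpos b.1 (iffLR (same p) (orientl _ _))
    (iffLR (same q) (orientr _ _)).
  have k2 : 0 < k * k by rewrite -expr2 exprn_even_gt0.
  case: (hw _ _ b) => h; [exists k => //|exists (- k); rewrite ?oppr_eq0//] => v vv.
    by rewrite hk' mulrA pmulr_rge0// h.
  by rewrite hk' mulrA mulNr nmulr_rge0 ?oppr_lt0// h.
have weak' e k v : (forall v, v \in vs -> 0 <= k * form c e v) -> v \in vs ->
    0 <= k * form c' e (mu v).
  move=> h vv; have := sgE v e vv => /(congr1 ( *%R (Num.sg k))); rewrite -!sgrM.
  by move=> /sg_ge0 <-; exact: h.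
split=> //; split.
- by rewrite map_inj_in_uniq.
- by rewrite size_map.
- move=> _ /mapP[v vv ->]; rewrite nxE//.
  have [k hv] := hk _ vv; have [e [_ ev en]] := side _ vv.
  have [k1 k10 hk1] := form_orient cpos (vn _ vv) ev en.
  have mvn : mu v <> mu (next vs v) by move=> /muI h; exact: vn (h vv (nin _ vv)).
  have [k2 k20 hk2] := form_orient cpos' mvn (iffLR (z _ _ vv) ev) (iffLR (z _ _ (nin _ vv)) en).
  exists (k / k1 * k2) => _ /mapP[u uu ->] uv un.
  rewrite -mulrA -hk2.
  have : 0 < k / k1 * form c e u.
    rewrite hk1 mulrA divfK//; apply: hv => //.
      by apply: contra_neq uv => ->.
    by apply: contra_neq un => ->.
  have := sgE u e uu => /(congr1 ( *%R (Num.sg (k / k1)))); rewrite -!sgrM.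
  by move=> /sg_gt0 ->.
- move=> _ /mapP[v vv ->]; rewrite nxE//.
  have [e [/active_persist[w be] ev en]] := side _ vv.
  have [p [q [b same]]] := bpoint_bl cpos' be.
  by exists p, q; split=> //; apply/same/z => //; exact: nin.
split.
  move=> p q /[dup] b /(bl_bpoint cpos')[e [w [be same]]].
  have ae : active c e by apply/active_persist; exists w.
  have [k k0 hk'] := weak _ ae.
  have [k1 k10 hk1] := form_orient cpos' b.1 (iffLR (same p) (orientl _ _))
    (iffLR (same q) (orientr _ _)).
  have kk : k * k1 != 0 by rewrite mulf_neq0.
  have hh v : v \in map mu vs -> 0 <= k * k1 * orient p q v.
    by move=> /mapP[u uu ->]; rewrite -mulrA -hk1; exact: weak'.
  move: kk; rewrite neq_lt => /orP[] kk; [right|left] => v /hh.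
    by rewrite nmulr_rge0.
  by rewrite pmulr_rge0.
have ms0 : (0 < size (map mu vs))%N by rewrite size_map.
(* The new centroid need not correspond to the old one, so a point [x'] of the second figure with
   the signs of the old centroid is taken as witness. Each active line has the vertices weakly on
   one side, hence [x'] and the new centroid strictly on that side, and [separation] cannot tell
   them apart. *)
have [x' hx'] := fig_persist cpos sty Sg.
have Sx' : fig c' x' by apply: fig_sign hx' Sg.
apply: contrapT => /(separation cpos' Sx')[e [w [be]]].
have ae : active c e by apply/active_persist; exists w.
have [k k0 hk'] := weak _ ae.
have [v vv ve] := good_polygon_noline gp (end_neq cpos (e := e)).
have gx : 0 < k * form c e (centroid vs) by apply: orient_centroid_ge0 => //; exists v.
have gx' : 0 < k * form c' e (centroid (map mu vs)).
  apply: orient_centroid_ge0 => //.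
    by move=> _ /mapP[u uu ->]; exact: weak'.
  exists (mu v); first exact: map_f.
  by rewrite -formE -(sg_eq0 (sgE v e vv)).
have kx' : 0 < k * form c' e x'.
  have := hx' e => /(congr1 ( *%R (Num.sg k))); rewrite -!sgrM => /sg_gt0 <-.
  exact: gx.
have := mulr_gt0 kx' gx'; rewrite mulrACA -expr2 pmulr_rgt0 ?exprn_even_gt0//.
by rewrite leNgt => ->.
Qed.

End PolygonPersistence.

(** * Rational functions of time *)

Section RationalFunctions.
Context {R : realType}.
Implicit Types (r : ratfun R) (p q : {poly R}) (J : set R) (g h : R -> R) (t : R).
Local Notation "p %:F" := (FracField.tofrac p).

Lemma frac_cross (F : fieldType) (a b c d : F) : b != 0 -> d != 0 ->
  a / b = c / d -> a * d = c * b.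
Proof. by move=> b0 d0 /eqP; rewrite GRing.eqr_div// => /eqP. Qed.

Lemma tofrac_neq0 q t : q.[t] != 0 -> q%:F != 0.
Proof. by move=> h; rewrite tofrac_eq0; apply: contraNneq h => ->; rewrite horner0. Qed.

(** Two representations of [r] have equal cross products as polynomials, so the set from which
    [xget] chooses is a singleton. *)
Lemma revalE r t p q : q.[t] != 0 -> r = p%:F / q%:F -> reval r t = p.[t] / q.[t].
Proof.
move=> qt rE; apply: xget_subset1; first by exists p, q.
move=> _ _ [p1 [q1 [h1 r1 ->]]] [p2 [q2 [h2 r2 ->]]].
have e' := frac_cross (tofrac_neq0 h1) (tofrac_neq0 h2) (etrans (esym r1) r2).
have e : p1 * q2 = p2 * q1.
  by apply/eqP; rewrite -tofrac_eq (tofracM p1 q2) (tofracM p2 q1) e'.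
by apply/eqP; rewrite GRing.eqr_div// -!hornerM e.
Qed.

(** One fraction serves all of [J]; only its representation as a quotient may vary with the
    moment. *)
Definition rational_on J g : Prop :=
  exists r, forall t, J t -> rdefined r t /\ reval r t = g t.

Lemma rational_on_eq J g h : (forall t, J t -> g t = h t) ->
  rational_on J g -> rational_on J h.
Proof. by move=> e [r hr]; exists r => t Jt; rewrite -e//; exact: hr. Qed.

Lemma rational_on_cst J (k : R) : rational_on J (fun=> k).
Proof.
exists (k%:P%:F) => t _.
have o : (1 : {poly R}).[t] != 0 by rewrite hornerC oner_eq0.
have e : k%:P%:F = k%:P%:F / (1 : {poly R})%:F by rewrite tofrac1 divr1.
split; first by exists k%:P, 1.
by rewrite (revalE o e) !hornerC divr1.
Qed.

Lemma rational_onD J g h : rational_on J g -> rational_on J h ->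
  rational_on J (fun t => g t + h t).
Proof.
move=> [r hr] [r' hr']; exists (r + r') => t Jt.
have [[p [q [qt rE]]] <-] := hr _ Jt; have [[p' [q' [qt' rE']]] <-] := hr' _ Jt.
have qq : (q * q').[t] != 0 by rewrite hornerM mulf_neq0.
have e : r + r' = (p * q' + p' * q)%:F / (q * q')%:F.
  rewrite rE rE' (addf_div _ _ (tofrac_neq0 qt) (tofrac_neq0 qt')).
  by rewrite (tofracD (p * q')) (tofracM p) (tofracM p') (tofracM q).
split; first by exists (p * q' + p' * q), (q * q').
rewrite (revalE qq e) (revalE qt rE) (revalE qt' rE') addf_div//.
by rewrite !hornerD !hornerM.
Qed.

Lemma rational_onM J g h : rational_on J g -> rational_on J h ->
  rational_on J (fun t => g t * h t).
Proof.
move=> [r hr] [r' hr']; exists (r * r') => t Jt.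
have [[p [q [qt rE]]] <-] := hr _ Jt; have [[p' [q' [qt' rE']]] <-] := hr' _ Jt.
have qq : (q * q').[t] != 0 by rewrite hornerM mulf_neq0.
have e : r * r' = (p * p')%:F / (q * q')%:F by rewrite rE rE' mulf_div !tofracM.
split; first by exists (p * p'), (q * q').
by rewrite (revalE qq e) (revalE qt rE) (revalE qt' rE') mulf_div !hornerM.
Qed.

Lemma rational_onN J g : rational_on J g -> rational_on J (fun t => - g t).
Proof.
move=> hg; apply: rational_on_eq (rational_onM (rational_on_cst J (-1)) hg).
by move=> t _; rewrite mulN1r.
Qed.

Lemma rational_onB J g h : rational_on J g -> rational_on J h ->
  rational_on J (fun t => g t - h t).
Proof. by move=> hg /rational_onN; exact: rational_onD. Qed.

Lemma rational_onV J g : (forall t, J t -> g t != 0) -> rational_on J g ->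
  rational_on J (fun t => (g t)^-1).
Proof.
move=> nz [r hr]; exists r^-1 => t Jt.
have [[p [q [qt rE]]] gE] := hr _ Jt.
have pt' : p.[t] != 0.
  by apply: contraNneq (nz _ Jt) => p0; rewrite -gE (revalE qt rE) p0 mul0r.
have e : r^-1 = q%:F / p%:F by rewrite rE invf_div.
split; first by exists q, p.
by rewrite (revalE pt' e) -gE (revalE qt rE) invf_div.
Qed.

Lemma rational_on_sum J (T : Type) (l : seq T) (f : T -> R -> R) :
  (forall x, rational_on J (f x)) -> rational_on J (fun t => \sum_(x <- l) f x t).
Proof.
move=> h; elim: l => [|x l IH].
  by apply: rational_on_eq (rational_on_cst J 0) => t _; rewrite big_nil.
by apply: rational_on_eq (rational_onD (h x) IH) => t _; rewrite big_cons.
Qed.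

Lemma poly_roots_seq p : p != 0 -> exists l : seq R, forall x, root p x -> x \in l.
Proof.
move: {2}(size p) (leqnn (size p)) => n; elim: n p => [|n IH] p.
  by rewrite leqn0 size_poly_eq0 => /eqP ->; rewrite eqxx.
move=> sp p0; have [[x px]|n0] := pselect (exists x, root p x); last first.
  by exists [::] => x px; case: n0; exists x.
have /factor_theorem[q qE] := px.
have q0 : q != 0 by apply: contraNneq p0 => q0; rewrite qE q0 mul0r.
have [|l hl] := IH q _ q0.
  by move: sp; rewrite qE size_Mmonic ?monicXsubC// size_XsubC addn2.
exists (x :: l) => y; rewrite qE rootM root_XsubC inE => /orP[/hl ->|->//].
by rewrite orbT.
Qed.

(* b is true when g vanishes identically. *)
Lemma rational_on_zeros J g : rational_on J g ->
  exists (l : seq R) (b : bool), forall t, J t -> t \notin l -> (g t == 0) = b.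
Proof.
move=> [r hr]; have [[t0 Jt0]|n] := pselect (exists t, J t); last first.
  by exists [::], true => t Jt; case: n; exists t.
have [[p [q [qt rE]]] _] := hr _ Jt0.
have q0 : q != 0 by apply: contraNneq qt => ->; rewrite horner0.
have [p0|p0] := eqVneq p 0.
  exists [::], true => t Jt _; have [_ <-] := hr _ Jt.
  have o : (1 : {poly R}).[t] != 0 by rewrite hornerC oner_eq0.
  have e : r = (0 : {poly R})%:F / (1 : {poly R})%:F by rewrite rE p0 tofrac0 !mul0r.
  by rewrite (revalE o e) horner0 mul0r eqxx.
have [l hl] := poly_roots_seq (mulf_neq0 p0 q0).
exists l, false => t Jt tl; have [_ <-] := hr _ Jt.
have : ~~ root (p * q) t by apply: contra tl; exact: hl.
rewrite rootM negb_or => /andP[p1 q1].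
by rewrite (revalE q1 rE); apply/negbTE; rewrite mulf_neq0// invr_neq0.
Qed.

Lemma rational_on_continuous J g t : nbhs t J -> rational_on J g ->
  {for t, continuous g}.
Proof.
move=> nJ [r hr]; have Jt := nbhs_singleton nJ.
have [[p [q [qt rE]]] gt] := hr _ Jt.
have cp := @continuous_horner R p t; have cq := @continuous_horner R q t.
have nq : \forall s \near t, q.[s] != 0.
  have on : open [set y : R | y != 0] by exact: open_neq.
  exact: (cq _ (open_nbhs_nbhs (conj on qt))).
have gE : \forall s \near t, p.[s] / q.[s] = g s.
  by apply: filterS2 nq nJ => s qs Js; rewrite -(revalE qs rE); have [] := hr _ Js.
have c : (fun s => p.[s] / q.[s]) @ t --> p.[t] / q.[t].
  by apply: (@cvgM R _ _ (nbhs_filter t)) => //; exact: cvgV.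
rewrite /prop_for /continuous_at -gt (revalE qt rE).
apply: cvg_trans c; apply: near_eq_cvg; apply: filterS gE => s ->.
by [].
Qed.

Lemma taff_exists J (M : R -> 'M[R]_2) (b : R -> pt R) :
  (forall i j, rational_on J (fun t => M t i j)) ->
  (forall i, rational_on J (fun t => b t i 0)) ->
  (forall t, J t -> \det (M t) != 0) ->
  exists f : taff R, forall t, J t ->
    taff_defined f t /\ forall v, taff_at f t v = M t *m v + b t.
Proof.
move=> hM hb hd.
have [F hF] : exists F : 'I_2 -> 'I_2 -> ratfun R, forall i j t, J t ->
    rdefined (F i j) t /\ reval (F i j) t = M t i j.
  have [F hF] : exists F : 'I_2 * 'I_2 -> ratfun R, forall ij t, J t ->
      rdefined (F ij) t /\ reval (F ij) t = M t ij.1 ij.2.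
    by apply: (@fin_all_exists _ (fun=> ratfun R) (fun ij r => forall t, J t ->
      rdefined r t /\ reval r t = M t ij.1 ij.2)) => -[i j]; exact: hM.
  by exists (fun i j => F (i, j)) => i j; exact: (hF (i, j)).
have [G hG] : exists G : 'I_2 -> ratfun R, forall i t, J t ->
    rdefined (G i) t /\ reval (G i) t = b t i 0.
  by apply: (@fin_all_exists _ (fun=> ratfun R) (fun i r => forall t, J t ->
      rdefined r t /\ reval r t = b t i 0)) => i; exact: hb.
exists (\matrix_(i, j) F i j, \col_i G i) => t Jt.
have ME : taff_mx (\matrix_(i, j) F i j, \col_i G i) t = M t.
  by apply/matrixP => i j; rewrite !mxE; have [] := hF i j t Jt.
split; first split=> [i j|i j|].
- by rewrite mxE; have [] := hF i j t Jt.
- by rewrite mxE; have [] := hG i t Jt.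
- by rewrite ME hd.
move=> v; rewrite /taff_at ME; congr (_ + _); apply/matrixP => i j.
by rewrite !mxE ord1; have [] := hG i t Jt.
Qed.

Lemma rational_on_orient J (P Q X : R -> pt R) :
  (forall i, rational_on J (fun t => P t i 0)) ->
  (forall i, rational_on J (fun t => Q t i 0)) ->
  (forall i, rational_on J (fun t => X t i 0)) ->
  rational_on J (fun t => orient (P t) (Q t) (X t)).
Proof.
move=> hP hQ hX; rewrite /orient.
by do ![apply: rational_onB|apply: rational_onM].
Qed.

Lemma rational_on_crs J (P Q P' Q' : R -> pt R) :
  (forall i, rational_on J (fun t => P t i 0)) ->
  (forall i, rational_on J (fun t => Q t i 0)) ->
  (forall i, rational_on J (fun t => P' t i 0)) ->
  (forall i, rational_on J (fun t => Q' t i 0)) ->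
  rational_on J (fun t => crs (P t) (Q t) (P' t) (Q' t)).
Proof.
move=> hP hQ hP' hQ'; rewrite /crs.
by do ![apply: rational_onB|apply: rational_onM].
Qed.

Lemma rational_on_meet J (P Q P' Q' : R -> pt R) i :
  (forall i, rational_on J (fun t => P t i 0)) ->
  (forall i, rational_on J (fun t => Q t i 0)) ->
  (forall i, rational_on J (fun t => P' t i 0)) ->
  (forall i, rational_on J (fun t => Q' t i 0)) ->
  (forall t, J t -> crs (P t) (Q t) (P' t) (Q' t) != 0) ->
  rational_on J (fun t => meet (P t) (Q t) (P' t) (Q' t) i 0).
Proof.
move=> hP hQ hP' hQ' nz.
have : rational_on J (fun t => P t i 0 + orient (P' t) (Q' t) (P t) *
    (crs (P t) (Q t) (P' t) (Q' t))^-1 * (Q t i 0 - P t i 0)).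
  apply: rational_onD => //; apply: rational_onM; last exact: rational_onB.
  apply: rational_onM; first exact: rational_on_orient.
  by apply: rational_onV => //; exact: rational_on_crs.
by apply: rational_on_eq => t _; rewrite /meet !mxE.
Qed.

Lemma rational_on_taff J (f : taff R) v i :
  (forall t, J t -> taff_defined f t) ->
  rational_on J (fun t => taff_at f t v i 0).
Proof.
move=> hf; have hM j : rational_on J (fun t => taff_mx f t i j).
  by exists (f.1 i j) => t /hf[h _ _]; split; [exact: h|rewrite mxE].
have hb : rational_on J (fun t => map_mx (reval^~ t) f.2 i 0).
  by exists (f.2 i 0) => t /hf[_ h _]; split; [exact: h|rewrite mxE].
have : rational_on J (fun t => taff_mx f t i 0 * v 0 0 + taff_mx f t i 1 * v 1 0 +
    map_mx (reval^~ t) f.2 i 0).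
  apply: rational_onD => //.
  by apply: rational_onD; apply: rational_onM => //; exact: rational_on_cst.
by apply: rational_on_eq => t _; rewrite /taff_at addmx00 mulmx2E.
Qed.

Lemma taff_affinity (f : taff R) t : taff_defined f t -> affinity (taff_at f t).
Proof.
move=> [_ _ d]; exists (taff_mx f t), (map_mx (reval^~ t) f.2).
by rewrite unitmxE unitfE.
Qed.

Lemma taff_interpolate J (p q x : pt R) (P Q X : R -> pt R) :
  orient p q x != 0 ->
  (forall i, rational_on J (fun t => P t i 0)) ->
  (forall i, rational_on J (fun t => Q t i 0)) ->
  (forall i, rational_on J (fun t => X t i 0)) ->
  (forall t, J t -> orient (P t) (Q t) (X t) != 0) ->
  exists f : taff R, forall t, J t ->
    [/\ taff_defined f t, taff_at f t p = P t, taff_at f t q = Q t & taff_at f t x = X t].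
Proof.
move=> o hP hQ hX ho; pose D := orient p q x.
(* By Cramer's rule, the matrix that sends [q - p] to [Q t - P t] and [x - p] to [X t - P t]. Its
   determinant is the ratio of the two oriented areas. *)
pose M t : 'M[R]_2 := \matrix_(i, j) (D^-1 *
  if j == 0 then (Q t i 0 - P t i 0) * (x 1 0 - p 1 0) - (X t i 0 - P t i 0) * (q 1 0 - p 1 0)
  else (X t i 0 - P t i 0) * (q 0 0 - p 0 0) - (Q t i 0 - P t i 0) * (x 0 0 - p 0 0)).
pose b t : pt R := P t - M t *m p.
have hM i j : rational_on J (fun t => M t i j).
  have : rational_on J (fun t => D^-1 *
    if j == 0 then (Q t i 0 - P t i 0) * (x 1 0 - p 1 0) - (X t i 0 - P t i 0) * (q 1 0 - p 1 0)
    else (X t i 0 - P t i 0) * (q 0 0 - p 0 0) - (Q t i 0 - P t i 0) * (x 0 0 - p 0 0)).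
    apply: rational_onM; first exact: rational_on_cst.
    by case: (j == 0); apply: rational_onB; apply: rational_onM;
      try exact: rational_on_cst; exact: rational_onB.
  by apply: rational_on_eq => t _; rewrite mxE.
have hb i : rational_on J (fun t => b t i 0).
  have : rational_on J (fun t => P t i 0 - (M t i 0 * p 0 0 + M t i 1 * p 1 0)).
    apply: rational_onB => //.
    by apply: rational_onD; apply: rational_onM => //; exact: rational_on_cst.
  by apply: rational_on_eq => t _; rewrite /b addmx00 oppmx00 mulmx2E.
have d t : \det (M t) = orient (P t) (Q t) (X t) / D.
  by rewrite det_mx22 !mxE /=; move: o; rewrite /D /orient => o; field.
have [|f hf] := taff_exists hM hb.
  by move=> t Jt; rewrite d mulf_neq0// ?invr_neq0// ho.
exists f => t /hf[fd fE]; split=> //; rewrite fE.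
- by rewrite /b addrC subrK.
- apply: pt_eqP; rewrite /b !(addmx00, oppmx00, mulmx2E) !mxE /=;
    by move: o; rewrite /D /orient => o; field.
- apply: pt_eqP; rewrite /b !(addmx00, oppmx00, mulmx2E) !mxE /=;
    by move: o; rewrite /D /orient => o; field.
Qed.

Lemma sg_constant (a b : R) g t t' :
  (forall s, a < s < b -> {for s, continuous g}) ->
  (forall s s', a < s < b -> a < s' < b -> g s = 0 -> g s' = 0) ->
  a < t < b -> a < t' < b -> Num.sg (g t) = Num.sg (g t').
Proof.
move=> cg zg ht ht'.
have [z|nz] := eqVneq (g t) 0; first by rewrite z (zg _ _ ht ht' z).
have nz' s : a < s < b -> g s != 0.
  by move=> hs; apply: contraNneq nz => z; rewrite (zg _ _ hs ht z).
have : connected (g @` `]a, b[).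
  apply: connected_continuous_connected.
    by apply/connected_intervalP; exact: interval_is_interval.
  apply: continuous_in_subspaceT => s; rewrite inE /= in_itv /=; exact: cg.
move=> /connected_intervalP itv.
have key s s' : a < s < b -> a < s' < b -> g s < 0 -> 0 < g s' -> False.
  move=> hs hs' n p; have := itv (g s) (g s').
  have i1 : (g @` `]a, b[) (g s) by exists s => //=; rewrite in_itv.
  have i2 : (g @` `]a, b[) (g s') by exists s' => //=; rewrite in_itv.
  move=> /(_ i1 i2 0); rewrite (ltW n) (ltW p) => /(_ isT)[u].
  by rewrite /= in_itv /= => /nz' /eqP.
have := nz; have := nz' _ ht'; rewrite !neq_lt => /orP[] h1 /orP[] h2.
- by rewrite !ltr0_sg.
- by case: (key _ _ ht' ht h1 h2).
- by case: (key _ _ ht ht' h2 h1).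
- by rewrite !gtr0_sg.
Qed.

End RationalFunctions.

(** * Moments of the partition *)

Section Intervals.
Context {R : realType}.
Implicit Types (I J K : set R) (x y z s t u v a b e : R).

Lemma has_endpointsP K x y : has_endpoints K x y ->
  [/\ K !=set0, is_interval K, forall t, K t -> x <= t <= y,
      forall e, 0 < e -> exists2 s, K s & s < x + e
    & forall e, 0 < e -> exists2 s, K s & y - e < s].
Proof.
move=> [K0 [bl [br KE]]].
have Kle t : K t -> x <= t <= y.
  rewrite KE /= in_itv /= => /andP[]; case: bl {KE}; case: br => /= h1 h2;
    by rewrite ?h1 ?h2 ?(ltW h1) ?(ltW h2).
have [t0 Kt0] := K0.
have xt s : x < s -> s < t0 -> K s.
  move=> xs st; move: Kt0; rewrite KE /= !in_itv /= => /andP[_ h].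
  apply/andP; split; first by case: bl {KE}; rewrite //= ltW.
  by case: br {KE} h => /= h; rewrite ?(lt_trans st h)// ltW// (lt_le_trans st h).
have ty s : t0 < s -> s < y -> K s.
  move=> ts sy; move: Kt0; rewrite KE /= !in_itv /= => /andP[h _].
  apply/andP; split; last by case: br {KE}; rewrite //= ltW.
  by case: bl {KE} h => /= h; rewrite ?(lt_trans h ts)// ltW// (le_lt_trans h ts).
have /andP[xt0 t0y] := Kle _ Kt0.
split=> // [|e e0|e e0]; first by rewrite KE; exact: interval_is_interval.
  move: xt0; rewrite le_eqVlt => /orP[/eqP xt0|xt0].
    by exists t0 => //; rewrite xt0 ltrDl.
  exists (x + Num.min e (t0 - x) / 2); last first.
    by rewrite ltrD2l ltr_pdivrMr// gt_min; apply/orP; left; rewrite mulr_natr mulr2n ltrDl.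
  have m0 : 0 < Num.min e (t0 - x) by rewrite lt_min e0 subr_gt0.
  have m1 : Num.min e (t0 - x) <= t0 - x by rewrite ge_min lexx orbT.
  by apply: xt; lra.
move: t0y; rewrite le_eqVlt => /orP[/eqP t0y|t0y].
  by exists t0 => //; rewrite t0y ltrBlDr ltrDl.
exists (y - Num.min e (y - t0) / 2); last first.
  by rewrite ltrD2l ltrN2 ltr_pdivrMr// gt_min; apply/orP; left; rewrite mulr_natr mulr2n ltrDl.
have m0 : 0 < Num.min e (y - t0) by rewrite lt_min e0 subr_gt0.
have m1 : Num.min e (y - t0) <= y - t0 by rewrite ge_min lexx orbT.
by apply: ty; lra.
Qed.

Lemma has_endpoints_uniq K x y x' y' :
  has_endpoints K x y -> has_endpoints K x' y' -> x = x' /\ y = y'.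
Proof.
have key u v u' v' : has_endpoints K u v -> has_endpoints K u' v' -> u <= u' /\ v' <= v.
  move=> /has_endpointsP[_ _ h1 _ _] /has_endpointsP[_ _ _ h2 h3]; split.
    rewrite leNgt; apply/negP => h; have [|s Ks] := h2 (u - u'); first by rewrite subr_gt0.
    by have /andP[us _] := h1 _ Ks; rewrite addrC subrK ltNge us.
  rewrite leNgt; apply/negP => h; have [|s Ks] := h3 (v' - v); first by rewrite subr_gt0.
  by have /andP[_ sv] := h1 _ Ks; rewrite opprB addrC subrK ltNge sv.
move=> h h'; have [h1 h2] := key _ _ _ _ h h'; have [h3 h4] := key _ _ _ _ h' h.
by split; apply/eqP; rewrite eq_le ?h1 ?h2 ?h3 ?h4.
Qed.

Lemma endpoint_or K x y z : has_endpoints K x y -> endpoint K z -> z = x \/ z = y.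
Proof.
move=> h [w [/(has_endpoints_uniq h)[]|/(has_endpoints_uniq h)[]]]; auto.
Qed.

Lemma endpointP K x : endpoint K x ->
  (forall e, 0 < e -> exists2 t, K t & `|t - x| < e) /\
  ((forall t, K t -> x <= t) \/ (forall t, K t -> t <= x)).
Proof.
move=> [y [|]] /has_endpointsP[_ _ h h1 h2]; split.
- move=> e /h1[s Ks sx]; exists s => //; have /andP[xs _] := h _ Ks.
  by rewrite ger0_norm ?subr_ge0// ltrBlDl.
- by left => t /h/andP[].
- move=> e /h2[s Ks sx]; exists s => //; have /andP[_ xs] := h _ Ks.
  by rewrite distrC ger0_norm ?subr_ge0// ltrBlDr -ltrBlDl.
- by right => t /h/andP[].
Qed.

Lemma endpoint_nbhs K x y z : has_endpoints K x y -> K z -> z != x -> z != y ->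
  nbhs z K.
Proof.
move=> /[dup] /has_endpointsP[_ _ h _ _] [_ [bl [br KE]]] Kz zx zy.
have /andP[xz zy'] := h _ Kz.
have xz' : x < z by rewrite lt_neqAle eq_sym zx.
have zy2 : z < y by rewrite lt_neqAle zy.
have : nbhs z `]x, y[%classic.
  by apply: open_nbhs_nbhs; split; [exact: itv_open|rewrite /= in_itv /= xz'].
apply: filterS => t; rewrite KE /= !in_itv /= => /andP[h1 h2].
by case: bl {KE}; case: br => /=; rewrite ?h1 ?h2 ?(ltW h1) ?(ltW h2).
Qed.

Lemma bounded_endpoints K u v : K !=set0 -> is_interval K ->
  (forall t, K t -> u <= t <= v) -> exists x y, has_endpoints K x y.
Proof.
move=> K0 /is_intervalP KE hb; exists (inf K), (sup K); split=> //.
have lb : has_lbound K by exists u => t /hb/andP[].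
have ub : has_ubound K by exists v => t /hb/andP[].
(* [BSide true] closes an interval on the left but opens it on the right, hence the negation. *)
exists `[< K (inf K) >], (~~ `[< K (sup K) >]).
by rewrite {1}KE /Rhull (asboolT lb) (asboolT ub).
Qed.

(* Otherwise K could be enlarged by a ball around x. *)
Lemma maximal_endpoint (U : Type) (ok : U -> R -> Prop) J (P : set R -> Prop) K x (Z : seq R) :
  (forall K, P K <-> exists m, forall t, K t -> ok m t) ->
  (forall m t t', J t -> J t' -> t \notin Z -> t' \notin Z -> ok m t -> ok m t') ->
  maximal_interval J P K -> endpoint K x -> nbhs x J -> x \in Z.
Proof.
move=> hP hZ [[K0 Kitv KJ PK] Kmax] ex nJ; apply: contrapT => /negP xZ.
have nZ : nbhs x [set t | t \notin Z].
  elim: (Z) xZ => [|z Z' IH]; first by move=> _; apply: filterS filterT.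
  rewrite inE negb_or => /andP[xz /IH n].
  have n2 : nbhs x [set t : R | t != z] by apply: open_nbhs_nbhs; split; [exact: open_neq|].
  by apply: filterS2 n n2 => t /= h1 h2; rewrite inE negb_or h2.
have [e /= e0 he] := iffLR (nbhs_ballP x _) (filterI nJ nZ).
have [/(_ _ e0)[t0 Kt0 t0x] side] := endpointP ex.
pose V := [set t : R | `|t - x| < e].
have VV t : V t -> J t /\ t \notin Z by move=> h; apply: he; rewrite /ball /= distrC.
have Vitv : is_interval V.
  move=> a b Va Vb z /andP[az zb]; move: Va Vb; rewrite /V /= !ltr_norml.
  by move=> /andP[h1 h2] /andP[h3 h4]; apply/andP; split; lra.
have [m hm] := iffLR (hP _) PK.
have KV : K `|` V = K.
  apply: Kmax; last by left.
  split.
  - by exists t0; left.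
  - have key (A : set R) a b z : is_interval A -> A a -> A b -> a <= z <= b -> A z.
      by move=> iA Aa Ab; exact: iA.
    move=> a b ha hb z /andP[az zb]; have [zt|tz] := leP z t0.
      case: ha => ha; [left; apply: (key _ a t0)|right; apply: (key _ a t0)];
        by rewrite // az zt.
    case: hb => hb; [left; apply: (key _ t0 b)|right; apply: (key _ t0 b)];
      by rewrite // zb (ltW tz).
  - by move=> t [/KJ//|/VV[]].
  - apply/hP; exists m => t [/hm//|Vt]; have [Jt tZ] := VV _ Vt.
    have [Jt0 t0Z] := VV _ t0x.
    by apply: (hZ m t0) => //; exact: hm.
have VK t : V t -> K t by move=> h; rewrite -KV; right.
have e2 : 0 < e / 2 by rewrite divr_gt0.
have e2e : e / 2 < e by rewrite ltr_pdivrMr// mulr_natr mulr2n ltrDl.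
case: side => h.
  have := h (x - e / 2); rewrite leNgt ltrBlDr ltrDl e2 => /(_ _)/notF; apply.
  by apply: VK; rewrite /V /= addrC addKr normrN gtr0_norm.
have := h (x + e / 2); rewrite leNgt ltrDl e2 => /(_ _)/notF; apply.
by apply: VK; rewrite /V /= addrC addKr gtr0_norm.
Qed.

(** The union [K] of all intervals around [t] on which [ok m] holds is maximal, as a larger interval
    would have the same value at [t]. If [K] did not reach [t'], one of its end points would be
    strictly between [a] and [b]; the bounds [u] and [v] ensure that the end points are real
    numbers. *)
Lemma constant_between (U : Type) (ok : U -> R -> Prop) J (P : set R -> Prop) a b u v :
  (forall K, P K <-> exists m, forall t, K t -> ok m t) ->
  (forall m m' t, J t -> ok m t -> ok m' t -> m = m') ->
  (forall t, J t -> u <= t <= v) -> `]a, b[ `<=` J ->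
  (forall K x, maximal_interval J P K -> endpoint K x -> J x -> ~ a < x < b) ->
  forall m t t', a < t < b -> a < t' < b -> ok m t -> ok m t'.
Proof.
move=> hP um hJ abJ hno m t t' ht ht' okt.
have abJ' s : a < s < b -> J s by move=> h; apply: abJ; rewrite /= in_itv.
pose good K' := [/\ is_interval K', K' `<=` J, K' t & forall r, K' r -> ok m r].
pose K := [set s | exists2 K', good K' & K' s].
have Kt : K t.
  exists [set t] => //; split=> //.
  - by move=> x y -> -> z /andP[h1 h2]; apply/eqP; rewrite eq_le h1 h2.
  - by move=> _ ->; exact: abJ'.
  - by move=> _ ->.
have Kitv : is_interval K.
  move=> x y [K1 [i1 J1 t1 o1] x1] [K2 [i2 J2 t2 o2] y2] z /andP[xz zy].
  have [zt|tz] := leP z t.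
    by exists K1 => //; apply: (i1 x t) => //; rewrite xz zt.
  by exists K2 => //; apply: (i2 t y) => //; rewrite zy (ltW tz).
have KJ : K `<=` J by move=> s [K' [_ h _ _]] /h.
have Kok s : K s -> ok m s by move=> [K' [_ _ _ h]] /h.
have Kmax : maximal_interval J P K.
  split; first by split=> //; [exists t|apply/hP; exists m].
  move=> K' [K0' i' J' /hP[m' o']] KK'; apply/seteqP; split=> // s K's.
  exists K' => //; split=> //; first exact: KK'.
  by move=> r /o'; rewrite (um m m' t (abJ' _ ht) okt (o' _ (KK' _ Kt))).
have [x [y hxy]] := bounded_endpoints (ex_intro _ t Kt) Kitv (fun s Ks => hJ s (KJ s Ks)).
have [_ _ h h1 h2] := has_endpointsP hxy.
have /andP[xt ty] := h _ Kt.
apply: Kok; apply: contrapT => nK.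
have [tt'|tt'|e] := ltgtP t t'; last by apply: nK; rewrite -e.
- have yt' : y <= t'.
    rewrite leNgt; apply/negP => lt'y; have [|s Ks] := h2 (y - t'); first by rewrite subr_gt0.
    rewrite opprB addrC subrK => t's; apply: nK.
    by apply: (Kitv t s) => //; rewrite (ltW tt') (ltW t's).
  have yab : a < y < b.
    by move: ht ht' => /andP[? ?] /andP[? ?]; apply/andP; split; lra.
  by apply: (hno K y Kmax _ (abJ' _ yab) yab); exists x; right.
- have yt' : t' <= x.
    rewrite leNgt; apply/negP => lt'y; have [|s Ks] := h1 (t' - x); first by rewrite subr_gt0.
    rewrite addrC subrK => t's; apply: nK.
    by apply: (Kitv s t) => //; rewrite (ltW tt') (ltW t's).
  have yab : a < x < b.
    by move: ht ht' => /andP[? ?] /andP[? ?]; apply/andP; split; lra.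
  by apply: (hno K x Kmax _ (abJ' _ yab) yab); exists y; left.
Qed.

End Intervals.

(** * How two and three lines meet *)

Section LinePairs.
Context {R : realType}.
Implicit Types (p q u v x : pt R) (l : set (pt R)).

Definition pline p q : set (pt R) := [set x | orient p q x = 0].

Definition ptype p q p' q' : meet_type :=
  if crs p q p' q' != 0 then MeetPoint
  else if orient p q p' == 0 then MeetLine else MeetEmpty.

Lemma plineI p q p' q' : crs p q p' q' != 0 ->
  pline p q `&` pline p' q' = [set meet p q p' q'].
Proof.
move=> h; apply/seteqP; split=> [x [h1 h2]|_ ->]; first exact: meet_uniq h h1 h2.
by split; [exact: meet_l|exact: meet_r].
Qed.

Lemma ptype_holds p q p' q' : p <> q -> p' <> q' ->
  has_meet_type (pline p q) (pline p' q') (ptype p q p' q').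
Proof.
move=> pq pq'; rewrite /ptype; case: (boolP (crs p q p' q' != 0)) => [h|/negPn/eqP h] /=.
  by exists (meet p q p' q'); exact: plineI.
have h' : crs p' q' p q = 0 by move: h; rewrite /crs => h; rewrite -[RHS]oppr0 -h; ring.
case: eqP => /= e.
  have [a1 a2] := crs0_coin pq' h' (orientl _ _) e.
  have [k hk] := orient_coin pq' a1 a2.
  have [b1 b2] : orient p' q' p = 0 /\ orient p' q' q = 0.
    have [s ps] := orient0_line pq e.
    by apply: (crs0_coin pq h e (orientl _ _)).
  have [k' hk'] := orient_coin pq b1 b2.
  apply/seteqP; split=> x; rewrite /pline /=; first by rewrite hk' => ->; rewrite mulr0.
  by rewrite hk => ->; rewrite mulr0.
apply/seteqP; split=> // x [/= x1 x2].
by have [a1 _] := crs0_coin pq' h' x2 x1.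
Qed.

Lemma has_meet_type_uniq l l' m m' : (exists x y, [/\ l x, l y & x <> y]) ->
  has_meet_type l l' m -> has_meet_type l l' m' -> m = m'.
Proof.
move=> [x [y [lx ly xy]]].
have E0P v : l `&` l' = set0 -> l `&` l' = [set v] -> False.
  by move=> -> e; have : [set v] v by []; rewrite -e.
have E0L : l `&` l' = set0 -> l = l' -> False.
  by move=> e e'; rewrite -e' setIid in e; rewrite e in lx.
have EPL v : l `&` l' = [set v] -> l = l' -> False.
  move=> e e'; rewrite -e' setIid in e; apply: xy.
  have -> : x = v by move: lx; rewrite e.
  by move: ly; rewrite e => ->.
case: m; case: m' => //=.
- by move=> h [v]; case/(E0P v h).
- by move=> h h'; case: (E0L h h').
- by move=> [v h] h'; case: (E0P v h' h).
- by move=> [v h] h'; case: (EPL v h h').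
- by move=> h h'; case: (E0L h' h).
- by move=> h [v h']; case: (EPL v h' h).
Qed.

Lemma pline_two p q : p <> q -> exists x y, [/\ pline p q x, pline p q y & x <> y].
Proof. by move=> pq; exists p, q; split; [exact: orientl|exact: orientr|]. Qed.

Lemma has_meet_typeP p q p' q' m : p <> q -> p' <> q' ->
  has_meet_type (pline p q) (pline p' q') m <-> m = ptype p q p' q'.
Proof.
move=> pq pq'; split=> [h|->]; last exact: ptype_holds.
exact: has_meet_type_uniq (pline_two pq) h (ptype_holds pq pq').
Qed.

(* Up to sign the determinant of the three line equations. *)
Definition det3 p q p' q' p2 q2 : R :=
  crs p q p' q' * orient p2 q2 p - orient p' q' p * crs p q p2 q2.

Lemma det3E p q p' q' p2 q2 : crs p q p' q' != 0 ->
  det3 p q p' q' p2 q2 = crs p q p' q' * orient p2 q2 (meet p q p' q').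
Proof. by move=> h; rewrite /det3 /meet orient_ray; field. Qed.

(** Concurrency in terms of the vanishing of [crs], [orient] and [det3], all rational functions of
    moving points. The second branch is for two coinciding lines, which the third must cross. *)
Definition concurrent p q p' q' p2 q2 : bool :=
  if crs p q p' q' != 0 then det3 p q p' q' p2 q2 == 0
  else (orient p q p' == 0) && (crs p q p2 q2 != 0).

Lemma concurrentP p q p' q' p2 q2 : p <> q -> p' <> q' -> p2 <> q2 ->
  (exists v, pline p q `&` pline p' q' `&` pline p2 q2 = [set v]) <->
  concurrent p q p' q' p2 q2.
Proof.
move=> pq pq' pq2; rewrite /concurrent.
case: (boolP (crs p q p' q' != 0)) => [h|h].
  rewrite (plineI h) det3E// mulf_eq0 (negbTE h) /=; split.
    move=> [v e]; have : [set v] v by [].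
    by rewrite -e => -[-> /eqP].
  move=> /eqP e; by exists (meet p q p' q'); apply/seteqP; split=> [x []//|_ ->]; split.
have := ptype_holds pq pq'; rewrite /ptype (negbTE h).
case: eqP => /= e.
  move=> <-; rewrite setIid; split.
    move=> [v /= hv]; apply/negP => /eqP c0.
    have : ptype p q p2 q2 = MeetPoint.
      by apply/esym/has_meet_typeP => //; exists v.
    by rewrite /ptype c0 eqxx /=; case: eqP.
  by move=> c0; exists (meet p q p2 q2); exact: plineI.
move=> ->; rewrite set0I; split=> // -[v hv].
by have : [set v] v by []; rewrite -hv.
Qed.

End LinePairs.

(** * Finiteness of the moments and constancy between them *)

Section Moments.
Context {R : realType} (O : gobject R).
Hypothesis hO : input_object O.
Implicit Types (c o : atomic R) (p q : pt R) (t x : R) (T : set (pt R)).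

Lemma input_endpoints o : O o -> exists x y, has_endpoints (dom o) x y.
Proof.
have [_ h _] := hO => /h[_ [x [y [_ _ ho]]] _ _ _].
by exists x, y.
Qed.

Lemma input_defined o t : O o -> dom o t -> taff_defined (trans o) t.
Proof. by have [_ h _] := hO => /h[_ _ _ _]; apply. Qed.

Lemma input_triangle o : O o -> exists p q r, Defs.shape o = triangle p q r.
Proof.
have [_ h _] := hO => /h[[p [q [r [_ _ _ e]]]] _ _ _ _].
by exists p, q, r.
Qed.

Lemma moving_edge_dom c : moving_edge O c -> exists x y, has_endpoints (dom c) x y.
Proof. by move=> [ob [e [/input_endpoints h _ ->]]]. Qed.

Lemma moving_edge_defined c t : moving_edge O c -> dom c t -> taff_defined (trans c) t.
Proof. by move=> [ob [e [oo _ ->]]] /(input_defined oo). Qed.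

Lemma moving_edge_segment c : moving_edge O c ->
  exists p q, p <> q /\ Defs.shape c = segment p q.
Proof. by move=> [ob [_ [_ [p [q [_ _ pq ->]]] ->]]]; exists p, q. Qed.

Lemma carrierE c p q t : taff_defined (trans c) t -> p <> q ->
  Defs.shape c = segment p q ->
  let f := taff_at (trans c) t in f p <> f q /\ carrier c t = pline (f p) (f q).
Proof.
move=> /taff_affinity hf pq sc f; have fpq : f p <> f q by move/(affinity_inj hf).
by split=> //; rewrite /carrier /snap sc affinity_segment// line_through_segment.
Qed.

Lemma zeros_const (J : set R) (g : R -> R) : rational_on J g ->
  exists Z : seq R, forall t t', J t -> J t' -> t \notin Z -> t' \notin Z ->
    (g t == 0) = (g t' == 0).
Proof.
move=> /rational_on_zeros[Z [b h]]; exists Z => t t' Jt Jt' tZ tZ'.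
by rewrite !h.
Qed.

Let notin_cat2 (s1 s2 : seq R) t : t \notin s1 ++ s2 -> t \notin s1 /\ t \notin s2.
Proof. by rewrite mem_cat negb_or => /andP[]. Qed.

Definition pair_ok c1 c2 (m : meet_type) t : Prop :=
  has_meet_type (carrier c1 t) (carrier c2 t) m.

(** By [ptype] the type depends only on whether two rational functions of time vanish; the
    exceptional moments come from their zeros and from the denominators. *)
Lemma pair_exceptional c1 c2 : moving_edge O c1 -> moving_edge O c2 ->
  exists Z : seq R, forall m t t', (dom c1 `&` dom c2) t -> (dom c1 `&` dom c2) t' ->
    t \notin Z -> t' \notin Z -> pair_ok c1 c2 m t -> pair_ok c1 c2 m t'.
Proof.
move=> m1 m2; have [p1 [q1 [n1 s1]]] := moving_edge_segment m1.
have [p2 [q2 [n2 s2]]] := moving_edge_segment m2.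
set J := dom c1 `&` dom c2.
have d1 t : J t -> taff_defined (trans c1) t by move=> [/(moving_edge_defined m1)].
have d2 t : J t -> taff_defined (trans c2) t by move=> [_ /(moving_edge_defined m2)].
pose P1 t := taff_at (trans c1) t p1; pose Q1 t := taff_at (trans c1) t q1.
pose P2 t := taff_at (trans c2) t p2; pose Q2 t := taff_at (trans c2) t q2.
have r1 v i := rational_on_taff v i d1; have r2 v i := rational_on_taff v i d2.
have [Z1 h1] : exists Z : seq R, forall t t', J t -> J t' -> t \notin Z -> t' \notin Z ->
    (crs (P1 t) (Q1 t) (P2 t) (Q2 t) == 0) = (crs (P1 t') (Q1 t') (P2 t') (Q2 t') == 0).
  by apply: zeros_const; apply: rational_on_crs => i; solve [exact: r1|exact: r2].
have [Z2 h2] : exists Z : seq R, forall t t', J t -> J t' -> t \notin Z -> t' \notin Z ->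
    (orient (P1 t) (Q1 t) (P2 t) == 0) = (orient (P1 t') (Q1 t') (P2 t') == 0).
  by apply: zeros_const; apply: rational_on_orient => i; solve [exact: r1|exact: r2].
exists (Z1 ++ Z2) => m t t' Jt Jt' /notin_cat2[a1 a2] /notin_cat2[a3 a4].
rewrite /pair_ok.
have [f1 ->] := carrierE (d1 _ Jt) n1 s1; have [f2 ->] := carrierE (d2 _ Jt) n2 s2.
have [f3 ->] := carrierE (d1 _ Jt') n1 s1; have [f4 ->] := carrierE (d2 _ Jt') n2 s2.
rewrite !has_meet_typeP// => ->.
by rewrite /ptype -/(P1 t) -/(Q1 t) -/(P2 t) -/(Q2 t) (h1 t t')// (h2 t t').
Qed.

Definition triple_ok c1 c2 c3 (m : unit) t : Prop :=
  exists v, carrier c1 t `&` carrier c2 t `&` carrier c3 t = [set v].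

Lemma triple_exceptional c1 c2 c3 :
  moving_edge O c1 -> moving_edge O c2 -> moving_edge O c3 ->
  exists Z : seq R, forall m t t', (dom c1 `&` dom c2 `&` dom c3) t ->
    (dom c1 `&` dom c2 `&` dom c3) t' -> t \notin Z -> t' \notin Z ->
    triple_ok c1 c2 c3 m t -> triple_ok c1 c2 c3 m t'.
Proof.
move=> m1 m2 m3; have [p1 [q1 [n1 s1]]] := moving_edge_segment m1.
have [p2 [q2 [n2 s2]]] := moving_edge_segment m2.
have [p3 [q3 [n3 s3]]] := moving_edge_segment m3.
set J := dom c1 `&` dom c2 `&` dom c3.
have d1 t : J t -> taff_defined (trans c1) t by move=> [[/(moving_edge_defined m1)]].
have d2 t : J t -> taff_defined (trans c2) t by move=> [[_ /(moving_edge_defined m2)]].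
have d3 t : J t -> taff_defined (trans c3) t by move=> [_ /(moving_edge_defined m3)].
pose P1 t := taff_at (trans c1) t p1; pose Q1 t := taff_at (trans c1) t q1.
pose P2 t := taff_at (trans c2) t p2; pose Q2 t := taff_at (trans c2) t q2.
pose P3 t := taff_at (trans c3) t p3; pose Q3 t := taff_at (trans c3) t q3.
have r1 v i := rational_on_taff v i d1; have r2 v i := rational_on_taff v i d2.
have r3 v i := rational_on_taff v i d3.
have [Z1 h1] : exists Z : seq R, forall t t', J t -> J t' -> t \notin Z -> t' \notin Z ->
    (crs (P1 t) (Q1 t) (P2 t) (Q2 t) == 0) = (crs (P1 t') (Q1 t') (P2 t') (Q2 t') == 0).
  by apply: zeros_const; apply: rational_on_crs => i; solve [exact: r1|exact: r2|exact: r3].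
have [Z2 h2] : exists Z : seq R, forall t t', J t -> J t' -> t \notin Z -> t' \notin Z ->
    (orient (P1 t) (Q1 t) (P2 t) == 0) = (orient (P1 t') (Q1 t') (P2 t') == 0).
  by apply: zeros_const; apply: rational_on_orient => i; solve [exact: r1|exact: r2|exact: r3].
have [Z3 h3] : exists Z : seq R, forall t t', J t -> J t' -> t \notin Z -> t' \notin Z ->
    (crs (P1 t) (Q1 t) (P3 t) (Q3 t) == 0) = (crs (P1 t') (Q1 t') (P3 t') (Q3 t') == 0).
  by apply: zeros_const; apply: rational_on_crs => i; solve [exact: r1|exact: r2|exact: r3].
have [Z4 h4] : exists Z : seq R, forall t t', J t -> J t' -> t \notin Z -> t' \notin Z ->
    (det3 (P1 t) (Q1 t) (P2 t) (Q2 t) (P3 t) (Q3 t) == 0) =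
    (det3 (P1 t') (Q1 t') (P2 t') (Q2 t') (P3 t') (Q3 t') == 0).
  apply: zeros_const; rewrite /det3; apply: rational_onB; apply: rational_onM;
    [apply: rational_on_crs|apply: rational_on_orient|apply: rational_on_orient|
     apply: rational_on_crs] => i; solve [exact: r1|exact: r2|exact: r3].
exists ((Z1 ++ Z2) ++ (Z3 ++ Z4)) => m t t' Jt Jt'.
move=> /notin_cat2[/notin_cat2[a1 a2] /notin_cat2[a3 a4]].
move=> /notin_cat2[/notin_cat2[b1 b2] /notin_cat2[b3 b4]].
rewrite /triple_ok.
have [f1 ->] := carrierE (d1 _ Jt) n1 s1; have [f2 ->] := carrierE (d2 _ Jt) n2 s2.
have [f3 ->] := carrierE (d3 _ Jt) n3 s3.
have [f4 ->] := carrierE (d1 _ Jt') n1 s1; have [f5 ->] := carrierE (d2 _ Jt') n2 s2.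
have [f6 ->] := carrierE (d3 _ Jt') n3 s3.
rewrite !concurrentP// /concurrent -/(P1 t) -/(Q1 t) -/(P2 t) -/(Q2 t) -/(P3 t) -/(Q3 t).
by rewrite (h1 t t')// (h2 t t')// (h3 t t')// (h4 t t').
Qed.

Lemma finite_edges p q r : finite_set (edge (triangle p q r)).
Proof.
have fS : finite_set [set p; q; r].
  by rewrite !finite_setU; do !split; exact: finite_set1.
apply: (@sub_finite_set _ _ ((fun xy : pt R * pt R => segment xy.1 xy.2) @`
    ([set p; q; r] `*` [set p; q; r]))); last first.
  by apply: finite_image; exact: finite_setX.
move=> e [x [y [/extreme_triangle hx /extreme_triangle hy _ ->]]].
exists (x, y) => //; split=> /=.
  by case: hx => ->; [left; left|left; right|right].
by case: hy => ->; [left; left|left; right|right].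
Qed.

Lemma finite_moving_edges : finite_set (moving_edge O).
Proof.
have [fO _ _] := hO.
apply: (@sub_finite_set _ _ (\bigcup_(o in O)
  ((fun e => Atomic e (dom o) (trans o)) @` edge (Defs.shape o)))).
  by move=> c [ob [e [oo he ->]]]; exists ob => //; exists e.
apply: bigcup_finite => // o /input_triangle[p [q [r ->]]].
by apply: finite_image; exact: finite_edges.
Qed.

Lemma finite_endpoints (K : set R) x y : has_endpoints K x y -> finite_set (endpoint K).
Proof.
move=> h; apply: (@sub_finite_set _ _ [set x; y]).
  by move=> z /(endpoint_or h)[->|->]; [left|right].
by rewrite finite_setU; split; exact: finite_set1.
Qed.

Lemma dom_nbhs c x : moving_edge O c -> dom c x -> ~ endpoint (dom c) x ->
  nbhs x (dom c).
Proof.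
move=> /moving_edge_dom[u [v huv]] dx ne.
apply: (endpoint_nbhs huv) => //; apply/eqP => e; apply: ne.
  by exists v; left; rewrite e.
by exists u; right; rewrite e.
Qed.

(** This makes [fset_set] meaningful in [Partition]. An end point of a maximal interval is either an
    end point of one of the time domains or interior to their intersection; in the latter case
    [maximal_endpoint] puts it among the exceptional moments. *)
Lemma finite_moments : finite_set (partition_moments O).
Proof.
have [fO _ _] := hO; have fM := finite_moving_edges.
have fE c : moving_edge O c -> finite_set (endpoint (dom c)).
  by move=> /moving_edge_dom[x [y /finite_endpoints]].
pose A := \bigcup_(o in O) endpoint (dom o).
pose B2 c1 c2 := [set x | exists K, [/\ (dom c1 `&` dom c2) x,
  maximal_interval (dom c1 `&` dom c2) (pair_constant c1 c2) K & endpoint K x]].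
pose B3 c1 c2 c3 := [set x | exists K, [/\ (dom c1 `&` dom c2 `&` dom c3) x,
  maximal_interval (dom c1 `&` dom c2 `&` dom c3) (triple_concurrent c1 c2 c3) K &
  endpoint K x]].
pose B := \bigcup_(c1 in moving_edge O) \bigcup_(c2 in moving_edge O) B2 c1 c2.
pose C := \bigcup_(c1 in moving_edge O) \bigcup_(c2 in moving_edge O)
  \bigcup_(c3 in moving_edge O) B3 c1 c2 c3.
apply: (@sub_finite_set _ _ (A `|` B `|` C)).
  move=> x [[ob oo ox]|[c1 [c2 [K [[m1 m2] _ Jx mx ex]]]]|
      [c1 [c2 [c3 [K [[m1 m2 m3] _ Jx mx ex]]]]]].
  - by left; left; exists ob.
  - by left; right; exists c1 => //; exists c2 => //; exists K.
  - by right; exists c1 => //; exists c2 => //; exists c3 => //; exists K.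
rewrite !finite_setU; split; first split.
- by apply: bigcup_finite => // o /input_endpoints[x [y /finite_endpoints]].
- apply: bigcup_finite => // c1 m1; apply: bigcup_finite => // c2 m2.
  have [Z hZ] := pair_exceptional m1 m2.
  apply: (@sub_finite_set _ _ ([set` Z] `|` endpoint (dom c1) `|` endpoint (dom c2))).
    move=> x [K [[x1 x2] mx ex]].
    have [e1|e1] := pselect (endpoint (dom c1) x); first by left; right.
    have [e2|e2] := pselect (endpoint (dom c2) x); first by right.
    left; left; apply: (maximal_endpoint (ok := pair_ok c1 c2) _ hZ mx ex) => //.
    by apply: filterI; exact: dom_nbhs.
  by rewrite !finite_setU; do !split; try exact: finite_seq; exact: fE.
- apply: bigcup_finite => // c1 m1; apply: bigcup_finite => // c2 m2.
  apply: bigcup_finite => // c3 m3.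
  have [Z hZ] := triple_exceptional m1 m2 m3.
  apply: (@sub_finite_set _ _ ([set` Z] `|` endpoint (dom c1) `|` endpoint (dom c2) `|`
    endpoint (dom c3))).
    move=> x [K [[[x1 x2] x3] mx ex]].
    have [e1|e1] := pselect (endpoint (dom c1) x); first by left; left; right.
    have [e2|e2] := pselect (endpoint (dom c2) x); first by left; right.
    have [e3|e3] := pselect (endpoint (dom c3) x); first by right.
    left; left; left; apply: (maximal_endpoint (ok := triple_ok c1 c2 c3) _ hZ mx ex) => //.
      move=> K'; split=> [h|[[] h] s /h//]; by exists tt.
    by apply: filterI; [apply: filterI|]; exact: dom_nbhs.
  by rewrite !finite_setU; do !split; try exact: finite_seq; exact: fE.
Qed.

Lemma mem_Partition x : (x \in Partition O) <-> partition_moments O x.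
Proof.
rewrite /Partition mem_sort in_fset_set; last exact: finite_moments.
by rewrite inE.
Qed.

Lemma Partition_sorted : sorted <%R (Partition O).
Proof.
have := @sort_lt_sorted _ _ (fset_set (partition_moments O)).
rewrite fset_uniq => h; exact: h.
Qed.

Lemma Partition_consecutive j : (j.+1 < size (Partition O))%N ->
  (Partition O)`_j < (Partition O)`_j.+1 /\
  forall x, partition_moments O x -> ~ (Partition O)`_j < x < (Partition O)`_j.+1.
Proof.
set chi := Partition O => hj; have st := Partition_sorted.
have lt_nth i k : (i < size chi)%N -> (k < size chi)%N -> (i < k)%N -> chi`_i < chi`_k.
  by move=> hi hk ik; apply: (sorted_ltn_nth lt_trans 0 st).
split; first by apply: lt_nth => //; exact: ltnW.
move=> x /mem_Partition xc /andP[h1 h2].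
have xi : (index x chi < size chi)%N by rewrite index_mem.
have xE : chi`_(index x chi) = x by rewrite nth_index.
have [ij|ji] := leqP (index x chi) j.
  move: ij; rewrite leq_eqVlt => /orP[/eqP ij|ij].
    by move: h1; rewrite -ij xE ltxx.
  have := lt_nth _ _ xi (ltnW hj) ij; rewrite xE => h.
  by have := lt_trans h h1; rewrite ltxx.
move: ji; rewrite leq_eqVlt => /orP[/eqP ij|ij].
  by move: h2; rewrite ij xE ltxx.
have := lt_nth _ _ hj xi ij; rewrite xE => h.
by have := lt_trans h h2; rewrite ltxx.
Qed.

(** The set of times that have a moment on both sides is an interval containing every time domain,
    hence contains the hull of their union. *)
Lemma time_domain_cases t : time_domain O t ->
  t \in Partition O \/ exists2 j, (j.+1 < size (Partition O))%N &
    (Partition O)`_j < t < (Partition O)`_j.+1.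
Proof.
move=> ht; have [x [y [/mem_Partition xm /mem_Partition ym /andP[xt ty]]]] :
    exists x y, [/\ partition_moments O x, partition_moments O y & x <= t <= y].
  move: ht; rewrite /time_domain Rhull_smallest; move: t.
  apply: smallest_sub.
    move=> a b [x [_ [mx _ /andP[xa _]]]] [_ [y [_ my /andP[_ by']]]] z /andP[az zb].
    by exists x, y; split=> //; rewrite (le_trans xa az) (le_trans zb by').
  move=> t [ob oo ot]; have [x [y h]] := input_endpoints oo.
  have [_ _ /(_ _ ot) xy _ _] := has_endpointsP h.
  by exists x, y; split=> //; constructor 1; exists ob => //; [exists y; left|exists x; right].
set chi := Partition O in xm ym *; have st := Partition_sorted.
have [tc|tc] := boolP (t \in chi); [by left|right].
have ty' : t < y by rewrite lt_neqAle ty andbT; apply: contraNneq tc => ->.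
have hf : has (fun z => t < z) chi by apply/hasP; exists y.
pose i := find (fun z => t < z) chi.
have isz : (i < size chi)%N by rewrite -has_find.
have ti : t < chi`_i by exact: (nth_find 0 hf).
have i0 : (0 < i)%N.
  rewrite lt0n; apply/eqP => i0; move: ti; rewrite i0 => t0.
  have x0 : chi`_0 <= x.
    rewrite -(nth_index 0 xm); case: (index x chi) (index_mem x chi) => [//|k].
    rewrite xm => hk; apply/ltW/(sorted_ltn_nth lt_trans 0 st) => //.
    by apply: leq_trans isz.
  by have := lt_le_trans t0 (le_trans x0 xt); rewrite ltxx.
exists i.-1; rewrite prednK// ti andbT.
have hlt : (i.-1 < i)%N by rewrite ltn_predL.
have /negbT := before_find 0 hlt; rewrite -leNgt le_eqVlt => /orP[/eqP e|//].
by exfalso; move/negP: tc; apply; rewrite -e mem_nth// (leq_trans _ isz)// ltnS leq_pred.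
Qed.

Section BetweenMoments.
Variables (a b : R).
Hypothesis noab : forall x, partition_moments O x -> ~ a < x < b.

Lemma dom_dichotomy o : O o ->
  (forall t, a < t < b -> dom o t) \/ (forall t, a < t < b -> ~ dom o t).
Proof.
move=> oo; have [x [y h]] := input_endpoints oo.
have [_ itv le1 h1 h2] := has_endpointsP h.
have nx : ~ a < x < b by apply: noab; constructor 1; exists o => //; exists y; left.
have ny : ~ a < y < b by apply: noab; constructor 1; exists o => //; exists x; right.
have [[t0 [ht0 dt0]]|n] := pselect (exists t, a < t < b /\ dom o t); last first.
  by right => t ht dt; apply: n; exists t.
left => t ht; have /andP[xt0 t0y] := le1 _ dt0.
move: ht0 ht => /andP[at0 t0b] /andP[a_t tb].
have xa : x <= a.
  by rewrite leNgt; apply/negP => ax; apply: nx; rewrite ax (le_lt_trans xt0).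
have yb : b <= y.
  by rewrite leNgt; apply/negP => yb; apply: ny; rewrite yb (lt_le_trans at0).
have [|s1 d1 l1] := h1 (t - x); first by rewrite subr_gt0 (le_lt_trans xa).
have [|s2 d2 l2] := h2 (y - t); first by rewrite subr_gt0 (lt_le_trans tb).
apply: (itv s1 s2) => //; apply/andP; split; lra.
Qed.

Lemma moving_edge_bounded c : moving_edge O c ->
  exists u v, forall t, dom c t -> u <= t <= v.
Proof. by move=> /moving_edge_dom[u [v /has_endpointsP[_ _ h _ _]]]; exists u, v. Qed.

Lemma pair_between c1 c2 m t t' : moving_edge O c1 -> moving_edge O c2 -> c1 <> c2 ->
  (forall s, a < s < b -> dom c1 s) -> (forall s, a < s < b -> dom c2 s) ->
  a < t < b -> a < t' < b -> pair_ok c1 c2 m t -> pair_ok c1 c2 m t'.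
Proof.
move=> m1 m2 ne d1 d2; have [u [v h]] := moving_edge_bounded m1.
apply: (@constant_between _ _ (pair_ok c1 c2) (dom c1 `&` dom c2)
  (pair_constant c1 c2) a b u v) => //.
- move=> m3 m4 s [s1 s2]; apply: has_meet_type_uniq.
  have [p [q [n e]]] := moving_edge_segment m1.
  have [n' ->] := carrierE (moving_edge_defined m1 s1) n e.
  exact: pline_two.
- by move=> s [/h].
- by move=> s; rewrite /= in_itv /= => hs; split; [exact: d1|exact: d2].
- by move=> K x mx ex Jx; apply: noab; constructor 2; exists c1, c2, K.
Qed.

Lemma triple_between c1 c2 c3 t t' :
  moving_edge O c1 -> moving_edge O c2 -> moving_edge O c3 ->
  c1 <> c2 -> c1 <> c3 -> c2 <> c3 ->
  (forall s, a < s < b -> dom c1 s) -> (forall s, a < s < b -> dom c2 s) ->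
  (forall s, a < s < b -> dom c3 s) ->
  a < t < b -> a < t' < b -> triple_ok c1 c2 c3 tt t -> triple_ok c1 c2 c3 tt t'.
Proof.
move=> m1 m2 m3 n12 n13 n23 d1 d2 d3; have [u [v h]] := moving_edge_bounded m1.
apply: (@constant_between _ _ (triple_ok c1 c2 c3) (dom c1 `&` dom c2 `&` dom c3)
  (triple_concurrent c1 c2 c3) a b u v).
- by move=> K'; split=> [h'|[[] h'] s /h'//]; exists tt.
- by move=> [] [].
- by move=> s [[/h]].
- by move=> s; rewrite /= in_itv /= => hs; split; [split; [exact: d1|exact: d2]|exact: d3].
- by move=> K x mx ex Jx; apply: noab; constructor 3; exists c1, c2, c3, K.
Qed.

End BetweenMoments.

End Moments.

(** * Triangulation between two moments *)

Section ObjectScenes.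
Context {R : realType} (O : gobject R).
Hypothesis hO : input_object O.
Implicit Types (p q : pt R) (t s x : R) (T : set (pt R)).

Lemma finite_range (A : Type) (S : set A) : finite_set S ->
  exists N (f : 'I_N -> A), forall x : A, S x <-> exists i, x = f i.
Proof.
move=> [n /card_set_bijP[h [hm hi hs]]].
have ex (i : 'I_n) : exists x : A, S x /\ h x = i.
  by have [x Sx hx] := hs i (ltn_ord i); exists x.
have [f hf] := fin_all_exists ex.
exists n, f; move=> x; split=> [Sx|[i ->]]; last by have [] := hf i.
exists (Ordinal (hm _ Sx)); have [Sf hE] := hf (Ordinal (hm _ Sx)).
by apply: hi; rewrite ?inE// hE.
Qed.

Lemma nondegenerate_affinity (a : pt R -> pt R) T : affinity a ->
  Defs.nondegenerate T -> Defs.nondegenerate (a @` T).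
Proof.
move=> ha [p [q [r [nc ->]]]]; exists (a p), (a q), (a r).
split; last exact: affinity_triangle.
have [k k0 hk] := affinity_orient ha; move/collinearE; rewrite hk => /eqP.
by rewrite mulf_eq0 (negbTE k0) /= => /eqP/collinearE.
Qed.

Lemma image_cancel (A B : Type) (a : A -> B) a' (S : set A) : cancel a a' ->
  a' @` (a @` S) = S.
Proof.
move=> k; rewrite image_comp; apply/seteqP; split=> [_ [x Sx /= <-]|x Sx].
  by rewrite k.
by exists x; rewrite //= k.
Qed.

(* The nondegenerate atomic objects alive throughout J, with corners listed so
   that their snapshots are positively oriented. *)
Record scene (J : set R) (N : nat) := Scene {
  sobj : 'I_N -> atomic R;
  scorner : 'I_N -> 'I_3 -> pt R;
  sobjP : forall i, O (sobj i) /\ forall t, J t -> dom (sobj i) t;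
  sshape : forall i, Defs.shape (sobj i) = tri (scorner i);
  spos : forall i t, J t -> pos3 (fun j => taff_at (trans (sobj i)) t (scorner i j));
  sall : forall o t, O o -> J t -> dom o t -> Defs.nondegenerate (Defs.shape o) ->
    exists i, o = sobj i }.

Definition scene_at J N (S : scene J N) t i j : pt R :=
  taff_at (trans (sobj S i)) t (scorner S i j).

(** The corners are listed once for all of [J]: the second hypothesis keeps the sign of the
    determinant constant, and where it is negative two corners are swapped. *)
Lemma scene_exists (J : set R) :
  (forall o, O o -> (forall t, J t -> dom o t) \/ (forall t, J t -> ~ dom o t)) ->
  (forall o, O o -> (forall t, J t -> dom o t) -> forall t t', J t -> J t' ->
     0 < \det (taff_mx (trans o) t) -> 0 < \det (taff_mx (trans o) t')) ->
  exists N, inhabited (scene J N).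
Proof.
move=> hdom hdet; have [fO _ _] := hO.
have fA : finite_set [set o | [/\ O o, forall t, J t -> dom o t &
    Defs.nondegenerate (Defs.shape o)]].
  by apply: sub_finite_set fO => o [].
have [N [f hf]] := finite_range fA.
have hi i : [/\ O (f i), forall t, J t -> dom (f i) t &
    Defs.nondegenerate (Defs.shape (f i))] by apply/hf; exists i.
have [k hk] : exists k : 'I_N -> 'I_3 -> pt R, forall i,
    Defs.shape (f i) = tri (k i) /\
    forall t, J t -> pos3 (fun j => taff_at (trans (f i)) t (k i j)).
  apply: (@fin_all_exists _ (fun=> 'I_3 -> pt R) (fun i k => Defs.shape (f i) = tri k /\
    forall t, J t -> pos3 (fun j => taff_at (trans (f i)) t (k j)))) => i.
  have [oo od /nondegenerate_tri[k kp sk]] := hi i.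
  have E p q r t : orient (taff_at (trans (f i)) t p) (taff_at (trans (f i)) t q)
      (taff_at (trans (f i)) t r) = \det (taff_mx (trans (f i)) t) * orient p q r.
    by rewrite /taff_at orient_aff.
  have [[t0 [Jt0 d0]]|n] := pselect (exists t, J t /\ 0 < \det (taff_mx (trans (f i)) t)).
    by exists k; split=> // t Jt; rewrite /pos3 E mulr_gt0// (hdet _ oo od t0).
  exists (fun j => if j == 0 then k 1 else if j == 1 then k 0 else k 2%:R).
  split; first by rewrite sk /tri /= triangle_swap.
  move=> t Jt; rewrite /pos3 /= E.
  have [_ _ dn] := input_defined hO oo (od _ Jt).
  have dlt : \det (taff_mx (trans (f i)) t) < 0.
    by rewrite lt_neqAle dn leNgt; apply/negP => h; apply: n; exists t.
  by rewrite nmulr_rgt0// -oppr_gt0 -orientC.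
exists N; apply: inhabits.
apply: (@Scene _ _ f k) => [i|i|i t Jt|o t oo Jt ot nd].
- by have [] := hi i.
- by have [] := hk i.
- by have [_] := hk i; apply.
- by apply/hf; split=> //; have [//|/(_ _ Jt)] := hdom _ oo.
Qed.

Section OneScene.
Variables (J : set R) (N : nat) (S : scene J N).

Let sdef i t : J t -> taff_defined (trans (sobj S i)) t.
Proof. by have [oo od] := sobjP S i => /od h; exact: (input_defined hO oo h). Qed.

Lemma scene_snap i t : J t -> snap (sobj S i) t = tri (scene_at S t i).
Proof.
by move=> /(sdef i)/taff_affinity ha; rewrite /snap sshape affinity_triangle.
Qed.

Lemma scene_pos t : J t -> forall i, pos3 (scene_at S t i).
Proof. by move=> Jt i; exact: spos. Qed.

Lemma scene_triangles t i : J t -> snap_triangles O t (tri (scene_at S t i)).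
Proof.
move=> Jt; exists (sobj S i); last exact: scene_snap.
by have [oo od] := sobjP S i; split=> //; exact: od.
Qed.

(** Here the standing assumption on inputs enters: the degenerate triangles contribute nothing to a
    snapshot. *)
Lemma scene_fig t : J t -> snapshot O t = fig (scene_at S t).
Proof.
move=> Jt; have [_ _ ->] := hO; rewrite figE; last exact: scene_pos.
apply/seteqP; split=> x.
  move=> [_ [[ob [oo ot] <-] nd] hx].
  have ha := taff_affinity (input_defined hO oo ot).
  have [a' [ha' k _]] := affinity_inv ha.
  have nd' : Defs.nondegenerate (Defs.shape ob).
    by rewrite -(image_cancel (Defs.shape ob) k); exact: nondegenerate_affinity.
  have [i oi] := sall S oo Jt ot nd'.
  by exists i => //; rewrite -scene_snap// -oi.
move=> [i _ hx]; exists (tri (scene_at S t i)) => //; split; first exact: scene_triangles.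
by apply/nondegenerate_tri; exists (scene_at S t i) => //; exact: scene_pos.
Qed.

Lemma scene_kept t vs : J t ->
  ts_kept_face (snap_triangles O t) vs <-> good_polygon (snapshot O t) vs.
Proof.
move=> Jt; rewrite (scene_fig Jt); apply: kept_faceP.
- exact: scene_pos.
- exact: scene_fig.
- by move=> i; exact: scene_triangles.
Qed.

Definition sedge (e : 'I_N * 'I_3) : atomic R :=
  Atomic (segment (scorner S e.1 e.2) (scorner S e.1 (e.2 + 1)))
    (dom (sobj S e.1)) (trans (sobj S e.1)).

Lemma sedge_moving e t : J t -> moving_edge O (sedge e).
Proof.
move=> Jt; exists (sobj S e.1), (segment (scorner S e.1 e.2) (scorner S e.1 (e.2 + 1))).
have [oo od] := sobjP S e.1; split=> //.
have ha := taff_affinity (sdef e.1 Jt); have [a' [ha' k _]] := affinity_inv ha.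
have : edge (tri (scene_at S t e.1))
    (segment (scene_at S t e.1 e.2) (scene_at S t e.1 (e.2 + 1))).
  by apply/edge_tri; [exact: scene_pos|exists e.2].
rewrite -(scene_snap _ Jt) => /(edge_affinity ha'); rewrite /snap image_cancel//.
by rewrite affinity_segment// /scene_at !k.
Qed.

Lemma sedge_dom e t : J t -> dom (sedge e) t.
Proof. by have [_ od] := sobjP S e.1; exact: od. Qed.

Lemma sedge_carrier e t : J t ->
  carrier (sedge e) t = [set x | form (scene_at S t) e x = 0].
Proof.
move=> Jt; have n : scorner S e.1 e.2 <> scorner S e.1 (e.2 + 1).
  move=> h; apply: (@end_neq _ _ (scene_at S t) (scene_pos Jt) e).
  by rewrite /scene_at h.
by have [_ ->] := carrierE (c := sedge e) (sdef e.1 Jt) n erefl.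
Qed.

Lemma sedge_snap e t : J t -> snap (sedge e) t =
  segment (scene_at S t e.1 e.2) (scene_at S t e.1 (e.2 + 1)).
Proof. by move=> /(sdef e.1)/taff_affinity ha; rewrite /snap /= affinity_segment. Qed.

Lemma scene_corner_rational i j l : rational_on J (fun t => scene_at S t i j l 0).
Proof. by apply: rational_on_taff => t; exact: sdef. Qed.

End OneScene.

(** A single moment is a possible domain of a scene, with the constancy conditions trivial. *)
Lemma kept_at t vs :
  ts_kept_face (snap_triangles O t) vs <-> good_polygon (figure (snap_triangles O t)) vs.
Proof.
have [||N [S]] := @scene_exists [set t].
- by move=> o oo; have [h|h] := pselect (dom o t); [left|right] => _ ->.
- by move=> o oo _ t1 t2 -> ->.
exact: (scene_kept S).
Qed.

Section IntervalScene.
Variables (a b : R).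
Hypothesis noab : forall x, partition_moments O x -> ~ a < x < b.
Let J : set R := [set` `]a, b[].

Let JE t : J t <-> a < t < b. Proof. by rewrite /J /= in_itv. Qed.

Let nbhsJ t : J t -> nbhs t J.
Proof. by move=> Jt; apply: open_nbhs_nbhs; split=> //; exact: itv_open. Qed.

Lemma interval_scene : exists N, inhabited (scene J N).
Proof.
apply: scene_exists => [ob oo|ob oo od t t' Jt Jt' d].
  by have [h|h] := dom_dichotomy hO noab oo; [left|right] => t /(iffLR (JE t)); exact: h.
have dn s : J s -> \det (taff_mx (trans ob) s) != 0.
  by move=> /od/(input_defined hO oo)[].
rewrite -(sg_gt0 (a := \det (taff_mx (trans ob) t)))//.
apply: (@sg_constant _ a b (fun s => \det (taff_mx (trans ob) s))).
- move=> s /(iffRL (JE s)) Js; apply: (rational_on_continuous (nbhsJ Js)).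
  have hM i j : rational_on J (fun s => taff_mx (trans ob) s i j).
    exists ((trans ob).1 i j) => r /od/(input_defined hO oo)[h _ _].
    by split; [exact: h|rewrite mxE].
  have : rational_on J (fun s => taff_mx (trans ob) s 0 0 * taff_mx (trans ob) s 1 1 -
     taff_mx (trans ob) s 0 1 * taff_mx (trans ob) s 1 0).
    by apply: rational_onB; apply: rational_onM.
  by apply: rational_on_eq => r _; rewrite det_mx22.
- by move=> s s' /(iffRL (JE s))/dn/eqP.
- exact: (iffLR (JE t)).
- exact: (iffLR (JE t')).
Qed.

Variables (N : nat) (S : scene J N).
Local Notation c := (scene_at S).
Local Notation E := (sedge S).

Let eneq t e : J t -> c t e.1 e.2 <> c t e.1 (e.2 + 1).
Proof. by move=> Jt; apply: end_neq; exact: scene_pos. Qed.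

Let epline e t : J t -> carrier (E e) t = pline (c t e.1 e.2) (c t e.1 (e.2 + 1)).
Proof. exact: sedge_carrier. Qed.

(** The partition compares distinct elements only; an element always meets itself in a line. *)
Lemma carrier_between c1 c2 t t' : moving_edge O c1 -> moving_edge O c2 ->
  (forall s, J s -> dom c1 s) -> (forall s, J s -> dom c2 s) ->
  J t -> J t' -> forall m, pair_ok c1 c2 m t -> pair_ok c1 c2 m t'.
Proof.
move=> m1 m2 d1 d2 Jt Jt' m; have [e|ne] := pselect (c1 = c2).
  rewrite /pair_ok -e => h; have [p [q [n sc]]] := moving_edge_segment m1.
  have [n' cE] := carrierE (moving_edge_defined hO m1 (d1 _ Jt)) n sc.
  have : m = MeetLine.
    apply: has_meet_type_uniq h _; last by [].
    by rewrite cE; exact: pline_two.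
  by move=> ->.
exact: (pair_between hO noab m1 m2 ne (fun s h => d1 s (iffRL (JE s) h))
  (fun s h => d2 s (iffRL (JE s) h)) (iffLR (JE t) Jt) (iffLR (JE t') Jt')).
Qed.

Let ept t e e' := ptype (c t e.1 e.2) (c t e.1 (e.2 + 1)) (c t e'.1 e'.2) (c t e'.1 (e'.2 + 1)).

Let ept_const t t' e e' : J t -> J t' -> ept t e e' = ept t' e e'.
Proof.
move=> Jt Jt'; apply/has_meet_typeP; try exact: eneq.
rewrite -!epline//; apply: (carrier_between (t := t)) => //; try exact: sedge_moving Jt.
- by move=> s; exact: sedge_dom.
- by move=> s; exact: sedge_dom.
- by rewrite /pair_ok !epline//; apply/has_meet_typeP => //; exact: eneq.
Qed.

Let ecrs_const t t' e e' : J t -> J t' ->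
  (ecrs (c t) e e' != 0) = (ecrs (c t') e e' != 0).
Proof.
move=> Jt Jt'; have := ept_const e e' Jt Jt'; rewrite /ept /ptype /ecrs.
by do 2 (case: (_ != 0)) => //; case: (_ == 0).
Qed.

Let coin_line t e e' : J t -> coin (c t) e e' <->
  pline (c t e.1 e.2) (c t e.1 (e.2 + 1)) = pline (c t e'.1 e'.2) (c t e'.1 (e'.2 + 1)).
Proof.
move=> Jt; split=> [h|h].
  by apply/seteqP; split=> x /=; move/(coin_form0 (scene_pos S Jt) x h).
have hp (x : pt R) : pline (c t e.1 e.2) (c t e.1 (e.2 + 1)) x -> form (c t) e' x = 0.
  by rewrite h.
by split; apply: hp; [exact: orientl|exact: orientr].
Qed.

Let coin_const t t' e e' : J t -> J t' -> coin (c t) e e' -> coin (c t') e e'.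
Proof.
move=> Jt Jt' /(coin_line _ _ Jt) h; apply/coin_line => //.
have : MeetLine = ept t e e' by apply/has_meet_typeP => //; exact: eneq.
by rewrite (ept_const _ _ Jt Jt') => /has_meet_typeP; apply; exact: eneq.
Qed.

Lemma vtx_rational e e' l t : J t -> ecrs (c t) e e' != 0 ->
  rational_on J (fun s => vtx (c s) e e' l 0).
Proof.
move=> Jt ne; apply: rational_on_meet => [i|i|i|i|s Js];
  try exact: scene_corner_rational.
by have := ecrs_const e e' Jt Js; rewrite ne /ecrs => <-.
Qed.

Let conc_const t t' e e' e2 : J t -> J t' -> ecrs (c t) e e' != 0 ->
  form (c t) e2 (vtx (c t) e e') = 0 -> form (c t') e2 (vtx (c t') e e') = 0.
Proof.
move=> Jt Jt' ne h; have ne' : ecrs (c t') e e' != 0 by rewrite -(ecrs_const e e' Jt Jt').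
have cE s e3 : J s -> forall x : pt R, carrier (E e3) s x <-> form (c s) e3 x = 0.
  by move=> Js x; rewrite sedge_carrier.
(* Different indices can give the same moving edge, for instance if two objects share an edge, time
   domain and transformation; [triple_between] is about distinct ones. *)
have [e12|n12] := pselect (E e = E e').
  exfalso; have cc : coin (c t) e e'.
    by apply/coin_line => //; rewrite -!epline// e12.
  by move: ne; rewrite /ecrs (coin_crs cc.1 cc.2) eqxx.
have [e13|n13] := pselect (E e = E e2).
  by apply/(cE t') => //; rewrite -e13; apply/cE => //; exact: vtx_l.
have [e23|n23] := pselect (E e' = E e2).
  by apply/(cE t') => //; rewrite -e23; apply/cE => //; exact: vtx_r.
have T s : J s -> ecrs (c s) e e' != 0 ->
    carrier (E e) s `&` carrier (E e') s = [set vtx (c s) e e'].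
  by move=> Js nes; rewrite !epline//; exact: plineI.
have [|v] := triple_between hO noab (sedge_moving S e Jt) (sedge_moving S e' Jt)
  (sedge_moving S e2 Jt) n12 n13 n23 (fun s hs => sedge_dom S e (iffRL (JE s) hs))
  (fun s hs => sedge_dom S e' (iffRL (JE s) hs))
  (fun s hs => sedge_dom S e2 (iffRL (JE s) hs)) (iffLR (JE t) Jt) (iffLR (JE t') Jt').
  exists (vtx (c t) e e'); rewrite T//; apply/seteqP; split=> [x []//|_ ->].
  by split=> //; apply/cE.
rewrite T// => hv; have : [set v] v by [].
by rewrite -hv => -[-> /(cE t' e2 Jt')].
Qed.

Lemma scene_same_type t t' : J t -> J t' -> same_type (c t) (c t').
Proof.
move=> Jt Jt'; split=> [e e'|e e'|e e' e2 ne|e e' cc].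
- exact: ecrs_const.
- by split; exact: coin_const.
- apply: (@sg_constant _ a b (fun s => form (c s) e2 (vtx (c s) e e'))).
  + move=> s /(iffRL (JE s)) Js; apply: (rational_on_continuous (nbhsJ Js)).
    apply: rational_on_orient => i; try exact: scene_corner_rational.
    exact: vtx_rational Jt ne.
  + move=> s s' /(iffRL (JE s)) Js /(iffRL (JE s')) Js'; apply: conc_const => //.
    by rewrite -(ecrs_const e e' Jt Js).
  + exact: (iffLR (JE t)).
  + exact: (iffLR (JE t')).
- apply: (@sg_constant _ a b (fun s => form (c s) e' (apex (c s) e))).
  + move=> s /(iffRL (JE s)) Js; apply: (rational_on_continuous (nbhsJ Js)).
    by apply: rational_on_orient => i; exact: scene_corner_rational.
  + move=> s s' /(iffRL (JE s)) Js _ h; exfalso.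
    have cs := coin_const Jt Js cc.
    have := iffRL (coin_form0 (scene_pos S Js) _ cs) h.
    by have := form_apex (scene_pos S Js) e => + e0; rewrite e0 ltxx.
  + exact: (iffLR (JE t)).
  + exact: (iffLR (JE t')).
Qed.

Hypothesis ab : a < b.
Local Notation tm := ((a + b) / 2).

Let Jtm : J tm.
Proof. by apply/JE; have [-> ->] := midf_lt ab. Qed.

Let vtx_coin e1 e2 e1' e2' : coin (c tm) e1 e1' -> coin (c tm) e2 e2' ->
  ecrs (c tm) e1 e2 != 0 ->
  ecrs (c tm) e1' e2' != 0 /\ vtx (c tm) e1 e2 = vtx (c tm) e1' e2'.
Proof.
have ps := scene_pos S Jtm; move=> h1 h2 ne.
have z1 : form (c tm) e1' (vtx (c tm) e1 e2) = 0.
  by apply/(coin_form0 ps _ h1); exact: vtx_l.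
have z2 : form (c tm) e2' (vtx (c tm) e1 e2) = 0.
  by apply/(coin_form0 ps _ h2); exact: vtx_r.
have [h|//] := coin_or_vtx ps z1 z2; exfalso.
have [h3 h4] := coin_trans ps (coin_trans ps h1 h) (coin_sym ps h2).
by move: ne; rewrite /ecrs (coin_crs h3 h4) eqxx.
Qed.

(** The active edge may belong to a degenerate object, which is not in the scene. Its carrier at the
    middle moment is the line of a boundary segment, hence of a scene edge, and by [carrier_between]
    the two carriers coincide throughout [J]. *)
Lemma active_edge_form c1 : active_edge O tm c1 ->
  exists e, forall t, J t -> carrier c1 t = [set x | form (c t) e x = 0].
Proof.
move=> [m1 d1 [p [q [pq sb]]]].
have [p1 [q1 [n1 s1]]] := moving_edge_segment m1.
have dJ s : J s -> dom c1 s.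
  have [ob [ed [oo _ c1E]]] := m1; rewrite c1E /= => Js.
  have [h|h] := dom_dichotomy hO noab oo; first by apply: h; exact: (iffLR (JE s)).
  by case: (h _ (iffLR (JE tm) Jtm)); move: d1; rewrite c1E.
have df := moving_edge_defined hO m1 d1.
have [n' cE] := carrierE df n1 s1.
have snE := affinity_segment p1 q1 (taff_affinity df).
have B : bl (fig (c tm)) p q.
  by split=> // y /sb[_]; rewrite (scene_fig S Jtm).
have [e [x [be le]]] := bl_bpoint (scene_pos S Jtm) B.
exists e => t Jt; rewrite -(sedge_carrier S e Jt).
apply: (@carrier_between c1 (E e) tm t m1 (sedge_moving S e Jtm) dJ _ Jtm Jt MeetLine).
  by move=> s; exact: sedge_dom.
rewrite /pair_ok /= cE (sedge_carrier S e Jtm).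
have hp : segment (taff_at (trans c1) tm p1) (taff_at (trans c1) tm q1) p.
  by rewrite -snE -s1; have [] := sb p (@segl _ p q).
have hq : segment (taff_at (trans c1) tm p1) (taff_at (trans c1) tm q1) q.
  by rewrite -snE -s1; have [] := sb q (@segr _ p q).
apply/seteqP; split=> v; rewrite /pline /=.
  by move/(segment_line v pq hp hq)/le.
by move/le/(segment_line v pq hp hq).
Qed.

(** The line of [e1] carries boundary, but possibly not within the edge [e1]; an edge on the same
    line that contains a boundary segment is taken instead. *)
Lemma active_edge_exists e1 : active (c tm) e1 ->
  exists e, coin (c tm) e1 e /\ active_edge O tm (E e).
Proof.
move=> [w /(bpoint_segment (scene_pos S Jtm))[i [k [q [ck wq _ _ sb]]]]].
exists (i, k); split=> //; split.
- exact: sedge_moving Jtm.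
- exact: sedge_dom Jtm.
- by exists w, q; split=> //; rewrite (sedge_snap S _ Jtm) (scene_fig S Jtm).
Qed.

Lemma moving_pointE w m : moving_point O tm J w m -> exists e1 e2,
  [/\ ecrs (c tm) e1 e2 != 0, w = vtx (c tm) e1 e2
    & forall t, J t -> m t = vtx (c t) e1 e2].
Proof.
move=> [c1 [c2 [/active_edge_form[e1 h1] /active_edge_form[e2 h2] hw hm]]].
have sub (A : set (pt R)) (x y : pt R) : A = [set x] -> A = [set y] -> x = y.
  by move=> -> h; have : [set x] x by []; rewrite h.
have ne : ecrs (c tm) e1 e2 != 0.
  have : MeetPoint = ept tm e1 e2.
    apply/has_meet_typeP; try exact: eneq.
    by exists w; rewrite -hw h1// h2.
  by rewrite /ept /ptype /ecrs; case: (_ != 0) => //; case: ifP.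
exists e1, e2; split=> // [|t Jt].
  by apply: sub hw _; rewrite h1// h2//; exact: plineI.
apply: sub (hm t Jt) _; rewrite h1// h2//; apply: plineI.
by rewrite -/(ecrs (c t) e1 e2) -(ecrs_const e1 e2 Jtm Jt).
Qed.

Let kept_fig t vs : J t ->
  ts_kept_face (snap_triangles O t) vs <-> good_polygon (fig (c t)) vs.
Proof. by move=> Jt; rewrite -(scene_fig S Jt); exact: (scene_kept S vs Jt). Qed.

Lemma triangulate_interval_sub t : J t ->
  [set snap o t | o in triangulate_interval O a b] `<=` TS (snap_triangles O t).
Proof.
move=> Jt _ [ob [vs [v [m [kf vin mp [so _] ho]]]] <-].
have [df mc mv mn] := ho t Jt.
have hm w : w \in vs -> exists e1 e2,
    [/\ ecrs (c tm) e1 e2 != 0, w = vtx (c tm) e1 e2 & m w t = vtx (c t) e1 e2].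
  by move=> /mp/moving_pointE[e1 [e2 [? ? h]]]; exists e1, e2; split=> //; exact: h.
have gp := iffLR (kept_fig vs Jtm) kf.
have [gp' inj _] := good_polygon_persist (scene_pos S Jtm) (scene_pos S Jt)
  (scene_same_type Jtm Jt) gp hm.
have [u _ _ _ _] := gp.
exists [seq m w t | w <- vs], (m v t); split.
- exact/kept_fig.
- exact: map_f.
- rewrite /snap so affinity_triangle; last exact: taff_affinity.
  by rewrite mc mv mn (next_map_inj inj).
Qed.

Let centroid_orient (vs : seq (pt R)) v t : J t -> good_polygon (fig (c t)) vs -> v \in vs ->
  orient (centroid vs) v (next vs v) != 0.
Proof.
move=> Jt gp /(good_polygon_side gp).
rewrite /side orient_rot => h; apply: contraTneq h => ->.
by rewrite mul0r ltxx.
Qed.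

Lemma triangulate_interval_sup t : J t ->
  TS (snap_triangles O t) `<=` [set snap o t | o in triangulate_interval O a b].
Proof.
move=> Jt _ [vs' [v' [/(kept_fig _ Jt) gp' v'in ->]]].
have st := scene_same_type Jt Jtm.
have hmu w : exists u, w \in vs' -> exists e1 e2,
    [/\ ecrs (c t) e1 e2 != 0, w = vtx (c t) e1 e2 & u = vtx (c tm) e1 e2].
  have [h|h] := boolP (w \in vs'); last by exists 0.
  have [e1 [e2 [_ _ ne we]]] := good_vertex (scene_pos S Jt) gp' h.
  by exists (vtx (c tm) e1 e2) => _; exists e1, e2.
pose mu w := sval (cid (hmu w)); have muP w := svalP (cid (hmu w)).
have [gp _ sg1] := good_polygon_persist (scene_pos S Jt) (scene_pos S Jtm) st gp' muP.
set vs := map mu vs' in gp.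
(* Off [vs] a constant junk motion makes [m] total, so that the moving centroid is a sum of rational
   functions indexed by all points. *)
have hm w : exists m : R -> pt R, (forall i, rational_on J (fun s => m s i 0)) /\
   (w \in vs -> moving_point O tm J w m /\ exists e1 e2,
     [/\ ecrs (c tm) e1 e2 != 0, w = vtx (c tm) e1 e2 & forall s, m s = vtx (c s) e1 e2]).
  have [h|h] := boolP (w \in vs); last first.
    by exists (fun=> 0); split=> // i; exact: rational_on_cst.
  have [e1 [e2 [a1 a2 ne we]]] := good_vertex (scene_pos S Jtm) gp h.
  have [e1' [c1 b1]] := active_edge_exists a1.
  have [e2' [c2 b2]] := active_edge_exists a2.
  have [ne' ve] := vtx_coin c1 c2 ne.
  exists (fun s => vtx (c s) e1' e2'); split=> [i|_]; first exact: vtx_rational Jtm ne'.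
  have T s : J s -> carrier (E e1') s `&` carrier (E e2') s = [set vtx (c s) e1' e2'].
    move=> Js; rewrite !epline//; apply: plineI.
    by rewrite -/(ecrs (c s) e1' e2') -(ecrs_const e1' e2' Jtm Js).
  split; last by exists e1', e2'; rewrite we ve.
  by exists (E e1'), (E e2'); split=> //; rewrite we ve T.
pose m w := sval (cid (hm w)).
have mR w i : rational_on J (fun s => m w s i 0) by exact: (svalP (cid (hm w))).1.
have mP w : w \in vs -> moving_point O tm J w (m w) /\ exists e1 e2,
     [/\ ecrs (c tm) e1 e2 != 0, w = vtx (c tm) e1 e2 & forall s, m w s = vtx (c s) e1 e2].
  exact: (svalP (cid (hm w))).2.
have per s : J s -> [/\ good_polygon (fig (c s)) [seq m w s | w <- vs],
    {in vs &, injective (m^~ s)} & forall w e, w \in vs ->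
      Num.sg (form (c tm) e w) = Num.sg (form (c s) e (m w s))].
  move=> Js; apply: (good_polygon_persist (scene_pos S Jtm) (scene_pos S Js)
    (scene_same_type Jtm Js) gp (mu := m^~ s)) => w /mP[_ [e1 [e2 [? ? h]]]].
  by exists e1, e2.
(* Going to the middle moment and back is the identity: a vertex at [t] is the common zero of two
   forms, and these zeros persist both ways. *)
have mt w : w \in vs' -> m (mu w) t = w.
  move=> h; have [e1 [e2 [ne we _]]] := muP w h.
  have [_ _ sg2] := per t Jt.
  have z e : form (c t) e w = 0 -> form (c t) e (m (mu w) t) = 0.
    move=> ez; apply/eqP; rewrite -(sg_eq0 (sg2 _ _ (map_f _ h))).
    by rewrite -(sg_eq0 (sg1 _ _ h)) ez.
  rewrite [RHS]we; apply: vtx_uniq => //; apply: z; rewrite we.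
    exact: vtx_l.
  exact: vtx_r.
have vin : mu v' \in vs by exact: map_f.
have [u _ _ _ _] := gp.
have cR i : rational_on J (fun s => centroid [seq m w s | w <- vs] i 0).
  have h := rational_onM (rational_on_cst J (size vs)%:R^-1)
    (rational_on_sum vs (f := fun w s => m w s i 0) (fun w => mR w i)).
  apply: rational_on_eq h => s _; rewrite /centroid !mxE size_map; congr (_ * _).
  by rewrite summxE [RHS]big_map.
(* The moving polygon stays good, so its centroid and two consecutive vertices are never collinear
   during [J] and determine an affinity at each moment. *)
have [s Js|f hf] := taff_interpolate (centroid_orient Jtm gp vin) cR (mR (mu v'))
  (mR (next vs (mu v'))).
  have [gps inj _] := per s Js.
  by rewrite -(next_map_inj inj)//; apply: (centroid_orient Js) => //; exact: map_f.
have vsE : [seq m w t | w <- vs] = vs'.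
  by rewrite -map_comp; apply: map_id_in => w /mt.
exists (Atomic (triangle (centroid vs) (mu v') (next vs (mu v'))) J f).
  exists vs, (mu v'), m; split=> //; first exact/(kept_fig _ Jtm).
  by move=> w /mP[].
have [df e1 e2 e3] := hf t Jt; have [_ inj _] := per t Jt.
rewrite /snap /= affinity_triangle; last exact: taff_affinity.
by rewrite e1 e2 e3 -(next_map_inj inj)// vsE mt.
Qed.

End IntervalScene.

Lemma triangulate_interval_TS a b t :
  (forall x, partition_moments O x -> ~ a < x < b) -> a < t < b ->
  [set snap o t | o in triangulate_interval O a b] = TS (snap_triangles O t).
Proof.
move=> noab atb; have ab : a < b by case/andP: atb => h1 h2; exact: lt_trans h1 h2.
have Jt : [set` `]a, b[] t by rewrite /= in_itv.
have [N [S]] := interval_scene noab.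
by apply/seteqP; split; [exact: (triangulate_interval_sub noab S)
  |exact: (triangulate_interval_sup noab S)].
Qed.
Lemma taff_at_id t (v : pt R) : taff_at taff_id t v = v.
Proof.
have r1 (x : R) : reval (FracField.tofrac x%:P) t = x.
  have h : (1 : {poly R}).[t] != 0 by rewrite hornerC oner_eq0.
  by rewrite (revalE (p := x%:P) h) ?tofrac1 ?divr1// !hornerC divr1.
have r0 : reval 0 t = 0 by have := r1 0; rewrite polyC0 tofrac0.
have r11 : reval 1 t = 1 by have := r1 1; rewrite polyC1 tofrac1.
have e1 : taff_mx taff_id t = 1%:M :> 'M[R]_2.
  apply/matrixP => i j; rewrite !mxE; case: eqP => _; rewrite ?mulr1n ?mulr0n.
    exact: r11.
  exact: r0.
have e2 : map_mx (reval^~ t) (taff_id (R := R)).2 = 0 :> pt R.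
  by apply/matrixP => i j; rewrite !mxE r0.
by rewrite /taff_at e1 e2 mul1mx addr0.
Qed.

Lemma snap_id T x t : snap (Atomic T [set x] (@taff_id R)) t = T.
Proof.
rewrite /snap /=; apply/seteqP; split=> [_ [v Tv <-]|v Tv]; first by rewrite taff_at_id.
by exists v; rewrite ?taff_at_id.
Qed.

Lemma snap_triangles_Triangulate t : time_domain O t ->
  snap_triangles (Triangulate O (Partition O)) t = TS (snap_triangles O t).
Proof.
move=> /(time_domain_cases hO) ht.
have sub ob : Triangulate O (Partition O) ob -> dom ob t ->
    TS (snap_triangles O t) (snap ob t).
  move=> [[x _ [T hT <-]] /= ->|[j hj ho] dt]; first by rewrite snap_id.
  have [_ noab] := Partition_consecutive hO hj.
  have dE : dom ob = [set` `](Partition O)`_j, (Partition O)`_j.+1[].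
    by have [vs [v [m [_ _ _ [_ ->] _]]]] := ho.
  have tj : (Partition O)`_j < t < (Partition O)`_j.+1.
    by move: dt; rewrite dE /= in_itv.
  by rewrite -(triangulate_interval_TS noab tj); exists ob.
apply/seteqP; split=> [_ [ob [h1 h2] <-]|T]; first exact: sub.
case: ht => [tin hT|[j hj tj]].
  exists (Atomic T [set t] taff_id); last exact: snap_id.
  by split=> //; left; exists t => //; exists T.
have [_ noab] := Partition_consecutive hO hj.
rewrite -(triangulate_interval_TS noab tj) => -[ob ho <-]; exists ob => //; split.
  by right; exists j.
by have [vs [v [m [_ _ _ [_ ->] _]]]] := ho; rewrite /= in_itv.
Qed.

End ObjectScenes.

(** * Merging *)

Section MergeSnapshots.
Context {R : realType}.
Implicit Types (G : gobject R) (E N J K : set R) (t x : R).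

Lemma snap_triangles_absorb G J K :
  (forall t, K t ->
     [set snap ob t | ob in objs_on G K] = [set snap ob t | ob in objs_on G J]) ->
  snap_triangles (absorb G J K) = snap_triangles G.
Proof.
move=> h; apply/funext => t; apply/seteqP; split=> [_ [ob [go dt] <-]|_ [ob [go dt] <-]].
  case: go dt => [[go _] dt|[ob' [go' dJ] ->] /= [Jt|Kt]].
  - by exists ob.
  - by exists ob' => //; split=> //; rewrite dJ.
  - have : [set snap ob t | ob in objs_on G J] (snap ob' t) by exists ob'.
    by rewrite -h// => -[ob2 [go2 dK] e]; exists ob2 => //; split=> //; rewrite dK.
have [dJ|nJ] := pselect (dom ob = J).
  exists (Atomic (Defs.shape ob) (J `|` K) (trans ob)) => //; split.
    by right; exists ob.
  by left; rewrite -dJ.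
have [dK|nK] := pselect (dom ob = K); last by exists ob => //; split=> //; left.
have Kt : K t by rewrite -dK.
have : [set snap ob t | ob in objs_on G K] (snap ob t) by exists ob.
rewrite h// => -[ob' ho' e].
exists (Atomic (Defs.shape ob') (J `|` K) (trans ob')); last exact: e.
by split; [right; exists ob'|right].
Qed.

Lemma snap_triangles_point G x J : mergeable_point G x J ->
  snap_triangles (absorb G J [set x]) = snap_triangles G.
Proof.
move=> [phi [[hf _ hs] h]]; apply: snap_triangles_absorb => _ ->.
apply/seteqP; split=> [_ [ob /hs[ob' ho' <-] <-]|_ [ob ho <-]].
  by exists ob' => //; have [_ ->] := h _ ho'; rewrite snap_id.
by exists (phi ob); [exact: hf|have [_ ->] := h _ ho; rewrite snap_id].
Qed.

Lemma snap_triangles_intervals G E N : mergeable_intervals G E N ->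
  snap_triangles (absorb G E N) = snap_triangles G.
Proof.
move=> [_ _ _ [x [phi [_ _ [hf _ hs] h]]]]; apply: snap_triangles_absorb => t Nt.
have sn ob : objs_on G E ob -> snap ob t = snap (phi ob) t.
  move=> /h[_ [g [_ hg hE]]]; rewrite /snap -hg image_comp.
  by apply: eq_imagel => v _ /=; apply: hE; right.
apply/seteqP; split=> [_ [ob /hs[ob' ho' <-] <-]|_ [ob ho <-]].
  by exists ob' => //; exact: sn.
by exists (phi ob); [exact: hf|rewrite -sn].
Qed.

(** A single step preserves all snapshots from any accumulator, so the induction carries no
    invariant. *)
Lemma snap_triangles_Merge G chi : snap_triangles (Merge G chi) = snap_triangles G.
Proof.
rewrite /Merge; case: (time_elements chi) => // E Ns.
elim: Ns G E => //= N Ns IH G E; rewrite /merge_step.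
case: asboolP => [[x -> hm]|_]; first by rewrite IH snap_triangles_point.
case: asboolP => [[x -> hm]|_]; first by rewrite IH snap_triangles_point.
case: asboolP => [hm|_]; first by rewrite IH snap_triangles_intervals.
exact: IH.
Qed.

Lemma snap_triangles_TST (O : gobject R) t : input_object O -> time_domain O t ->
  snap_triangles (TST O) t = TS (snap_triangles O t).
Proof.
move=> hO ht; rewrite -(snap_triangles_Triangulate hO ht) /TST.
by case: ifP => // _; rewrite snap_triangles_Merge.
Qed.

End MergeSnapshots.

Theorem mainTheorem13 (R : realType) (O O' : gobject R)
    (alpha : R -> pt R -> pt R) :
  input_object O -> input_object O' ->
  (forall t0, (time_domain O `&` time_domain O') t0 ->
     affinity (alpha t0) /\ alpha t0 @` snapshot O t0 = snapshot O' t0) ->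
  forall t0, (time_domain O `&` time_domain O') t0 ->
    [set alpha t0 @` T | T in snap_triangles (TST O) t0]
    = snap_triangles (TST O') t0.
Proof.
move=> hO hO' h t0 ht0; have [ha e] := h _ ht0; have [h1 h2] := ht0.
rewrite !snap_triangles_TST//; apply: TS_affinity ha e _ _ => vs; exact: kept_at.
Qed.
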